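(* Let $\alpha$ and $\beta$ be algebraic numbers; put $\mathbb{K}=\mathbb{Q}(\alpha,\beta)$ and $D=[\mathbb{K}:\mathbb{Q}]$. Let $A$ and $E$ be positive real numbers with $E\ge e$ and $$\log A\ge\max\bigl(h(\alpha),\,D^{-1}\log E,\,D^{-1}|\beta|E\bigr).$$ 1) If $\beta\neq0$, then $$|e^{\beta}-\alpha|\ge\exp\Bigl(-105500\, D^2\log A\,\bigl(h(\beta)+\log_+\log A+\log D+\log E\bigr)\bigl(D\log D+\log E\bigr)(\log E)^{-2}\Bigr).$$ 2) If $\alpha\neq0$ and $\log\alpha$ is any non-zero determination of the logarithm of $\alpha$, then $$|\beta-\log\alpha|\ge\exp\Bigl(-105500\, D^2\log A\,\bigl(h(\beta)+\log_+\log A+\log D+\log E\bigr)\bigl(D\log D+\log E\bigr)(\log E)^{-2}\Bigr).$$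
   Context: Logarithms are natural and $\log_+x=\log\max(1,x)$. For an algebraic number $\gamma$ of degree $d$ with minimal polynomial $a_0x^d+\cdots+a_d=a_0(x-\gamma_1)\cdots(x-\gamma_d)\in\mathbb{Z}[x]$ (irreducible, coprime integer coefficients, $a_0>0$), the absolute logarithmic Weil height is $h(\gamma)=\frac1d\bigl(\log|a_0|+\sum_{i=1}^d\log\max\{1,|\gamma_i|\}\bigr)$. *)

(* Defs.v *)
From HB Require Import structures.
From mathcomp Require Import all_boot all_order all_algebra all_field.
From mathcomp Require Import complex.
From mathcomp Require Import boolp classical_sets reals sequences exp trigo.

Set Implicit Arguments.
Unset Strict Implicit.
Unset Printing Implicit Defensive.

Import Order.TTheory GRing.Theory Num.Theory.
Local Open Scope ring_scope.
Local Open Scope complex_scope.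

Notation algebraic_number := (algebraicOver ratr).

(* The norm `|z| of R[i] is valued in R[i]; normc is the R-valued modulus. *)
Notation normc := ComplexField.Normc.normc.

Definition cexp (R : realType) (z : R[i]) : R[i] :=
  let: x +i* y := z in (expR x * cos y) +i* (expR x * sin y).

Definition ln_plus (R : realType) (x : R) : R := ln (Num.max 1 x).

(* zcontents p carries the sign of lead_coef p, so zcontents p = 1 says that
   the coefficients of p are coprime and that its leading one is positive. *)
Definition is_int_minpoly (R : realType) (g : R[i]) (p : {poly int}) : Prop :=
  [/\ irreducible_poly (map_poly intr p : {poly rat}),
      zcontents p = 1 & root (map_poly intr p) g].

(* The default value 0 is only reached when g is transcendental. *)
Definition int_minpoly (R : realType) (g : R[i]) : {poly int} :=
  xget 0 [set p | is_int_minpoly g p]%classic.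

Lemma min_poly_exists (R : realType) (g : R[i]) : algebraic_number g ->
  exists r : {poly rat}, [/\ irreducible_poly r, r != 0
    & root (map_poly ratr r) g].
Proof.
case=> p0 nz0 r0.
have exn : exists n, `[< exists p : {poly rat}, [/\ p != 0,
    root (map_poly (ratr : rat -> R[i]) p) g & size p = n] >].
  by exists (size p0); apply/asboolP; exists p0.
case: (ex_minnP exn) => n /asboolP[r [nzr rr szr]] minr.
exists r; split => //.
apply/(subfx_irreducibleP rr nzr) => q rq nzq; rewrite szr.
by apply: minr; apply/asboolP; exists q.
Qed.

Lemma int_minpolyP (R : realType) (g : R[i]) : algebraic_number g ->
  is_int_minpoly g (int_minpoly g).
Proof.
move=> /min_poly_exists[r [irr nzr rg]].
apply: (xgetPex 0 (P := [set p | is_int_minpoly g p]%classic)) => /=.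
have [q [a nza Dr]] := rat_poly_scale r.
have nzq : q != 0.
  by apply: contraNneq nzr => q0; rewrite Dr q0 map_poly0 scaler0.
have Dq : map_poly intr q =
    (zcontents q)%:~R *: map_poly intr (zprimitive q) :> {poly rat}.
  by rewrite {1}[q]zpolyEprim map_polyZ.
have nzc : (zcontents q)%:~R != 0 :> rat by rewrite intr_eq0 zcontents_eq0.
set b : rat := a%:~R^-1 * (zcontents q)%:~R.
have nzb : b != 0.
  by apply: mulf_neq0 => //; rewrite invr_eq0 intr_eq0.
have Dr' : r = b *: map_poly intr (zprimitive q) by rewrite Dr Dq scalerA.
exists (zprimitive q); split.
- have eqrz : r %= map_poly intr (zprimitive q) by rewrite Dr' eqp_scale.
  case: irr => sz H; split; first by rewrite -(eqp_size eqrz).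
  by move=> d szd; rewrite -(eqp_dvdr _ eqrz) => /(H _ szd) /eqp_trans; apply.
- by rewrite zcontents_primitive nzq.
- move: rg; rewrite Dr' map_polyZ rootZ ?fmorph_eq0 // -map_poly_comp.
  by under eq_map_poly do rewrite /= ratr_int.
Qed.

Definition complex_roots (R : realType) (p : {poly R[i]}) : seq R[i] :=
  sval (closed_field_poly_normal p).

Definition weil_height (R : realType) (g : R[i]) : R :=
  let p := int_minpoly g in
  (ln (`|lead_coef p|%:~R)
   + \sum_(z <- complex_roots (map_poly intr p)) ln (Num.max 1 (normc z)))
  / (size p).-1%:R.

(* D = [Q(a, b) : Q], where Q(a, b) is presented as an abstract number field K
   with an embedding iota into R[i] whose image is generated by a and b. *)
Definition is_adjoin_degree (R : realType) (a b : R[i]) (D : nat) : Prop :=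
  exists (K : fieldExtType rat) (iota : {rmorphism K -> R[i]}) (x y : K),
    [/\ iota x = a, iota y = b, <<1 & [:: x; y]>>%VS = fullv
      & D = \dim {:K}].

Lemma adjoin_degree_exists (R : realType) (a b : R[i]) :
  algebraic_number a -> algebraic_number b ->
  exists D, is_adjoin_degree a b D.
Proof.
case=> [p nzp pa] [q nzq qb].
have [n [[pa' Da] [pb' Db]]] := pchar0_PET nzp pa nzq qb (pchar_num _).
set z := b *+ n - a in Da Db.
have : algebraic_number z.
  have mn (x : R[i]) : algebraic_number x -> algebraic_number (x *+ n).
    move=> ax; rewrite -mulr_natr; apply: algebraic_mul => //.
    by rewrite -(rmorph_nat (ratr : {rmorphism rat -> R[i]})); apply: algebraic_id.
  by apply: algebraic_sub; [apply: mn; exists q | exists p].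
move=> /min_poly_exists[r [irr nzr rz]].
pose K := SubFieldExtType rz irr.
pose iota : {rmorphism K -> R[i]} := @subfx_inj _ _ ratr z r.
pose z1 : K := subfx_root _ z r.
have z1C : iota z1 = z by exact: subfx_inj_root.
pose inK := fieldExt_horner z1.
have inKE s : iota (inK s) = (map_poly ratr s).[z].
  rewrite /inK /= -horner_map z1C -map_poly_comp; congr _.[z].
  by apply: eq_map_poly => c /=; rewrite alg_num_field fmorph_rat.
exists (\dim {:K}), K, iota, (inK pa'), (inK pb').
split=> //; rewrite ?inKE //.
apply/vspaceP=> x; rewrite memvf.
have [s ->] := subfxEroot rz nzr x.
have Dz1 : z1 = inK pb' *+ n - inK pa'.
  by apply: (fmorph_inj iota); rewrite rmorphB rmorphMn /= !inKE Da Db z1C.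
rewrite -[X in X \in _]/(inK s).
elim/poly_ind: s => [|s c IH]; first by rewrite /inK rmorph0 mem0v.
have -> : inK (s * 'X + c%:P) = inK s * z1 + c%:A.
  by rewrite /inK rmorphD rmorphM /= fieldExt_hornerX fieldExt_hornerC.
apply: rpredD; last by rewrite memvZ // -[1]/(1 : K) rpred1.
apply: memvM => //; rewrite Dz1.
by apply: rpredB; rewrite ?rpredMn // seqv_sub_adjoin // !inE eqxx ?orbT.
Qed.

(* Main.v *)
Require Import Defs.
From HB Require Import structures.
From mathcomp Require Import all_boot all_order all_fingroup all_algebra all_field.
From mathcomp Require Import complex.
From mathcomp Require Import boolp classical_sets reals sequences exp trigo topology normedtype.
From mathcomp Require Import zify ring lra.

(** The proof uses interpolation determinants for the functions z^tau e^(t z)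
    at the points s beta with multiplicities.  A linear combination of these
    functions is an exponential polynomial; a Wronskian argument bounds the
    number of its zeros on the group G_a x G_m, so that the matrix of the values
    of the derivatives, written in terms of (s beta, alpha^s), has a nonzero
    maximal minor Delta.  Delta is an integer polynomial in alpha and beta, so
    Liouville's inequality bounds |Delta| from below in terms of heights.
    If e^beta were too close to alpha, Delta would be close to the determinant of
    the true values of these functions; along the dilation z -> zeta z the
    latter vanishes at zeta = 0 to order about L^2/2, where L is the size of
    the minor, whence a small upper bound for |Delta|.  The usual derivatives are
    replaced by operators q(d/dz) for products q of binomial polynomials, whose
    denominators are controlled by lcm(1, ..., K) <= 4^K: this is what produces
    the factor D log D + log E instead of a term depending on the heights.
    The second part follows from the first by e^lambda = alpha, and for
    beta = 0 from Liouville's inequality for alpha - 1. *)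

Set Implicit Arguments.
Unset Strict Implicit.
Unset Printing Implicit Defensive.

Import Order.TTheory GRing.Theory Num.Theory.
Import numFieldNormedType.Exports.

(** * Common multiples of the first integers *)

(** The determinant estimates use no complex analysis. Exponentials are replaced by Taylor
    polynomials with [N] terms, where [N] is at least the size L of the minor and otherwise as large
    as the approximation of [cexp] requires. Orders of vanishing and the Schwarz lemma become
    statements about coefficients. Write w = log E, a = D log A, g = D log D + w and b = h(beta) +
    log_+ log A + log D + w. Integers K, M, S are obtained by rounding up 4 b / w, 20 a / w and 48 g
    / w. The functions have tau < L0 = S M and t < L1 = 16 D K, the operators have degree < S0 = (M
    + 1) L1, and the points are s beta with s < S. Then (S0 - L1) S = L0 L1, which is what the zero
    estimate asks for, and L = L0 L1. The factor D in L1 is there because Liouville's inequality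
    raises the size of Delta to the power D. Per row of the minor the gain is about E^(L/2 - S0),
    while alpha only has to be within about E^(-L) of e^beta; hence an exponent of the order of L w,
    that is D a b g / w^2. *)

Lemma dvdn_pfactors (d n : nat) : 0 < d ->
  (forall p k : nat, prime p -> p ^ k %| d -> p ^ k %| n) -> d %| n.
Proof.
move=> d_gt0 H; have [->|n_gt0] := posnP n; first exact: dvdn0.
apply/dvdn_partP => // p; rewrite mem_primes => /andP[p_pr _].
by rewrite p_part; apply: H; rewrite // -p_part dvdn_part.
Qed.

(** By Legendre's formula the valuation of the binomial coefficient is the sum over [j] of [(a + b)
    %/ p ^ j - a %/ p ^ j - b %/ p ^ j]. No term is negative, and for [e < j <= k] the term is at
    least 1, because [a] and [b] are below [p ^ j] while [a + b] is not. So the valuation is at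
    least [k - e]. *)
Lemma pfactor_dvd_fact_quot (a b m p k : nat) : prime p ->
  (forall j, 0 < j -> a %/ p ^ j + b %/ p ^ j <= (a + b) %/ p ^ j) ->
  m < p ^ k -> p ^ k <= a + b -> a <= m -> b <= m -> 
  forall e, p ^ e <= m -> m < p ^ e.+1 -> p ^ k %| p ^ e * 'C(a + b, a).
Proof.
move=> p_pr super mltk ltk am bm e em me.
have p_gt1 := prime_gt1 p_pr.
have C_gt0 : 0 < 'C(a + b, a) by rewrite bin_gt0 leq_addr.
have fact_gt0 := fact_gt0.
have p_gt0 := prime_gt0 p_pr.
rewrite pfactor_dvdn ?muln_gt0 ?expn_gt0 ?p_gt0 //.
rewrite lognM ?expn_gt0 ?p_gt0 // pfactorK //.
have : logn p (a + b)`! = logn p 'C(a + b, a) + (logn p a`! + logn p b`!).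
  rewrite -(@bin_fact (a + b) a) ?leq_addr // addKn.
  by rewrite lognM ?muln_gt0 ?fact_gt0 // lognM ?fact_gt0.
rewrite !logn_fact //.
have ext n : n <= a + b -> \sum_(1 <= j < n.+1) n %/ p ^ j =
    \sum_(1 <= j < (a + b).+1) n %/ p ^ j.
  move=> nab; rewrite [RHS](@big_cat_nat _ _ _ n.+1) //=.
  rewrite [X in _ = _ + X]big_nat_cond [X in _ = _ + X]big1 ?addn0 // => j /andP[/andP[nj _] _].
  by rewrite divn_small // (leq_trans nj) // ltnW // ltn_expl.
rewrite (ext a) ?leq_addr // (ext b) ?leq_addl // => E.
suff : k - e <= logn p 'C(a + b, a) by lia.
have kab : k < (a + b).+1 by rewrite ltnS (leq_trans _ ltk) // ltnW // ltn_expl.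
rewrite -(leq_add2r (\sum_(1 <= j < (a + b).+1) (a %/ p ^ j + b %/ p ^ j))).
rewrite [X in _ <= _ + X]big_split /= -E.
have ek : e < k by rewrite -(@ltn_exp2l p) // (leq_ltn_trans em).
rewrite -[k - e]muln1 -sum_nat_const_nat.
have sub (F : nat -> nat) : \sum_(1 <= j < (a + b).+1) F j = 
  \sum_(1 <= j < e.+1) F j + (\sum_(e.+1 <= j < k.+1) F j +
   \sum_(k.+1 <= j < (a + b).+1) F j).
  by rewrite -big_cat_nat //= -?big_cat_nat //=; lia.
rewrite !sub.
have le1 u v : 0 < u -> \sum_(u <= j < v) (a %/ p ^ j + b %/ p ^ j) <= \sum_(u <= j < v) (a + b) %/ p ^ j.
  move=> u0; rewrite big_nat_cond [leqRHS]big_nat_cond; apply: leq_sum => j /andP[/andP[uj _] _].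
  by apply: super; lia.
have: \sum_(e.+1 <= j < k.+1) 1 + \sum_(e.+1 <= j < k.+1) (a %/ p ^ j + b %/ p ^ j) <= \sum_(e.+1 <= j < k.+1) (a + b) %/ p ^ j.
  rewrite -big_split /= big_nat_cond [leqRHS]big_nat_cond; apply: leq_sum => j /andP[/andP[ej jk] _].
  have mj : m < p ^ j by rewrite (leq_trans me) // leq_exp2l.
  rewrite (divn_small (leq_ltn_trans am mj)) (divn_small (leq_ltn_trans bm mj)) !addn0.
  rewrite divn_gt0 ?expn_gt0 ?prime_gt0 // (leq_trans _ ltk) // leq_exp2l //.
have := le1 1 e.+1 isT; have := le1 k.+1 (a + b).+1 isT.
rewrite !sum_nat_const_nat. lia.
Qed.

(* Induction from m = n - n./2 to n: a prime having a power in ]m, n] divides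
   binomial(n, m), which is at most 4 ^ (n - m). *)
Lemma common_multiple_exp4 (n : nat) :
  exists2 d, 0 < d <= 4 ^ n & forall i, 0 < i <= n -> i %| d.
Proof.
elim/ltn_ind: n => n IH.
have [n1|n1] := leqP n 1.
  by exists 1 => [|i]; [rewrite expn_gt0 | case: n n1 {IH} => [|[|n]] //; case: i => [|[|i]]].
pose a := n./2; pose m := n - a.
have Dn : n = a + m by rewrite /m /a; lia.
have am : a <= m by rewrite /m /a; lia.
have mn : m < n by rewrite /m /a; lia.
have [d /andP[d0 d4] dP] := IH m mn.
have C_gt0 : 0 < 'C(n, a) by rewrite bin_gt0; lia.
exists (d * 'C(n, a)).
  rewrite muln_gt0 d0 C_gt0 /= [in 4 ^ n]Dn expnD mulnC leq_mul //.
  rewrite Dn.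
  (* For odd [n] the two equal middle coefficients both occur in the row of sum [2 ^ n]; the factor
     2 so saved is needed to reach [4 ^ a]. *)
  have : 'C(a + m, a) * (1 + (a < m)) <= 2 ^ (a + m).
    have := Pascal 1 1 (a + m). rewrite (_ : 1 + 1 = 2) // => ->.
    rewrite (eq_bigr (fun i : 'I_(a + m).+1 => 'C(a + m, i))); last by move=> i _; rewrite !exp1n !muln1.
    have aam : a < (a + m).+1 by lia.
    have mam : m < (a + m).+1 by lia.
    rewrite (bigD1 (Ordinal aam)) //= mulnDr muln1 leq_add2l.
    case: (ltnP a m) => [ltam|]; last by rewrite muln0.
    rewrite (bigD1 (Ordinal mam)) /=; last by rewrite -val_eqE /=; lia.
    by rewrite muln1 -bin_sub ?leq_addr // addKn leq_addr.
  case: (ltnP a m) => [ltam|mam].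
    have -> : m = a.+1 by rewrite /m /a; lia.
    move=> H; rewrite -(@leq_pmul2r 2) //; apply: leq_trans H _.
    by rewrite (_ : 4 = 2 ^ 2) // -expnM -expnSr leq_exp2l //; lia.
  have -> : m = a by lia.
  rewrite addn0 muln1 => H; apply: leq_trans H _.
  by rewrite (_ : 4 = 2 ^ 2) // -expnM leq_exp2l //; lia.
move=> i /andP[i0 i_n]; apply: dvdn_pfactors => // p k p_pr pki.
have [|mpk] := leqP (p ^ k) m.
  by move=> pkm; apply/dvdn_mulr/dP; rewrite expn_gt0 prime_gt0.
have pkn : p ^ k <= n by rewrite (leq_trans _ i_n) // dvdn_leq.
have p_gt1 := prime_gt1 p_pr.
have m0 : 0 < m by rewrite /m /a; lia.
apply: dvdn_trans (_ : p ^ trunc_log p m * 'C(n, a) %| _).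
  rewrite Dn; apply: (@pfactor_dvd_fact_quot a m m) => //.
  - by move=> j _; rewrite divnD ?expn_gt0 ?prime_gt0 // leq_addr.
  - by rewrite -Dn.
  - exact: trunc_logP.
  - exact: trunc_log_ltn.
apply: dvdn_mul => //; apply: dP.
by rewrite expn_gt0 prime_gt0 //= trunc_logP.
Qed.

Local Open Scope ring_scope.

(** * Binomial polynomials *)

Lemma poly_nat_roots (F : numFieldType) (p : {poly F}) :
  (forall n : nat, p.[n%:R] = 0) -> p = 0.
Proof.
move=> p0; apply/eqP/negbNE/negP => nzp.
have := @max_poly_roots F p [seq n%:R | n <- iota 0 (size p)] nzp.
rewrite size_map size_iota ltnn => H; have : false; last by [].
apply: H; first by apply/allP => x /mapP[n _ ->]; rewrite /root p0.
by rewrite map_inj_uniq ?iota_uniq // => m n /eqP; rewrite eqr_nat => /eqP.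
Qed.

Definition binp (j : nat) : {poly rat} :=
  j`!%:R^-1 *: \prod_(i < j) ('X - i%:R%:P).

Lemma binp0 : binp 0 = 1.
Proof. by rewrite /binp big_ord0 fact0 invr1 scale1r. Qed.

Lemma binpS j : j.+1%:R *: binp j.+1 = ('X - j%:R%:P) * binp j.
Proof.
rewrite /binp big_ord_recr /= factS natrM invfM scalerA mulrA divff ?pnatr_eq0 //.
by rewrite mul1r -scalerAr mulrC.
Qed.

Lemma horner_binp j n : (binp j).[n%:R] = 'C(n, j)%:R.
Proof.
elim: j => [|j IH]; first by rewrite binp0 hornerC bin0.
have nz : j.+1%:R != 0 :> rat by rewrite pnatr_eq0.
apply: (mulfI nz); rewrite -hornerZ binpS hornerM hornerXsubC IH.
rewrite -[RHS]natrM mul_bin_left natrM.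
by have [/natrB->//|/bin_small->] := leqP j n; rewrite !mulr0.
Qed.

Lemma size_binp j : size (binp j) = j.+1.
Proof.
by rewrite size_scale ?invr_eq0 ?pnatr_eq0 -?lt0n ?fact_gt0 // size_prod_XsubC ?size_enum_ord /index_enum -?enumT size_enum_ord.
Qed.

Lemma binp_shift j : binp j.+1 \Po ('X + 1%:P) = binp j.+1 + binp j.
Proof.
apply/eqP; rewrite -subr_eq0; apply/eqP/poly_nat_roots => n.
rewrite !(hornerD, hornerN, horner_comp, hornerX, hornerC) [n%:R + 1]natr1 !horner_binp binS natrD.
by rewrite subrr.
Qed.

Lemma deriv_binp0 j : (binp j.+1)^`().[0] = (-1) ^+ j / j.+1%:R.
Proof.
have -> : binp j.+1 = (j.+1)`!%:R^-1 *: ('X * \prod_(i < j) ('X - i.+1%:R%:P)).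
  by rewrite /binp big_ord_recl subr0.
rewrite derivZ derivM derivX mul1r !hornerE horner_prod.
rewrite (eq_bigr (fun i : 'I_j => -1 * i.+1%:R)); last by move=> i _; rewrite !hornerE mulN1r.
rewrite big_split /=.
have -> : \prod_(i < j) i.+1%:R = j`!%:R :> rat.
  by rewrite -natr_prod fact_prod big_add1 big_mkord.
rewrite factS natrM invfM.
rewrite prodr_const card_ord; have nz : j`!%:R != 0 :> rat by rewrite pnatr_eq0 -lt0n fact_gt0.
by rewrite mulrC -mulrA [X in _ * X]mulrCA divff ?mulr1 //.
Qed.

Lemma binpS_0 j : (binp j).[0] = (j == 0)%:R.
Proof. by rewrite (horner_binp j 0) bin0n eq_sym. Qed.

(* The derivative is log(1 + Delta) for the forward difference Delta, and Delta
   lowers the index of binp by one. *)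
Lemma deriv_binp j : (binp j)^`() =
  \sum_(i < j) ((-1) ^+ i / i.+1%:R) *: binp (j - i.+1).
Proof.
elim: j => [|j IH]; first by rewrite binp0 big_ord0 derivC.
apply/eqP; rewrite -subr_eq0; apply/eqP/poly_nat_roots.
set g := _ - _.
(* The difference [g] of the two sides has period 1, so only its value at 0 has to be computed. *)
have gS : g \Po ('X + 1%:P) = g.
  rewrite /g comp_polyB.
  have -> : (binp j.+1)^`() \Po ('X + 1%:P) = (binp j.+1)^`() + (binp j)^`().
    by rewrite -derivD -binp_shift deriv_comp derivD derivX derivC addr0 mulr1.
  rewrite big_ord_recr /= comp_polyD raddf_sum /=.
  rewrite IH subnn binp0 comp_polyZ comp_polyC.
  under eq_bigr => i _.
    rewrite comp_polyZ subSS.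
    have -> : (j - i = (j - i.+1).+1)%N by have := ltn_ord i; lia.
    rewrite binp_shift scalerDr.
  over.
  rewrite big_split /=.
  under [X in _ = _ - (X + _)]eq_bigr => i _.
    rewrite subSS.
    have -> : (j - i = (j - i.+1).+1)%N by have := ltn_ord i; lia.
  over.
  ring.
elim=> [|n IHn]; last first.
  by rewrite -IHn -[in RHS]gS horner_comp; congr (_.[_]); rewrite hornerD hornerX hornerC natr1.
rewrite /g hornerD hornerN horner_sum deriv_binp0 big_ord_recr /= subnn binp0.
rewrite big1 ?add0r; first by rewrite hornerZ hornerC mulr1 subrr.
move=> i _; rewrite hornerZ binpS_0 subSS.
have -> : (j - i == 0)%N = false by have := ltn_ord i; lia.
by rewrite mulr0.
Qed.

(** Imposing the condition on all derivatives at once makes it stable under [d] times the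
    derivation, hence under products by the Leibniz rule. *)
Definition int_derivs (d : nat) (q : {poly rat}) :=
  forall k n : nat, d%:R ^+ k * (q^`(k)).[n%:R] \is a Num.int.

Lemma int_derivs1 d : int_derivs d 1.
Proof.
move=> [|k] n; first by rewrite derivn0 hornerC mulr1 rpred1.
by rewrite -polyC1 derivnC horner0 mulr0 rpred0.
Qed.

Lemma int_derivsM d p q : int_derivs d p -> int_derivs d q -> int_derivs d (p * q).
Proof.
move=> ip iq k; elim: k p q ip iq => [|k IH] p q ip iq n.
  by rewrite derivn0 hornerM expr0 mul1r -[X in X * _]mul1r -[X in _ * X]mul1r rpredM // ?(ip 0%N) ?(iq 0%N).
have ider r : int_derivs d r -> int_derivs d (d%:R *: r^`()).
  by move=> ir j m; rewrite derivnZ hornerZ mulrA -exprSr -derivSn; apply: ir.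
rewrite derivSn exprSr -mulrA -hornerZ -derivnZ derivM scalerDr derivnD hornerD mulrDr.
rewrite scalerAl scalerAr; apply: rpredD; apply: IH => //; exact: ider.
Qed.

(** By [deriv_binp] each derivation introduces only denominators [i.+1 <= K], cleared by one factor
    [d], and leaves binomial polynomials of smaller index. *)
Lemma int_derivs_binp d K j : (0 < d)%N -> (forall i, (0 < i <= K)%N -> (i %| d)%N) ->
  (j <= K)%N -> int_derivs d (binp j).
Proof.
move=> d_gt0 dK jK k; elim: k j jK => [|k IH] j jK n.
  by rewrite derivn0 mul1r horner_binp rpred_nat.
rewrite derivSn deriv_binp (raddf_sum (derivn k)) horner_sum mulr_sumr rpred_sum // => i _.
have iK : (0 < i.+1 <= K)%N by rewrite /= (leq_trans (ltn_ord i)).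
rewrite /= derivnZ hornerZ exprSr.
have /dvdnP[e De] := dK _ iK.
rewrite {2}De natrM.
have -> : d%:R ^+ k * (e%:R * i.+1%:R) * ((-1) ^+ i / i.+1%:R * (binp (j - i.+1))^`(k).[n%:R])
   = (-1) ^+ i * e%:R * (d%:R ^+ k * (binp (j - i.+1))^`(k).[n%:R]) :> rat.
  have nz : i.+1%:R != 0 :> rat by rewrite pnatr_eq0.
  move: (i.+1%:R : rat) nz => x nz; by field.
by rewrite rpredM ?IH // ?rpredM ?rpredX ?rpredN ?rpred1 ?rpred_nat //; lia.
Qed.

(* A basis of the polynomials whose derivatives keep small denominators and
   whose values stay small on an initial segment of the integers. *)
Definition qpol (K sigma : nat) : {poly rat} :=
  binp K ^+ (sigma %/ K) * binp (sigma %% K).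

Lemma int_derivs_qpol d K sigma : (0 < d)%N -> (0 < K)%N ->
  (forall i, (0 < i <= K)%N -> (i %| d)%N) -> int_derivs d (qpol K sigma).
Proof.
move=> d_gt0 K_gt0 dK; apply: int_derivsM; last first.
  by apply: (int_derivs_binp d_gt0 dK); rewrite ltnW // ltn_pmod.
elim: (sigma %/ K)%N => [|a IH]; first exact: int_derivs1.
by rewrite exprS; apply: int_derivsM => //; apply: (int_derivs_binp d_gt0 dK).
Qed.

Lemma size_qpol K sigma : (0 < K)%N -> size (qpol K sigma) = sigma.+1.
Proof.
move=> K_gt0.
have nzb j : binp j != 0 by rewrite -size_poly_eq0 size_binp.
rewrite size_mul ?expf_neq0 // size_binp addnS /=.
have -> : size (binp K ^+ (sigma %/ K)) = (sigma %/ K * K).+1.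
  rewrite -[LHS]prednK ?lt0n ?size_poly_eq0 ?expf_neq0 //.
  by rewrite size_exp size_binp /= mulnC.
by rewrite addSn -divn_eq.
Qed.

(** * The l1 norm of a polynomial *)

Lemma ler_horner (F : numDomainType) (p q : {poly F}) (r : F) :
  0 <= r -> (forall i, p`_i <= q`_i) -> p.[r] <= q.[r].
Proof.
move=> r0 pq; pose n := maxn (size p) (size q).
rewrite (@horner_coef_wide _ n p) ?leq_maxl // (@horner_coef_wide _ n q) ?leq_maxr //.
by apply: ler_sum => i _; rewrite ler_wpM2r ?exprn_ge0.
Qed.

(** It replaces the maximum modulus on the disc of radius [r]: it bounds the values there, is
    submultiplicative, and makes sense over any [numDomainType]. *)
Definition l1n (F : numDomainType) (r : F) (p : {poly F}) : F :=
  (map_poly Num.norm p).[r].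

Section L1.
Variable F : numDomainType.
Implicit Types (r : F) (p q : {poly F}).

Lemma coef_absp p i : (map_poly Num.norm p)`_i = `|p`_i|.
Proof. by rewrite coef_map_id0 // normr0. Qed.

Lemma l1nC r c : l1n r c%:P = `|c|.
Proof.
by rewrite /l1n -[RHS](hornerC _ r); congr _.[r]; apply/polyP => i; rewrite coef_absp !coefC; case: ifP; rewrite ?normr0.
Qed.

Lemma l1n0 r : l1n r 0 = 0.
Proof. by rewrite -polyC0 l1nC normr0. Qed.

Lemma l1n_ge0 r p : 0 <= r -> 0 <= l1n r p.
Proof.
by move=> r0; rewrite -(horner0 r); apply: ler_horner => // i; rewrite coef0 coef_absp normr_ge0.
Qed.

Lemma l1nD r p q : 0 <= r -> l1n r (p + q) <= l1n r p + l1n r q.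
Proof.
move=> r0; rewrite -hornerD; apply: ler_horner => // i.
by rewrite coefD !coef_absp coefD ler_normD.
Qed.

Lemma l1nM r p q : 0 <= r -> l1n r (p * q) <= l1n r p * l1n r q.
Proof.
move=> r0; rewrite -hornerM_comm; last by rewrite /comm_poly mulrC.
apply: ler_horner => // i.
rewrite coefM coef_absp coefM (le_trans (ler_norm_sum _ _ _)) //.
by apply: ler_sum => j _; rewrite !coef_absp normrM.
Qed.

Lemma l1n_sum r (I : Type) (s : seq I) (P : pred I) (f : I -> {poly F}) : 0 <= r ->
  l1n r (\sum_(i <- s | P i) f i) <= \sum_(i <- s | P i) l1n r (f i).
Proof.
move=> r0; elim/big_rec2: _ => [|i y x _ H]; first by rewrite l1n0.
by rewrite (le_trans (l1nD _ _ r0)) // lerD2l.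
Qed.

Lemma l1n_prod r (I : Type) (s : seq I) (P : pred I) (f : I -> {poly F}) : 0 <= r ->
  l1n r (\prod_(i <- s | P i) f i) <= \prod_(i <- s | P i) l1n r (f i).
Proof.
move=> r0; elim/big_rec2: _ => [|i y x _ H]; first by rewrite -polyC1 l1nC normr1.
by rewrite (le_trans (l1nM _ _ r0)) // ler_wpM2l ?l1n_ge0.
Qed.

Lemma l1nX r p n : 0 <= r -> l1n r (p ^+ n) <= l1n r p ^+ n.
Proof. by move=> r0; rewrite -[n]card_ord -!prodr_const l1n_prod. Qed.

Lemma l1nMXn r p n : l1n r (p * 'X^n) = l1n r p * r ^+ n.
Proof.
rewrite /l1n.
have -> : r ^+ n = 'X^n.[r] by rewrite hornerXn.
rewrite -hornerM_comm; last by rewrite /comm_poly mulrC.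
congr _.[r]; apply/polyP => i; rewrite coef_absp !coefMXn coef_absp.
by case: ifP; rewrite ?normr0.
Qed.

Lemma l1nZ r c p : l1n r (c *: p) = `|c| * l1n r p.
Proof.
rewrite /l1n -hornerZ; congr _.[r]; apply/polyP => i.
by rewrite coefZ !coef_absp coefZ normrM.
Qed.

Lemma ler_norm_horner p z : `|p.[z]| <= l1n `|z| p.
Proof.
rewrite /l1n (@horner_coef_wide _ (size p) (map_poly _ p)); last exact: size_poly.
rewrite horner_coef (le_trans (ler_norm_sum _ _ _)) //; apply: ler_sum => i _.
by rewrite coef_absp normrM normrX.
Qed.

(** The Schwarz lemma on coefficients: between the radii 1 and [r], every monomial that occurs grows
    by at least [r ^+ m]. *)
Lemma ler_norm_horner1_vanish r p m : 1 <= r -> (forall i, (i < m)%N -> p`_i = 0) ->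
  `|p.[1]| * r ^+ m <= l1n r p.
Proof.
move=> r1 p0.
have r0 : 0 <= r := le_trans ler01 r1.
rewrite /l1n (@horner_coef_wide _ (size p) (map_poly _ p)); last exact: size_poly.
rewrite horner_coef (le_trans (ler_wpM2r _ (ler_norm_sum _ _ _))) ?exprn_ge0 //.
rewrite mulr_suml; apply: ler_sum => i _.
rewrite coef_absp expr1n mulr1; have [/p0->|mi] := ltnP i m; first by rewrite normr0 !mul0r.
by rewrite ler_wpM2l // ler_weXn2l.
Qed.

Lemma l1n_det r n (M : 'M[{poly F}]_n) W : 0 <= r ->
  (forall i j, l1n r (M i j) <= W) -> l1n r (\det M) <= n`!%:R * W ^+ n.
Proof.
move=> r0 MW; rewrite (le_trans (l1n_sum _ _ _ r0)) //.
rewrite (le_trans (ler_sum _ (G := fun _ => W ^+ n) _)) //.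
  move=> s _.
  rewrite (le_trans (l1nM _ _ r0)) //.
  have sgn (b : nat) : l1n r ((-1) ^+ b) = 1.
    by rewrite -polyC1 -polyCN -polyC_exp l1nC normrX normrN1 expr1n.
  rewrite sgn mul1r (le_trans (l1n_prod _ _ _ r0)) //.
  rewrite (le_trans (ler_prod (E1 := fun i => l1n r (M i (s i))) (E2 := fun _ => W) _ _)) //.
    by move=> i _; rewrite l1n_ge0 ?MW.
  by rewrite prodr_const card_ord.
by rewrite sumr_const card_Sn mulr_natl.
Qed.

Lemma ler_norm_det n (M : 'M[F]_n) W :
  (forall i j, `|M i j| <= W) -> `|\det M| <= n`!%:R * W ^+ n.
Proof.
move=> MW; rewrite -(l1nC 0) -det_map_mx; apply: l1n_det => // i j.
by rewrite mxE l1nC.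
Qed.
End L1.

(** * Zero estimate *)

Lemma coef_prod_top (R : comNzRingType) (I : Type) (s : seq I) (f : I -> {poly R}) (e : I -> nat) :
  (forall i, (size (f i) <= (e i).+1)%N) ->
  (size (\prod_(i <- s) f i)%R <= (\sum_(i <- s) e i).+1)%N /\
  (\prod_(i <- s) f i)`_(\sum_(i <- s) e i)%N = \prod_(i <- s) (f i)`_(e i).
Proof.
move=> fe; elim: s => [|i s [szs cs]]; first by rewrite !big_nil size_poly1 coefC.
rewrite !big_cons; split.
  by rewrite (leq_trans (size_polyMleq _ _)) //; have := fe i; lia.
rewrite coefM.
have ei : (e i < (e i + \sum_(j <- s) e j).+1)%N by rewrite ltnS leq_addr.
rewrite (bigD1 (Ordinal ei)) //= addKn cs [X in _ + X = _]big1 ?addr0 // => j neq.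
have [lt|gt|eq] := ltngtP j (e i); last by case/eqP: neq; apply: val_inj.
  rewrite [X in _ * X]nth_default ?mulr0 // (leq_trans szs) //; lia.
by rewrite nth_default ?mul0r // (leq_trans (fe i)).
Qed.

(** Each term of the Leibniz expansion takes one entry from each column, so the same degree bound
    [\sum_j e j] serves for every permutation. *)
Lemma coef_det_top (R : comNzRingType) n (M : 'M[{poly R}]_n) (e : 'I_n -> nat) :
  (forall i j, (size (M i j) <= (e j).+1)%N) ->
  (size (\det M) <= (\sum_j e j).+1)%N /\
  (\det M)`_(\sum_j e j)%N = \det (\matrix_(i, j) (M i j)`_(e j)).
Proof.
move=> Me.
have sume (s : 'S_n) : (\sum_j e j = \sum_j e (s j))%N by rewrite (reindex_inj (@perm_inj _ s)).
have sg (b : nat) (p : {poly R}) : (-1) ^+ b * p = ((-1) ^+ b : R) *: p.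
  by rewrite -mul_polyC polyC_exp polyCN polyC1.
split.
  rewrite (leq_trans (size_sum _ _ _)) //; apply/bigmax_leqP => s _.
  rewrite sg (leq_trans (size_scale_leq _ _)) //.
  have [] := @coef_prod_top R 'I_n (index_enum 'I_n) (fun i => M i (s i)) (fun i => e (s i)) _.
    by move=> i; apply: Me.
  by rewrite -(sume s).
rewrite coef_sum; apply: eq_bigr => s _; rewrite sg coefZ; congr (_ * _).
have [] := @coef_prod_top R 'I_n (index_enum 'I_n) (fun i => M i (s i)) (fun i => e (s i)) _.
  by move=> i; apply: Me.
rewrite -(sume s) => _ ->; apply: eq_bigr => i _; by rewrite mxE.
Qed.

Lemma dvdp_prod_XsubC_exp (F : fieldType) (xs : seq F) (m : nat) (p : {poly F}) :
  uniq xs -> (forall x, x \in xs -> ('X - x%:P) ^+ m %| p) ->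
  (\prod_(x <- xs) ('X - x%:P)) ^+ m %| p.
Proof.
elim: xs => [|x xs IH] /=; first by rewrite big_nil expr1n dvd1p.
move=> /andP[xxs uxs] H; rewrite big_cons exprMn Gauss_dvdp.
  by rewrite H ?mem_head // IH // => y yxs; rewrite H // inE yxs orbT.
by rewrite coprimep_expl // coprimep_expr // coprimep_sym coprimep_XsubC root_prod_XsubC.
Qed.

(** The derivation seen through the factor e^(t z): the derivative of p e^(t z) is ([twderiv t p])
    e^(t z). *)
Definition twderiv (F : nzRingType) (t : F) (p : {poly F}) : {poly F} := p^`() + t *: p.

Section ZeroEstimate.
Variable F : numFieldType.
Implicit Types (p q c : {poly F}) (t x : F).

Lemma twderivM t c p : twderiv t (c * p) = c^`() * p + c * twderiv t p.
Proof. by rewrite /twderiv derivM mulrDr scalerAr addrA. Qed.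

Lemma iter_twderivD t j p q :
  iter j (twderiv t) (p + q) = iter j (twderiv t) p + iter j (twderiv t) q.
Proof. by elim: j => //= j ->; rewrite /twderiv derivD scalerDr addrACA. Qed.

Lemma iter_twderiv0 t j : iter j (twderiv t) 0 = 0 :> {poly F}.
Proof. by elim: j => //= j ->; rewrite /twderiv deriv0 scaler0 addr0. Qed.

Lemma size_twderiv t p : (size (twderiv t p) <= size p)%N.
Proof.
rewrite (leq_trans (size_polyD _ _)) // geq_max size_scale_leq andbT.
by have [->|nz] := eqVneq p 0; rewrite ?deriv0 ?size_poly0 // ltnW // lt_size_deriv.
Qed.

Lemma size_iter_twderiv t j p : (size (iter j (twderiv t) p) <= size p)%N.
Proof. by elim: j => //= j; apply: leq_trans; apply: size_twderiv. Qed.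

Lemma lead_iter_twderiv t j p :
  (iter j (twderiv t) p)`_(size p).-1 = t ^+ j * lead_coef p.
Proof.
elim: j => [|j IH] /=; first by rewrite mul1r.
rewrite coefD coefZ IH exprS mulrA coef_deriv nth_default ?mul0rn ?add0r //.
by rewrite (leq_trans (size_iter_twderiv _ _ _)) // leqSpred.
Qed.

(** The factor e^(t z) does not change the order at [x]. The induction hypothesis, applied to [p]
    and to [twderiv t p], gives the divisibility of the derivative of [p]; characteristic 0 then
    yields the last power. *)
Lemma dvdp_twderiv t x m p :
  (forall j, (j < m)%N -> (iter j (twderiv t) p).[x] = 0) -> ('X - x%:P) ^+ m %| p.
Proof.
elim: m p => [|m IH] p H; first by rewrite expr0 dvd1p.
have /IH d1 : forall j, (j < m)%N -> (iter j (twderiv t) p).[x] = 0.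
  by move=> j jm; apply: H; rewrite ltnW.
have /IH d2 : forall j, (j < m)%N -> (iter j (twderiv t) (twderiv t p)).[x] = 0.
  by move=> j jm; rewrite -iterSr H.
case: m d1 d2 H {IH} => [|m] d1 d2 H.
  by rewrite expr1 dvdp_XsubCl; apply/rootP/(H 0%N).
case/dvdpP: d1 => r Dp; rewrite Dp [X in X %| _]exprS dvdp_mul2r ?expf_neq0 ?polyXsubC_eq0 //.
have: ('X - x%:P) ^+ m.+1 %| p^`().
  have: ('X - x%:P) ^+ m.+1 %| t *: p by rewrite -mul_polyC Dp !dvdp_mull.
  by move=> /dvdp_addl <-.
rewrite Dp derivM (dvdp_addr _ (dvdp_mull _ (dvdpp _))). rewrite deriv_exp derivXsubC mul1r /=.
rewrite mulrnAr -mulr_natl -polyC_natr mul_polyC dvdpZr ?pnatr_eq0 //.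
by rewrite [X in X %| _]exprS dvdp_mul2r ?expf_neq0 ?polyXsubC_eq0.
Qed.

Section VanishingOrder.
Variables (n : nat) (x y : F).
Implicit Types (H : 'I_n -> {poly F}).

(** [H] stands for the function \sum_i H_i(z) e^(i z), [D j] for its [j]-th derivative, and [ev] for
    its value at the point [(x, y)] of G_a x G_m, with [y] in the place of e^z. *)
Let D j H := fun i : 'I_n => iter j (twderiv i%:R) (H i).
Let ev H := \sum_(i < n) y ^+ i * (H i).[x].

Lemma ev_iter_twderivM j H c : (forall k, (k <= j)%N -> ev (D k H) = 0) ->
  ev (D j (fun i => c * H i)) = 0.
Proof.
elim: j H c => [|j IH] H c H0.
  have := H0 0%N isT; rewrite /ev /D /= => e0.
  rewrite (eq_bigr (fun i : 'I_n => c.[x] * (y ^+ i * (H i).[x]))).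
    by rewrite -mulr_sumr e0 mulr0.
  by move=> i _; rewrite hornerM mulrCA.
have h1 : ev (D j (fun i => c^`() * H i)) = 0 by apply: IH => k kj; apply: H0; rewrite leqW.
have h2 : ev (D j (fun i => c * twderiv i%:R (H i))) = 0.
  by apply: IH => k kj; rewrite -(H0 k.+1 kj) /ev; apply: eq_bigr => i _; rewrite /D iterSr.
rewrite -[RHS](addr0 0) -{1}h1 -h2 /ev -big_split /=; apply: eq_bigr => i _.
by rewrite -mulrDr -hornerD /D -iterS iterSr twderivM iter_twderivD.
Qed.
End VanishingOrder.

(* The determinant of the twisted derivatives of the P i is a nonzero polynomial
   (its leading coefficient is a Vandermonde determinant) which by Cramer's rule
   inherits the zeros x s with multiplicity S0 - L1 + 1. *)
Theorem exp_poly_zero_estimate (L0 L1 S0 S1 : nat) (P : 'I_L1 -> {poly F})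
    (x y : 'I_S1 -> F) :
  injective x -> (forall s, y s != 0) -> (forall i, size (P i) <= L0)%N ->
  (L1 <= S0)%N -> (L0.-1 * L1 < (S0 - L1).+1 * S1)%N ->
  (forall (s : 'I_S1) j, (j < S0)%N ->
    \sum_(i < L1) y s ^+ i * (iter j (twderiv i%:R) (P i)).[x s] = 0) ->
  forall i, P i = 0.
Proof.
move=> injx nzy szP L1S0 ineq P0 i0; apply/eqP/negbNE/negP => nzP.
(* Columns of vanishing P i are padded with 1 so that det W is not zero. *)
pose Q i := if P i == 0 then 1 else P i.
have nzQ i : Q i != 0 by rewrite /Q; case: ifP => [_|->]; rewrite ?oner_eq0.
pose W : 'M[{poly F}]_L1 := \matrix_(k, i) iter k (twderiv i%:R) (Q i).
have topW k i : (size (W k i) <= (size (Q i)).-1.+1)%N.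
  by rewrite mxE prednK ?lt0n ?size_poly_eq0 // size_iter_twderiv.
have [szW leadW] := coef_det_top topW.
have nzW : \det W != 0.
  apply/eqP => W0; move: leadW; rewrite W0 coef0 => /esym/eqP; apply/negP.
  have -> : \matrix_(i, j) (W i j)`_(size (Q j)).-1 =
     Vandermonde L1 (\row_i i%:R) *m diag_mx (\row_i lead_coef (Q i)).
    by apply/matrixP => k i; rewrite mul_mx_diag !mxE lead_iter_twderiv.
  rewrite det_mulmx det_diag det_Vandermonde mulf_neq0 //.
    apply/prodf_neq0 => i _; apply/prodf_neq0 => j ij.
    by rewrite !mxE subr_eq0 eqr_nat gtn_eqF.
  by apply/prodf_neq0 => i _; rewrite mxE lead_coef_eq0.
set m := (S0 - L1).+1.
have dv s : ('X - (x s)%:P) ^+ m %| \det W.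
  apply: (@dvdp_twderiv i0%:R) => j jm.
  apply: (mulfI (expf_neq0 i0 (nzy s))); rewrite mulr0.
  (* Row [i0] of the adjugate kills every column but [i0]. Since [e] is built from [P] and not from
     [Q], the padded columns give 0 as well, and the combination is \det W times e^(i0 z). It
     involves derivatives of order less than [L1], whence the loss of multiplicity. *)
  pose e (i : 'I_L1) := \sum_k (\adj W) i0 k * iter k (twderiv i%:R) (P i).
  have De i : e i = if i == i0 then \det W else 0.
    have := congr1 (fun A : 'M_L1 => A i0 i) (mul_adj_mx W); rewrite !mxE eq_sym.
    have [ne|nP] := eqVneq (P i) 0.
      move=> _; rewrite /e big1 => [|k _]; last by rewrite ne iter_twderiv0 mulr0.
      by case: eqP => // ii0; case/eqP: nzP; rewrite -ii0.
    rewrite mulrb => <-; apply: eq_bigr => k _; rewrite !mxE /Q.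
    by rewrite (negPf nP).
  transitivity (\sum_(i < L1) y s ^+ i * (iter j (twderiv i%:R) (e i)).[x s]).
    rewrite (bigD1 i0) //= De eqxx big1 ?addr0 // => i /negPf ni.
    by rewrite De ni iter_twderiv0 horner0 mulr0.
  rewrite (eq_bigr (fun i : 'I_L1 => \sum_k y s ^+ i *
     (iter j (twderiv i%:R) ((\adj W) i0 k * iter k (twderiv i%:R) (P i))).[x s])); last first.
    move=> i _; rewrite -mulr_sumr -horner_sum; congr (_ * _.[_]).
    by apply: (big_morph _ (iter_twderivD _ _) (iter_twderiv0 _ _)).
  rewrite exchange_big big1 // => k _; apply: ev_iter_twderivM => l lj.
  have lk : (l + k < S0)%N by have := ltn_ord k; rewrite /m in jm; lia.
  apply: etrans (P0 s _ lk).
  by apply: eq_bigr => i _; rewrite iterD.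
have ux : uniq (codom x) by rewrite map_inj_uniq ?enum_uniq.
have := dvdp_prod_XsubC_exp (m := m) (p := \det W) ux.
have dvx z : z \in codom x -> ('X - z%:P) ^+ m %| \det W by case/codomP => s ->.
move=> /(_ dvx) /dvdp_leq => /(_ nzW).
rewrite leqNgt => /negP; apply.
have nzp : \prod_(z <- codom x) ('X - z%:P) != 0 by rewrite monic_neq0 ?monic_prod_XsubC.
rewrite -[X in (_ < X)%N]prednK ?lt0n ?size_poly_eq0 ?expf_neq0 // size_exp.
rewrite size_prod_XsubC size_codom card_ord /= ltnS.
apply: leq_trans szW _; rewrite mulnC; apply: leq_trans ineq.
rewrite ltnS mulnC -[X in (_ <= X * _)%N]card_ord -sum_nat_const leq_sum // => i _.
rewrite /Q; case: eqP => [_|_]; first by rewrite size_poly1.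
by have := szP i; case: (size _) => //= k; case: L0 {szP}.
Qed.
End ZeroEstimate.

(** * Interpolation determinants *)

Definition vanish (F : nzRingType) (m : nat) (p : {poly F}) :=
  forall i, (i < m)%N -> p`_i = 0.

Section Vanish.
Variable F : comNzRingType.
Implicit Types (p q : {poly F}) (m n : nat).

Lemma vanish0 m : vanish m (0 : {poly F}).
Proof. by move=> i _; rewrite coef0. Qed.

Lemma vanishD m p q : vanish m p -> vanish m q -> vanish m (p + q).
Proof. by move=> vp vq i im; rewrite coefD vp ?vq ?addr0. Qed.

Lemma vanish_sum m (I : Type) (s : seq I) (P : pred I) (f : I -> {poly F}) :
  (forall i, P i -> vanish m (f i)) -> vanish m (\sum_(i <- s | P i) f i).
Proof.
move=> vf; elim/big_rec: _ => [|i p Pi]; [exact: vanish0 | exact/vanishD/vf].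
Qed.

Lemma vanishM m n p q : vanish m p -> vanish n q -> vanish (m + n) (p * q).
Proof.
move=> vp vq i im; rewrite coefM big1 // => j _.
have [jm|mj] := ltnP j m; first by rewrite vp // mul0r.
by rewrite vq ?mulr0 //; have := ltn_ord j; lia.
Qed.

Lemma vanishMl m p q : vanish m p -> vanish m (q * p).
Proof. by move=> vp; rewrite -[m]add0n; apply: vanishM. Qed.

Lemma vanishZ m c p : vanish m p -> vanish m (c *: p).
Proof. by move=> vp i im; rewrite coefZ vp ?mulr0. Qed.

Lemma vanish_le m n p : vanish m p -> (n <= m)%N -> vanish n p.
Proof. by move=> vp nm i iN; apply: vp; apply: leq_trans nm. Qed.

Lemma vanish_deriv m p : vanish m.+1 p -> vanish m p^`().
Proof. by move=> vp i im; rewrite coef_deriv vp ?mul0rn. Qed.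

Lemma vanish_derivn m k p : vanish m p -> vanish (m - k) p^`(k).
Proof.
move=> vp; elim: k => [|k IH]; first by rewrite subn0.
have [km|mk] := ltnP k m; last by move=> i; rewrite (_ : m - k.+1 = 0)%N //; lia.
by rewrite derivnS; apply: vanish_deriv; rewrite -subSn // subSS.
Qed.

Lemma vanish_prod n (f : 'I_n -> {poly F}) (e : 'I_n -> nat) :
  (forall i, vanish (e i) (f i)) -> vanish (\sum_i e i) (\prod_i f i).
Proof.
move=> vf; elim/big_rec2: _ => [|i p k _ vp]; first by move=> ?.
exact: vanishM.
Qed.

(** The subtraction in [j - sg i] is truncated, which only increases the order of each term of the
    expansion. *)
Lemma vanish_det n (M : 'M[{poly F}]_n) (sg : 'I_n -> nat) :
  (forall i j : 'I_n, vanish (j - sg i) (M i j)) ->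
  vanish (\sum_(j < n) j - \sum_(i < n) sg i) (\det M).
Proof.
move=> vM; apply: vanish_sum => s _; apply: vanishMl.
apply: vanish_le (vanish_prod (fun i => vM i (s i))) _.
rewrite (reindex_inj (@perm_inj _ s)) /= leq_subLR -big_split /=.
by apply: leq_sum => i _; lia.
Qed.
End Vanish.

(** * Order of vanishing of a determinant of functions *)

Lemma echelon_cols (F : fieldType) n (A : 'M[F]_n) :
  exists2 G : 'M[F]_n, \det G != 0 &
    forall i j : 'I_n, (i < j)%N -> (A *m G) i j = 0.
Proof.
case: n A => [|n] A; first by exists 1%:M => [|[]//]; rewrite det_mx00 oner_neq0.
have := cormen_lup_correct A^T; have := cormen_lup_detL A^T.
have := @cormen_lup_upper _ _ A^T; have := cormen_lup_perm A^T.
case: (cormen_lup A^T) => [[P L] U] /= /existsP[s /eqP ->] Uup dL PA.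
have uL : L^T \in unitmx by rewrite unitmx_tr unitmxE dL unitr1.
exists ((perm_mx s)^T *m invmx L^T).
  rewrite det_mulmx det_tr det_perm det_inv det_tr dL invr1 mulr1.
  by rewrite signr_eq0.
move=> i j ij.
have -> : A *m ((perm_mx s)^T *m invmx L^T) = U^T.
  by rewrite mulmxA -[A]trmxK -trmx_mul [perm_mx s *m _]PA trmx_mul mulmxK.
by rewrite mxE Uup.
Qed.

(** [A i l] is meant as the [i]-th Taylor coefficient of the [l]-th function. Constant column
    operations make the [j]-th function vanish to order [j] at 0 and multiply the determinant by a
    nonzero constant; the operator of row [m] then lowers the order by at most [sg m]. The sum of
    the [j] is the source of the order L^2/2. *)
Lemma det_vanish (F : fieldType) n (M : 'M[{poly F}]_n) (sg : 'I_n -> nat)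
    (A : 'M[F]_n) :
  (forall (g : 'I_n -> F) (j : 'I_n),
     (forall i : 'I_n, (i < j)%N -> \sum_l A i l * g l = 0) ->
   forall m, vanish (j - sg m) (\sum_l g l *: M m l)) ->
  vanish (\sum_(j < n) j - \sum_(i < n) sg i) (\det M).
Proof.
move=> H; have [G dG AG] := echelon_cols A.
have : vanish (\sum_(j < n) j - \sum_(i < n) sg i) (\det (M *m map_mx polyC G)).
  apply: vanish_det => m j; rewrite mxE.
  under eq_bigr do rewrite mxE mulrC mul_polyC.
  by apply: H => i ij; apply: etrans (AG i j ij); rewrite mxE.
rewrite det_mulmx det_map_mx => v i im; apply: (mulIf dG).
by rewrite mul0r -coefMC v.
Qed.

(** * Truncated exponentials and the operators q(t + d/dz) *)

Section ExpTrunc.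
Variable F : numFieldType.
Implicit Types (p q : {poly F}) (t x : F).

Definition expt (N : nat) t : {poly F} := \poly_(n < N) (t ^+ n / n`!%:R).

Lemma vanish_deriv_expt N t : vanish N.-1 ((expt N t)^`() - t *: expt N t).
Proof.
move=> i iN; rewrite coefB coef_deriv coefZ !coef_poly.
have iN1 : (i.+1 < N)%N by lia.
rewrite iN1 (ltnW iN1) factS natrM exprS -[X in X - _]mulr_natr.
have nz : i.+1%:R != 0 :> F by rewrite pnatr_eq0.
have fnz : i`!%:R != 0 :> F by rewrite pnatr_eq0 -lt0n fact_gt0.
by move: (i.+1%:R : F) (i`!%:R : F) nz fnz => a b ? ?; field; apply/andP.
Qed.

(** The truncated exponential satisfies its differential equation only up to order [N.-1], and each
    further derivation loses one order. *)
Lemma vanish_derivn_expt N t p j :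
  vanish (N - j) ((p * expt N t)^`(j) - iter j (twderiv t) p * expt N t).
Proof.
elim: j => [|j IH]; first by rewrite derivn0 subrr; apply: vanish0.
have -> : (p * expt N t)^`(j.+1) - iter j.+1 (twderiv t) p * expt N t =
   ((p * expt N t)^`(j) - iter j (twderiv t) p * expt N t)^`() +
    iter j (twderiv t) p * ((expt N t)^`() - t *: expt N t).
  rewrite derivnS derivB derivM /= /twderiv -!mul_polyC; ring.
apply: vanishD.
  case: (ltnP j N) => jN; last by move=> i; rewrite (_ : N - j.+1 = 0)%N //; lia.
  by apply: vanish_deriv; rewrite -subSn // subSS.
by apply: vanishMl; apply: vanish_le (vanish_deriv_expt t) _; lia.
Qed.

(* The operator q(t + d/dz). *)
Definition twop q t p := \sum_(j < size q) q`_j *: iter j (twderiv t) p.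

(** Up to terms of order [N - (size q).-1], the sum is q(d/dz) applied to the function assumed to
    vanish, and q(d/dz) lowers the order by at most the degree of [q]. *)
Lemma vanish_twop_expt (I : finType) (g : I -> F) (tau : I -> nat) (t : I -> F) N m q :
  (m <= N)%N -> vanish m (\sum_l g l *: ('X^(tau l) * expt N (t l))) ->
  vanish (m - (size q).-1) (\sum_l g l *: (twop q (t l) 'X^(tau l) * expt N (t l))).
Proof.
move=> mN v.
set S := \sum_l _ in v.
have -> : \sum_l g l *: (twop q (t l) 'X^(tau l) * expt N (t l)) =
  \sum_(j < size q) q`_j *: S^`(j) - \sum_(j < size q) \sum_l (q`_j * g l) *:
    (('X^(tau l) * expt N (t l))^`(j) - iter j (twderiv (t l)) 'X^(tau l) * expt N (t l)).
  rewrite (eq_bigr (fun l => \sum_(j < size q) (q`_j * g l) *: (iter j (twderiv (t l)) 'X^(tau l) * expt N (t l)))); last first.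
    move=> l _; rewrite /twop mulr_suml scaler_sumr; apply: eq_bigr => j _.
    by rewrite -scalerAl scalerA mulrC.
  rewrite exchange_big -sumrB /=; apply: eq_bigr => j _.
  rewrite /S (raddf_sum (derivn j)) scaler_sumr -sumrB; apply: eq_bigr => l _ /=.
  by rewrite derivnZ scalerA scalerBr opprB addrC subrK.
apply: vanishD.
  apply: vanish_sum => j _; apply: vanishZ; apply: vanish_le (vanish_derivn v) _.
  by have := ltn_ord j; lia.
rewrite -sumrN; apply: vanish_sum => j _; rewrite -sumrN; apply: vanish_sum => l _.
rewrite -scaleNr; apply: vanishZ; apply: vanish_le (@vanish_derivn_expt N _ _ _) _.
by have := ltn_ord j; lia.
Qed.

(** Taylor expansion of q(t + d/dz) at [t]. The polynomial [q] now enters only through its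
    derivatives at [t], a natural number in the application, and those are what [int_derivs]
    controls. *)
Lemma twopD_nderivn q t p n : (size p <= n)%N ->
  twop q t p = \sum_(k < n) q^`N(k).[t] *: p^`(k).
Proof.
elim/poly_ind: q => [|q c IH] szp.
  rewrite /twop size_poly0 big_ord0 big1 // => k _.
  by rewrite raddf0 horner0 scale0r.
have twopS : twop (q * 'X + c%:P) t p = twderiv t (twop q t p) + c *: p.
  have -> : twop (q * 'X + c%:P) t p =
      \sum_(j < (size q).+1) (q * 'X + c%:P)`_j *: iter j (twderiv t) p.
    rewrite /twop size_MXaddC; case: ifP => // /andP[/eqP -> /eqP ->].
    by rewrite size_poly0 big_ord0 big_ord1 mul0r addr0 coef0 scale0r.
  rewrite big_ord_recl coefD coefMX coefC add0r addrC; congr (_ + _).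
  rewrite /twop /twderiv (raddf_sum (@deriv F)) scaler_sumr -big_split; apply: eq_bigr => j _ /=.
  by rewrite coefD coefMX coefC addr0 derivZ scalerDr !scalerA [t * _]mulrC.
rewrite {}twopS IH // {IH}; case: n szp => [|n] szp.
  have -> : p = 0 by apply/eqP; rewrite -size_poly_eq0 -leqn0.
  by rewrite !big_ord0 /twderiv deriv0 !scaler0 !addr0.
rewrite /twderiv (raddf_sum (@deriv F)) /= big_ord_recr /=.
have -> : (q^`N(n).[t] *: p^`(n))^`() = 0.
  rewrite derivZ -derivnS [p^`(_)](_ : _ = 0) ?scaler0 //.
  by apply/polyP => i; rewrite coef_derivn nth_default ?mul0rn ?coef0 // (leq_trans szp) ?leq_addr.
rewrite big_ord_recl [RHS]big_ord_recl !nderivn0 !derivn0 /=.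
rewrite [RHS](_ : _ = (q.[t] * t + c) *: p + (\sum_(i < n) q^`N(i).[t] *: p^`(i.+1) +
    t *: \sum_(i < n) q^`N(i.+1).[t] *: p^`(i.+1))); last first.
  congr (_ + _); first by rewrite !hornerE.
  rewrite scaler_sumr -big_split; apply: eq_bigr => i _ /=.
  by rewrite nderivnMXaddC !hornerE scalerDl scalerA [t * _]mulrC.
under eq_bigr do rewrite derivZ -derivnS.
by rewrite -!mul_polyC !polyCD !polyCM; ring.
Qed.

(** The k! of the Taylor coefficient turns the derivative of ['X^tau] into a binomial coefficient,
    so the derivatives of [q] are the only possible source of denominators, and a factor [d ^+ tau]
    removes them. *)
Lemma horner_twopXn q t z tau :
  (twop q t 'X^tau).[z] = \sum_(k < tau.+1) q^`(k).[t] * 'C(tau, k)%:R * z ^+ (tau - k).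
Proof.
rewrite (@twopD_nderivn _ _ _ tau.+1) ?size_polyXn // horner_sum; apply: eq_bigr => k _.
rewrite hornerZ derivnXn hornerMn hornerXn nderivn_def hornerMn -bin_ffact.
by rewrite mulr_natr -mulrnA mulrnAr mulrnAl mulnC.
Qed.

Lemma norm_nderivn_sum q t n :
  \sum_(k < n) `|q^`N(k).[t]| <= l1n 1 (q \Po ('X + t%:P)).
Proof.
have cE k : (q \Po ('X + t%:P))`_k = q^`N(k).[t].
  suff -> : q \Po ('X + t%:P) = \poly_(i < size q) q^`N(i).[t].
    rewrite coef_poly; case: ltnP => // qk.
    suff -> : q^`N(k) = 0 by rewrite horner0.
    by apply/polyP => i; rewrite coef_nderivn nth_default ?mul0rn ?coef0 // (leq_trans qk) ?leq_addr.
  apply/eqP; rewrite -subr_eq0; apply/eqP/poly_nat_roots => m.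
  rewrite hornerD hornerN horner_comp hornerD hornerX hornerC [m%:R + t]addrC.
  rewrite (nderiv_taylor _ (mulrC _ _)) horner_poly.
  by rewrite subrr.
set m := (maxn n (size q)).+1.
rewrite /l1n (@horner_coef_wide _ m); last first.
  apply: leq_trans (size_poly _ _) _; rewrite (leq_trans (size_comp_poly_leq _ _)) //.
  by rewrite size_XaddC /= muln1 ltnS (leq_trans (leq_pred _)) // leq_maxr.
have nm : (n <= m)%N by rewrite leqW // leq_maxl.
rewrite (big_ord_widen _ (fun k => `|q^`N(k).[t]|) nm) /=.
rewrite big_mkcond /=; apply: ler_sum => k _; rewrite expr1n mulr1 coef_absp cE.
by case: ifP.
Qed.
End ExpTrunc.

Section Bound.
Variable F : numFieldType.
Implicit Types (p q : {poly F}) (t x r : F).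

Lemma coef_comp_scaleX p x i : (p \Po (x *: 'X))`_i = p`_i * x ^+ i.
Proof.
rewrite coef_comp_poly (eq_bigr (fun j : 'I__ => if i == j :> nat then p`_i * x ^+ i else 0)).
  case: (ltnP i (size p)) => ip; last first.
    by rewrite nth_default // mul0r big1 // => j _; case: ifP.
  rewrite (bigD1 (Ordinal ip)) //= eqxx big1 ?addr0 // => j ne.
  by rewrite ifN // eq_sym; apply: contraNN ne => /eqP e; apply/eqP/val_inj.
move=> j _; rewrite exprZn coefZ coefXn; case: eqP => [->|_]; first by rewrite mulr1.
by rewrite !mulr0.
Qed.

Lemma vanish_comp_scaleX m p x : vanish m p -> vanish m (p \Po (x *: 'X)).
Proof. by move=> vp i im; rewrite coef_comp_scaleX vp ?mul0r. Qed.

Lemma l1n_comp_scaleX r p x : l1n r (p \Po (x *: 'X)) = l1n (r * `|x|) p.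
Proof.
suff E : map_poly Num.norm (p \Po (x *: 'X)) = map_poly Num.norm p \Po (`|x| *: 'X).
  by rewrite /l1n E horner_comp hornerZ hornerX mulrC.
by apply/polyP => i; rewrite coef_absp !coef_comp_scaleX coef_absp normrM normrX.
Qed.

Lemma l1n_expt r N t : l1n r (expt N t) = (expt N `|t|).[r].
Proof.
rewrite /l1n; congr _.[r]; apply/polyP => i; rewrite coef_absp !coef_poly.
case: ifP => _; last by rewrite normr0.
rewrite normrM normrX normfV normr_nat; reflexivity.
Qed.

Lemma l1n_twop r Y q t tau : 0 <= r -> r <= Y -> tau%:R <= Y ->
  l1n r (twop q t 'X^tau) <= l1n 1 (q \Po ('X + t%:P)) * Y ^+ tau.
Proof.
move=> r0 rY tY; have Y0 : 0 <= Y := le_trans r0 rY.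
rewrite (@twopD_nderivn _ _ _ _ tau.+1) ?size_polyXn //.
rewrite (le_trans (l1n_sum _ _ _ r0)) //.
apply: le_trans (ler_wpM2r (exprn_ge0 tau Y0) (norm_nderivn_sum q t tau.+1)).
rewrite mulr_suml; apply: ler_sum => k _.
rewrite l1nZ ler_wpM2l // derivnXn -mulr_natl -polyC_natr mul_polyC l1nZ.
rewrite -['X^_]mul1r l1nMXn -polyC1 l1nC normr1 mul1r ger0_norm //.
have kt : (k <= tau)%N by rewrite -ltnS ltn_ord.
have -> : Y ^+ tau = Y ^+ k * Y ^+ (tau - k) by rewrite -exprD subnKC.
apply: ler_pM; rewrite ?exprn_ge0 //.
  apply: le_trans (_ : tau%:R ^+ k <= _); last by rewrite lerXn2r ?nnegrE.
  rewrite -natrX ler_nat.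
  by rewrite ffact_prod -[X in (_ <= _ ^ X)%N]card_ord -prod_nat_const leq_prod // => i _; rewrite leq_subr.
by rewrite lerXn2r ?nnegrE.
Qed.

(* M is the value at zeta = 1 of the matrix of the functions dilated by zeta,
   corrected by the error times zeta^n.  Its determinant vanishes at 0 to high
   order, and for the l1 norm at radius E the Schwarz lemma is immediate. *)
Theorem interpolation_det_bound n (M : 'M[F]_n) (c tau_t : 'I_n -> F)
    (q : 'I_n -> {poly F}) (x : 'I_n -> F) (tau sg : 'I_n -> nat) (N : nat) (E W : F) :
  1 <= E -> (n <= N)%N -> (forall m, size (q m) <= (sg m).+1)%N ->
  (forall m l, let p := c l *: (twop (q m) (tau_t l) 'X^(tau l) * expt N (tau_t l)) in
     l1n (E * `|x m|) p + E ^+ n * `|M m l - p.[x m]| <= W) ->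
  `|\det M| * E ^+ (\sum_(j < n) j - \sum_(m < n) sg m) <= n`!%:R * W ^+ n.
Proof.
move=> E1 nN szq HW.
have E0 : 0 <= E := le_trans ler01 E1.
pose p m l := c l *: (twop (q m) (tau_t l) 'X^(tau l) * expt N (tau_t l)).
pose Z : 'M[{poly F}]_n := \matrix_(m, l)
  (p m l \Po (x m *: 'X) + (M m l - (p m l).[x m]) *: 'X^n).
have -> : \det M = (\det Z).[1].
  rewrite -[_.[1]]/(horner_eval 1 _) -det_map_mx; congr (\det _).
  apply/matrixP => m l; rewrite !mxE [RHS]/= /horner_eval hornerD horner_comp !hornerZ hornerX.
  by rewrite hornerXn expr1n !mulr1 addrC subrK.
apply: le_trans (ler_norm_horner1_vanish E1 _) _; last first.
  apply: l1n_det => // m l; rewrite mxE (le_trans (l1nD _ _ E0)) //.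
  apply: le_trans (HW m l); rewrite lerD //; first by rewrite l1n_comp_scaleX.
  by rewrite l1nZ -['X^_]mul1r l1nMXn -polyC1 l1nC normr1 mul1r mulrC.
(* The function of column [l] is the same in all rows; the row contributes only the operator [q m]
   and the dilation by [x m], so one choice of column operations serves for every row. *)
apply: (@det_vanish F n Z sg (\matrix_(i, l) (c l *: ('X^(tau l) * expt N (tau_t l)))`_i)).
move=> g j g0 m.
have -> : \sum_l g l *: Z m l = (\sum_l (g l * c l) *: (twop (q m) (tau_t l) 'X^(tau l) * expt N (tau_t l)))
    \Po (x m *: 'X) + \sum_l (g l * (M m l - (p m l).[x m])) *: 'X^n.
  rewrite (raddf_sum (comp_poly (x m *: 'X))) -big_split /=; apply: eq_bigr => l _.
  by rewrite mxE scalerDr scalerA -[in RHS]scalerA !comp_polyZ.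
apply: vanishD; last first.
  apply: vanish_sum => l _; apply: vanishZ => i ij; rewrite coefXn.
  by have := ltn_ord j; case: eqP => //; lia.
apply: vanish_comp_scaleX.
apply: vanish_le (_ : vanish (j - (size (q m)).-1) _) _; last by have := szq m; case: (size _) => //=; lia.
apply: vanish_twop_expt; first by rewrite (leq_trans _ nN) // ltnW.
move=> i ij; have i_n : (i < n)%N := ltn_trans ij (ltn_ord j).
rewrite coef_sum; apply: etrans (g0 (Ordinal i_n) ij).
by apply: eq_bigr => l _; rewrite mxE !coefZ -mulrA [LHS]mulrC.
Qed.

(** Each factor X + t - i has norm at most 1 + |t - i|, which is at most [n] because [t] and [i]
    both lie in [0, n). *)
Lemma l1n_binp_shift (j t n : nat) : (t < n)%N -> (j <= n)%N ->
  l1n 1 (map_poly ratr (binp j) \Po ('X + t%:R%:P)) <= n%:R ^+ j / j`!%:R :> F.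
Proof.
move=> tn jn.
rewrite /binp map_polyZ fmorphV rmorph_nat rmorph_prod comp_polyZ /= rmorph_prod /= l1nZ.
rewrite normfV ratr_nat normr_nat mulrC ler_wpM2r ?invr_ge0 //.
rewrite (le_trans (l1n_prod _ _ _ ler01)) //.
rewrite -[X in _ <= _ ^+ X]card_ord -prodr_const; apply: ler_prod => i _.
rewrite l1n_ge0 // rmorphB /= map_polyX map_polyC /= ratr_nat comp_polyB comp_polyX comp_polyC -polyC_natr.
rewrite -addrA -polyCB (le_trans (l1nD _ _ ler01)) // l1nC -['X]mul1r -['X]expr1 l1nMXn.
rewrite -polyC1 l1nC normr1 mul1r expr1n.
have ij := ltn_ord i.
case: (leqP i t) => it.
  by rewrite -natrB // ger0_norm // nat1r ler_nat; lia.
by rewrite distrC -natrB 1?ltnW // ger0_norm // nat1r ler_nat; lia.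
Qed.

Lemma l1n_qpol_shift (K s t n : nat) : (0 < K)%N -> (t < n)%N -> (K <= n)%N ->
  l1n 1 (map_poly ratr (qpol K s) \Po ('X + t%:R%:P)) <=
    (n%:R ^+ K / K`!%:R) ^+ (s %/ K) * (n%:R ^+ (s %% K) / (s %% K)`!%:R) :> F.
Proof.
move=> K0 tn Kn.
rewrite /qpol rmorphM rmorphXn /= rmorphM rmorphXn /=.
rewrite (le_trans (l1nM _ _ ler01)) // ler_pM ?l1n_ge0 //.
  rewrite (le_trans (l1nX _ _ ler01)) // lerXn2r ?nnegrE ?l1n_ge0 ?divr_ge0 ?exprn_ge0 //.
  exact: l1n_binp_shift.
by apply: l1n_binp_shift => //; rewrite ltnW // (leq_trans _ Kn) // ltn_pmod.
Qed.
End Bound.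

(** * Conjugates and heights *)

Section Integrality.
Variable F : fieldType.
Local Notation O := (integralOver (intr : int -> F)).

Lemma integral_sum (I : Type) (s : seq I) (P : pred I) (f : I -> F) :
  (forall i, P i -> O (f i)) -> O (\sum_(i <- s | P i) f i).
Proof.
move=> Of; elim/big_rec: _ => [|i x Pi]; first exact: integral0.
exact/integral_add/Of.
Qed.

Lemma integral_prod (I : Type) (s : seq I) (P : pred I) (f : I -> F) :
  (forall i, P i -> O (f i)) -> O (\prod_(i <- s | P i) f i).
Proof.
move=> Of; elim/big_rec: _ => [|i x Pi]; first exact: integral1.
exact/integral_mul/Of.
Qed.

Lemma integral_exp x n : O x -> O (x ^+ n).
Proof. by move=> Ox; rewrite -[n]card_ord -prodr_const; apply: integral_prod. Qed.

(* The coefficients g_k descend from the leading one by g_(k-1) = f_k + a g_k,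
   and a g_k is integral over the f_i and g_k. *)
Lemma integral_quot_XsubC (f g : {poly F}) a :
  f = g * ('X - a%:P) -> (forall i, O f`_i) -> forall i, O g`_i.
Proof.
move=> Df Of.
have f0 : f`_0 = - (a * g`_0).
  by rewrite Df mulrBr coefB coefMX coefMC sub0r mulrC.
have fS k : f`_k.+1 = g`_k - a * g`_k.+1.
  by rewrite Df mulrBr coefB coefMX coefMC mulrC.
have sumf k : \sum_(i < k.+1) f`_i * a ^+ i = - (g`_k * a ^+ k.+1).
  elim: k => [|k IH]; first by rewrite big_ord1 f0 mulr1 expr1 mulrC.
  by rewrite big_ord_recr /= IH fS !exprS; ring.
have step k : O g`_k.+1 -> O g`_k.
  move=> Og; rewrite -[g`_k](subrK (a * g`_k.+1)) -fS; apply: integral_add => //.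
  set b := g`_k.+1 in Og *.
  pose p := 'X^(k.+2) + \poly_(i < k.+2) (f`_i * b ^+ (k.+1 - i)).
  apply: (@integral_root_monic _ _ _ _ p).
  - rewrite monicE lead_coefDl ?lead_coefXn //.
    by rewrite size_polyXn ltnS size_poly.
  - rewrite /root hornerD hornerXn horner_poly.
    have -> : \sum_(i < k.+2) f`_i * b ^+ (k.+1 - i) * (a * b) ^+ i =
       b ^+ k.+1 * \sum_(i < k.+2) f`_i * a ^+ i.
      rewrite mulr_sumr; apply: eq_bigr => i _.
      have ik : (i <= k.+1)%N by rewrite -ltnS.
      have -> : b ^+ k.+1 = b ^+ (k.+1 - i) * b ^+ i by rewrite -exprD subnK.
      by rewrite exprMn; ring.
    by rewrite sumf -/b exprMn -mulrN; apply/eqP; rewrite ![_ ^+ k.+2]exprS; ring.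
  apply/integral_poly => i; rewrite coefD coefXn coef_poly; apply: integral_add.
    exact: integral_nat.
  by case: ifP => _; [apply: integral_mul => //; apply: integral_exp | apply: integral0].
move=> i; have : O g`_(i + size g) by rewrite nth_default ?leq_addl //; apply: integral0.
by elim: (size g) => [|n IH]; rewrite ?addn0 // addnS => /step.
Qed.

(** Roots are removed one at a time. If f = g (X - a) has integral coefficients, so has g; to keep
    the root [a] in the product, use a g = X g - f, which has integral coefficients too. *)
Lemma integral_prod_roots (I : Type) (s : seq I) (P : pred I) (a : I -> F) c :
  (forall i, O (c *: \prod_(i <- s) ('X - (a i)%:P))`_i) ->
  O (c * \prod_(i <- s | P i) a i).
Proof.
elim: s c => [|j s IH] c.
  by move/(_ 0%N); rewrite !big_nil coefZ coefC mulr1.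
rewrite !big_cons => Of.
have Og := integral_quot_XsubC (g := c *: \prod_(i <- s) ('X - (a i)%:P)) (a := a j) _ Of.
have {}Og i : O (c *: \prod_(i <- s) ('X - (a i)%:P))`_i.
  by apply: Og; rewrite -scalerAl mulrC.
case: ifP => _; last exact: IH.
rewrite mulrA; apply: IH => i.
have -> : (c * a j) *: \prod_(i <- s) ('X - (a i)%:P) =
    (c *: \prod_(i <- s) ('X - (a i)%:P)) * 'X - c *: (('X - (a j)%:P) * \prod_(i <- s) ('X - (a i)%:P)).
  by rewrite -!mul_polyC polyCM; ring.
rewrite coefB coefMX; apply: integral_sub => //.
by case: ifP => _ //; apply: integral0.
Qed.
End Integrality.

Lemma integral_rat (F : numFieldType) (q : rat) :
  integralOver (intr : int -> F) (ratr q) -> q \is a Num.int.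
Proof.
case=> p mp rp.
have rq : root (map_poly intr p) q.
  rewrite -(fmorph_root (ratr : {rmorphism rat -> F})) -map_poly_comp.
  by rewrite (eq_map_poly (g := intr)) // => x /=; rewrite ratr_int.
have : 'X - q%:P %| map_poly intr p by rewrite dvdp_XsubCl.
case/dvdpP_rat_int => p1 [a nza Da] [r Dp].
have lp : lead_coef p1 * lead_coef r = 1 by rewrite -lead_coefM -Dp; apply/monicP.
have : lead_coef ('X - q%:P) = 1 by rewrite lead_coefXsubC.
rewrite Da lead_coefZ lead_coef_map_inj //; last exact: intr_inj.
move=> alp.
have -> : q = - (a * (p1`_0)%:~R).
  have := congr1 (fun f : {poly rat} => f`_0) Da.
  by rewrite coefB coefX coefC sub0r coefZ coef_map /= => <-; rewrite opprK.
have -> : a = (lead_coef r)%:~R.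
  have E := congr1 (fun x : int => x%:~R : rat) lp; rewrite intrM in E.
  by rewrite -[LHS]mulr1 -[X in _ * X]E mulrA alp mul1r.
by rewrite rpredN rpredM // intr_int.
Qed.

Section Conjugates.
Variables (C : numFieldType) (f : {poly rat}) (n : nat) (z : 'I_n -> C).
Hypotheses (Df : map_poly ratr f = \prod_i ('X - (z i)%:P)) (injz : injective z).

(** [P] is the matrix of multiplication by [p] modulo [f] in the basis of powers of X. The
    Vandermonde matrix of the roots diagonalizes it, with the conjugates of [p] as eigenvalues. *)
Lemma char_poly_conjugates (p : {poly rat}) :
  exists G : {poly rat}, map_poly ratr G = \prod_i ('X - ((map_poly ratr p).[z i])%:P) :> {poly C}.
Proof.
pose P : 'M[rat]_n := \matrix_(i, j) (('X^i * p) %% f)`_j.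
exists (char_poly P).
have szf : size f = n.+1.
  by rewrite -(size_map_poly (ratr : {rmorphism rat -> C})) Df size_prod_XsubC /index_enum -enumT size_enum_ord.
have nzf : f != 0 by rewrite -size_poly_eq0 szf.
rewrite map_char_poly.
pose V := Vandermonde n (\row_i z i).
have nzV : \det V != 0.
  rewrite det_Vandermonde; apply/prodf_neq0 => i _; apply/prodf_neq0 => j ij.
  by rewrite !mxE subr_eq0 (inj_eq injz) -val_eqE gtn_eqF.
pose d := \row_i (map_poly ratr p).[z i].
have PV : map_mx ratr P *m V = V *m diag_mx d.
  apply/matrixP => i j; rewrite mul_mx_diag !mxE.
  have zf : root (map_poly ratr f) (z j).
    by rewrite Df /root horner_prod (bigD1 j) //= !hornerE subrr mul0r.
  transitivity (map_poly ratr (('X^i * p) %% f)).[z j].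
    rewrite (@horner_coef_wide _ n); last first.
      by rewrite size_map_poly -ltnS -szf ltn_modp.
    by apply: eq_bigr => k _; rewrite !mxE coef_map.
  have := congr1 (fun g => (map_poly ratr g).[z j]) (divp_eq ('X^i * p) f).
  rewrite !rmorphD !rmorphM /= !hornerD !hornerM (rootP zf) mulr0 add0r => <-.
  by rewrite rmorphXn /= map_polyX hornerXn.
have dV : (\det V)%:P != 0 by rewrite polyC_eq0.
apply: (mulIf dV); rewrite -det_map_mx -det_mulmx.
have -> : char_poly_mx (map_mx ratr P) *m map_mx polyC V = map_mx polyC V *m char_poly_mx (diag_mx d).
  rewrite /char_poly_mx mulmxBl mulmxBr -!map_mxM PV.
  by rewrite mul_scalar_mx mul_mx_scalar.
rewrite det_mulmx mulrC det_map_mx; congr (_ * _).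
rewrite -/(char_poly _) char_poly_trig ?diag_mx_is_trig //.
by apply: eq_bigr => i _; rewrite !mxE eqxx.
Qed.
End Conjugates.

Lemma irreducible_common_root (C : numFieldType) (f r : {poly rat}) (z : C) :
  irreducible_poly f -> root (map_poly ratr f) z -> root (map_poly ratr r) z -> f %| r.
Proof.
move=> [szf irr] fz rz.
rewrite -[_ %| _]negbK -irreducible_poly_coprime //; apply/negP.
rewrite -(coprimep_map (ratr : {rmorphism rat -> C})) => cop.
by move: rz; rewrite /root (negPf (coprimep_root cop fz)).
Qed.

(** While [G] has a root, it shares it with [m] and is therefore divisible by [m]. It serves to see
    a characteristic polynomial as a power of the minimal one. *)
Lemma prod_roots_irreducible_pow (C : numClosedFieldType) (m G : {poly rat}) :
  irreducible_poly m -> G != 0 ->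
  (forall z : C, root (map_poly ratr G) z -> root (map_poly ratr m) z) ->
  exists k c, c != 0 /\ G = c *: m ^+ k.
Proof.
move=> irr; have [n] := ubnP (size G); elim: n G => // n IH G szG nzG Gm.
have [sz1|sz1] := leqP (size G) 1.
  exists 0%N, G`_0; rewrite expr0 {2}(size1_polyC sz1) alg_polyC; split=> //.
  by apply: contraNneq nzG => G0; rewrite (size1_polyC sz1) G0.
have [z Gz] : exists z : C, root (map_poly ratr G) z.
  by apply/closed_rootP; rewrite size_map_poly gtn_eqF.
have /dvdpP[H DG] := irreducible_common_root irr (Gm z Gz) Gz.
have nzH : H != 0 by apply: contraNneq nzG => H0; rewrite DG H0 mul0r.
have nzm : m != 0 by apply: contraNneq nzG => m0; rewrite DG m0 mulr0.
have szH : (size H < n)%N.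
  have szm := irr.1; move: szG; rewrite DG size_mul //.
  move: (size H) (size m) szm => a b; lia.
have [|k [c [nzc DH]]] := IH H szH nzH.
  by move=> w Hw; apply: Gm; rewrite DG rmorphM rootM Hw.
by exists k.+1, c; split=> //; rewrite DG DH exprSr scalerAl.
Qed.

(** [f] is the minimal polynomial of a primitive element. Its roots [z i] stand for the [D] complex
    embeddings, [z i0] for the given one, and the values of [pa] and [pb] at [z i] are simultaneous
    conjugates of [a] and [b]. *)
Lemma adjoin_degree_conjugates (R : realType) (a b : R[i]) (D : nat) :
  is_adjoin_degree a b D ->
  exists (f pa pb : {poly rat}) (z : 'I_D -> R[i]) (i0 : 'I_D),
    [/\ irreducible_poly f, map_poly ratr f = \prod_i ('X - (z i)%:P), injective z
      & a = (map_poly ratr pa).[z i0] /\ b = (map_poly ratr pb).[z i0]].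
Proof.
case=> K [iota [x [y [xa yb Kxy ->]]]].
have sepx : separable_element 1%AS x.
  by apply: pcharf0_separable => p; rewrite (pchar_lalg K) pchar_num.
have [xi Dxi] := Primitive_Element_Theorem y sepx.
have gen : <<1; xi>>%VS = fullv.
  by rewrite -Dxi -Kxy adjoin_cons adjoin_seq1.
have inK (u : K) : exists p : {poly rat}, iota u = (map_poly ratr p).[iota xi].
  have : u \in <<1; xi>>%VS by rewrite gen memvf.
  case/Fadjoin1_polyP => p ->; exists p.
  rewrite -horner_map -map_poly_comp; congr _.[_]; apply: eq_map_poly => c /=.
  by rewrite alg_num_field fmorph_rat.
have [pa Da] := inK x; have [pb Db] := inK y.
have /polyOver1P[f Df] := minPolyOver 1%AS xi.
have szf : size f = (\dim {:K}).+1.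
  have := size_minPoly 1%AS xi; rewrite Df size_map_poly => ->.
  by rewrite -gen dim_Fadjoin dimv1 muln1.
have monf : f \is monic.
  by have := monic_minPoly 1%AS xi; rewrite Df map_monic.
have iotaf (p : {poly rat}) : iota (map_poly (in_alg K) p).[xi] = (map_poly ratr p).[iota xi].
  rewrite -horner_map -map_poly_comp; congr _.[_]; apply: eq_map_poly => c /=.
  by rewrite alg_num_field fmorph_rat.
have rootf : root (map_poly ratr f) (iota xi).
  by rewrite /root -iotaf -Df minPolyxx rmorph0.
have irrf : irreducible_poly f.
  split; first by rewrite szf ltnS adim_gt0.
  move=> q szq qf; rewrite -(eqp_map (in_alg K)) -Df.
  have /orP[//|] : (map_poly (in_alg K) q %= minPoly 1%AS xi) || (map_poly (in_alg K) q %= 1).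
    apply: minPoly_irr; first exact: alg_polyOver.
    by rewrite Df dvdp_map.
  by rewrite -size_poly_eq1 size_map_poly (negPf szq).
have [r Dr] := closed_field_poly_normal (map_poly (ratr : rat -> R[i]) f).
have {Dr} Dr : map_poly ratr f = \prod_(z <- r) ('X - z%:P) :> {poly R[i]}.
  by rewrite Dr lead_coef_map (monicP monf) rmorph1 scale1r.
have szr : size r = \dim {:K}.
  by apply: succn_inj; rewrite -szf -(size_map_poly (ratr : {rmorphism rat -> R[i]})) Dr size_prod_XsubC.
have ur : uniq r.
  rewrite -separable_prod_XsubC -Dr separable_map.
  have szf' : (size f^`() < size f)%N by rewrite lt_size_deriv ?monic_neq0.
  rewrite separable_poly.unlock irreducible_poly_coprime //; apply/negP => /dvdp_leq.
  rewrite leqNgt szf' => H; have /H : f^`() != 0; last by [].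
  have szf1 : (1 < size f)%N := irrf.1.
  have : f^`()`_(size f).-2 != 0.
    have := monicP monf; rewrite /lead_coef coef_deriv.
    by case: (size f) szf1 => [|[|k]] //= _ ->; rewrite pnatr_eq0.
  by apply: contraNneq => ->; rewrite coef0.
have xir : iota xi \in r by rewrite -root_prod_XsubC -Dr.
have idx : (index (iota xi) r < \dim {:K})%N by rewrite -szr index_mem.
exists f, pa, pb, (fun i => r`_i), (Ordinal idx); split=> //.
- by rewrite Dr (big_nth 0) szr big_mkord.
- move=> i j /eqP; rewrite nth_uniq ?szr // => /eqP; exact: val_inj.
- by rewrite /= nth_index // -Da -Db xa yb.
Qed.

Section Height.
Variable R : realType.
Local Notation C := R[i].
Local Notation O := (integralOver (intr : int -> C)).

Lemma normc_prod (I : Type) (s : seq I) (P : pred I) (f : I -> C) :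
  normc (\prod_(i <- s | P i) f i) = \prod_(i <- s | P i) normc (f i).
Proof. exact: (big_morph _ (@ComplexField.Normc.normcM R) (@ComplexField.Normc.normc1 R)). Qed.

Lemma normc_ge0 (x : C) : 0 <= normc x.
Proof. by case: x => a b; apply: sqrtr_ge0. Qed.

Lemma normcX (x : C) n : normc (x ^+ n) = normc x ^+ n.
Proof. by rewrite -[n]card_ord -!prodr_const normc_prod. Qed.

(** The characteristic polynomial of [g] is, up to a constant, the [k]-th power of its minimal
    polynomial, where [D] is [k] times the degree of [g]. So each conjugate is repeated [k] times,
    and [a] is the [k]-th power of the leading coefficient. *)
Lemma height_conjugates (g : C) (D : nat) (f pg : {poly rat}) (z : 'I_D -> C) (i0 : 'I_D) :
  algebraic_number g -> irreducible_poly f ->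
  map_poly ratr f = \prod_i ('X - (z i)%:P) -> injective z -> g = (map_poly ratr pg).[z i0] ->
  exists a : int, [/\ 0 < a,
    forall j, O (a%:~R *: \prod_i ('X - ((map_poly ratr pg).[z i])%:P))`_j &
    ln (a%:~R : R) + \sum_i ln (Num.max 1 (normc (map_poly ratr pg).[z i])) = D%:R * weil_height g].
Proof.
move=> algg irrf Df injz Dg.
have [G DG] := char_poly_conjugates Df injz pg.
set m := int_minpoly g.
have [irrm _ rootm] : is_int_minpoly g m := int_minpolyP algg.
set mq := map_poly intr m : {poly rat} in irrm.
have mC : map_poly ratr mq = map_poly intr m :> {poly C}.
  by rewrite -map_poly_comp; apply: eq_map_poly => x /=; rewrite ratr_int.
have rz i : root (map_poly ratr f) (z i).
  by rewrite Df /root horner_prod (bigD1 i) //= !hornerE subrr mul0r.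
have compz i : (map_poly ratr (mq \Po pg)).[z i] = (map_poly intr m).[(map_poly ratr pg).[z i]] :> C.
  by rewrite map_comp_poly horner_comp mC.
have rm i : root (map_poly intr m) (map_poly ratr pg).[z i].
  have : f %| mq \Po pg.
    apply: (irreducible_common_root irrf (rz i0)).
    by rewrite /root compz -Dg; apply: rootm.
  rewrite -(dvdp_map (ratr : {rmorphism rat -> C})) => /dvdpP[w Dw].
  by rewrite /root -compz Dw hornerM (rootP (rz i)) mulr0.
have monG : G \is monic.
  rewrite -(map_monic (ratr : {rmorphism rat -> C})) DG; apply: monic_prod => i _; exact: monicXsubC.
have [||k [c [nzc Gk]]] := @prod_roots_irreducible_pow C mq G irrm.
- by rewrite monic_neq0.
- move=> w; rewrite DG /root horner_prod => /prodf_eq0[i _].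
  by rewrite !hornerE subr_eq0 => /eqP ->; rewrite mC; apply: rm.
have nzm : m != 0.
  by apply: contraTneq irrm.1 => m0; rewrite /mq m0 map_poly0 size_poly0.
have lmq : lead_coef mq = (lead_coef m)%:~R by rewrite lead_coef_map_inj //; apply: intr_inj.
have ck : c * (lead_coef m)%:~R ^+ k = 1.
  by have := monicP monG; rewrite Gk lead_coefZ lead_coef_exp lmq.
have DGC : (lead_coef m)%:~R ^+ k *: \prod_i ('X - ((map_poly ratr pg).[z i])%:P)
    = map_poly intr (m ^+ k) :> {poly C}.
  rewrite -DG Gk map_polyZ /= rmorphXn /= mC scalerA -(rmorph_int (ratr : {rmorphism rat -> C})).
  by rewrite -rmorphXn -rmorphM mulrC ck rmorph1 scale1r rmorphXn.
have a_gt0 : 0 < `|lead_coef m| ^+ k :> int by rewrite exprn_gt0 // normr_gt0 lead_coef_eq0.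
exists (`|lead_coef m| ^+ k); split => //.
  move=> j; rewrite rmorphXn /= normrEsign rmorphM rmorph_sign /=.
  rewrite exprMn -scalerA DGC coefZ coef_map /=.
  apply: integral_mul; last exact: integral_id.
  by do 2!apply: integral_exp; apply: integral_opp; apply: integral1.
have [S DS] : exists S, complex_roots (map_poly intr m : {poly C}) = S by exists (complex_roots (map_poly intr m)).
have mS : map_poly intr m = (lead_coef m)%:~R *: \prod_(w <- S) ('X - w%:P) :> {poly C}.
  rewrite -DS /complex_roots; case: (closed_field_poly_normal _) => /= r.
  rewrite lead_coef_map_inj //; exact: mulrIz (oner_neq0 _).
have nzl : (lead_coef m)%:~R != 0 :> C by rewrite intr_eq0 lead_coef_eq0.
have szS : size S = (size m).-1.
  have := congr1 (fun p : {poly C} => size p) mS.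
  rewrite size_scale // size_prod_XsubC size_map_inj_poly => [->||] //.
  exact: mulrIz (oner_neq0 _).
have PE : perm_eq [seq (map_poly ratr pg).[z i] | i <- enum 'I_D] (flatten (nseq k S)).
  apply: prod_XsubC_eq; rewrite big_map.
  apply: (@scalerI _ _ ((lead_coef m)%:~R ^+ k)); first exact: expf_neq0.
  rewrite big_enum /= DGC rmorphXn /= mS exprZn; congr (_ *: _).
  elim: k {ck DGC Gk a_gt0} => [|k IH]; first by rewrite expr0 big_nil.
  by rewrite exprS /= big_cat IH.
have sumE (F : C -> R) : \sum_i F (map_poly ratr pg).[z i] = k%:R * \sum_(w <- S) F w.
  rewrite -big_enum /= -(big_map (fun i => (map_poly ratr pg).[z i]) xpredT F).
  rewrite (perm_big _ PE) /=; elim: k {ck DGC Gk a_gt0 PE} => [|k IH]; first by rewrite big_nil mul0r.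
  by rewrite /= big_cat IH /= -natr1 mulrDl mul1r addrC.
have DE : D = (k * (size m).-1)%N.
  have := perm_size PE; rewrite size_map size_enum_ord => ->; rewrite -szS.
  by elim: k {ck DGC Gk a_gt0 PE sumE} => // k IH; rewrite /= size_cat IH mulSn.
rewrite (sumE (fun w => ln (Num.max 1 (normc w)))) /weil_height -/m DS DE.
have szm : ((size m).-1)%:R != 0 :> R.
  rewrite pnatr_eq0 -szS; have := irrm.1.
  by rewrite szS /mq size_map_inj_poly //; [case: (size m) => [|[]] | exact: intr_inj].
have cancel (x y w : R) : y != 0 -> x * y * (w / y) = x * w.
  by move=> y0; field.
rewrite [in RHS]natrM cancel // rmorphXn /= lnXn ?ltr0z ?normr_gt0 ?lead_coef_eq0 //.
by rewrite mulrDr !mulr_natl.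
Qed.
End Height.

(** * Liouville's inequality *)

(** The inner variable is sent to [u] (later alpha) and the outer one to [v] (later beta); in
    [bideg_le n m] the bound [n] likewise concerns the inner variable. The form as a composition
    provides the ring morphism structure. *)
Definition ev2 (S : comNzRingType) (u v : S) : {poly {poly int}} -> S :=
  horner_eval v \o map_poly (horner_eval u \o map_poly intr).

HB.instance Definition _ (S : comNzRingType) (u v : S) :=
  GRing.RMorphism.copy (ev2 u v)
    (horner_eval v \o map_poly (horner_eval u \o map_poly intr)).

Definition bideg_le (n m : nat) (P : {poly {poly int}}) :=
  (size P <= m.+1)%N /\ forall j, (size (P`_j)%R <= n.+1)%N.

Lemma ev2E (S : comNzRingType) (u v : S) n m P : bideg_le n m P ->
  ev2 u v P = \sum_(ij : 'I_m.+1 * 'I_n.+1) ((P`_ij.1)`_(ij.2))%:~R * u ^+ ij.2 * v ^+ ij.1.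
Proof.
case=> szm szn.
rewrite -[LHS]/((map_poly (horner_eval u \o map_poly intr) P).[v]) (@horner_coef_wide _ m.+1); last first.
  by rewrite (leq_trans (size_poly _ _)).
rewrite -(pair_big xpredT xpredT (fun (i : 'I_m.+1) (j : 'I_n.+1) => ((P`_i)`_j)%:~R * u ^+ j * v ^+ i)) /=.
apply: eq_bigr => i _; rewrite coef_map /= /horner_eval (@horner_coef_wide _ n.+1); last first.
  by rewrite (leq_trans (size_poly _ _)).
by rewrite mulr_suml; apply: eq_bigr => j _; rewrite coef_map.
Qed.

Lemma rmorph_ev2 (S T : comNzRingType) (phi : {rmorphism S -> T}) u v P :
  phi (ev2 u v P) = ev2 (phi u) (phi v) P.
Proof.
rewrite -[ev2 u v P]/((map_poly (horner_eval u \o map_poly intr) P).[v]) -horner_map -map_poly_comp; congr _.[_].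
apply: eq_map_poly => p /=; rewrite /horner_eval -horner_map -map_poly_comp; congr _.[_].
by apply: eq_map_poly => c /=; rewrite rmorph_int.
Qed.

Section Liouville.
Variable R : realType.
Local Notation C := R[i].
Local Notation O := (integralOver (intr : int -> C)).

(** The exponents are cut into [n] layers: layer [l] is [a] times the product of the [u i] with
    [l < e i], a partial product of roots. *)
Lemma integral_scaled_monomial D (u : 'I_D -> C) (a : C) (n : nat) (e : 'I_D -> nat) :
  (forall j, O (a *: \prod_i ('X - (u i)%:P))`_j) -> (forall i, (e i <= n)%N) ->
  O (a ^+ n * \prod_i u i ^+ e i).
Proof.
move=> Oa en.
have -> : a ^+ n * \prod_i u i ^+ e i = \prod_(l < n) (a * \prod_(i | (l < e i)%N) u i).
  rewrite big_split /= prodr_const card_ord; congr (_ * _).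
  rewrite (exchange_big_dep xpredT) //=; apply: eq_bigr => i _.
  by rewrite -(big_ord_widen n (fun=> u i) (en i)) prodr_const card_ord.
by apply: integral_prod => l _; apply: integral_prod_roots.
Qed.

Lemma liouville_prod D (u v : 'I_D -> C) (a b : C) n m P : bideg_le n m P ->
  (forall j, O (a *: \prod_i ('X - (u i)%:P))`_j) ->
  (forall j, O (b *: \prod_i ('X - (v i)%:P))`_j) ->
  O (a ^+ n * b ^+ m * \prod_i ev2 (u i) (v i) P).
Proof.
move=> bP Oa Ob; under eq_bigr do rewrite (ev2E _ _ bP).
rewrite bigA_distr_bigA mulr_sumr /=; apply: integral_sum => g _.
rewrite !big_split /=.
have -> : forall x y z w t : C, x * y * (z * w * t) = z * ((x * w) * (y * t)) by move=> *; ring.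
apply: integral_mul; first by apply: integral_prod => i _; apply: integral_id.
by apply: integral_mul; apply: integral_scaled_monomial => // i; rewrite -ltnS ltn_ord.
Qed.

Lemma normc_int (x : int) : normc (x%:~R : C) = `|x|%:~R.
Proof.
by apply: complexI; rewrite -[LHS]/(`|x%:~R : C|) -intr_norm rmorph_int.
Qed.

(** The product of all conjugates of P(alpha, beta), times [a ^+ n * b ^+ m], is a nonzero rational
    algebraic integer, so its modulus is at least 1. Only the [D.-1] other conjugates are estimated
    through [B]; the denominators and the maxima assemble into the heights. *)
Theorem liouville_two (alpha beta : C) (D : nat) (n m : nat) (P : {poly {poly int}}) (B : R) :
  algebraic_number alpha -> algebraic_number beta -> is_adjoin_degree alpha beta D ->
  bideg_le n m P -> 0 <= B ->
  (forall u v, normc (ev2 u v P) <= B * Num.max 1 (normc u) ^+ n * Num.max 1 (normc v) ^+ m) ->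
  ev2 alpha beta P != 0 ->
  1 <= normc (ev2 alpha beta P) * B ^+ D.-1 *
     expR (D%:R * (n%:R * weil_height alpha + m%:R * weil_height beta)).
Proof.
move=> alga algb degD bP B0 PB nzP.
have [f [pa [pb [z [i0 [irrf Df injz [Da Db]]]]]]] := adjoin_degree_conjugates degD.
have [a [a_gt0 Oa ha]] := height_conjugates alga irrf Df injz Da.
have [b [b_gt0 Ob hb]] := height_conjugates algb irrf Df injz Db.
set u := fun i => (map_poly ratr pa).[z i]; set v := fun i => (map_poly ratr pb).[z i].
rewrite -/(u _) in Da; rewrite -/(v _) in Db.
pose r : {poly rat} := ev2 pa pb P.
have rE i : (map_poly ratr r).[z i] = ev2 (u i) (v i) P.
  rewrite /r (rmorph_ev2 (map_poly (ratr : {rmorphism rat -> C}))).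
  by rewrite -[LHS]/(horner_eval (z i) _) rmorph_ev2.
have [G DG] := char_poly_conjugates Df injz r.
have rz i : root (map_poly ratr f) (z i).
  by rewrite Df /root horner_prod (bigD1 i) //= !hornerE subrr mul0r.
have nzr i : ev2 (u i) (v i) P != 0.
  apply: contraNneq nzP => x0; rewrite Da Db.
  have : f %| r by apply: (irreducible_common_root irrf (rz i)); rewrite /root rE x0.
  rewrite -(dvdp_map (ratr : {rmorphism rat -> C})) => /dvdpP[w Dw].
  by rewrite -rE Dw hornerM (rootP (rz i0)) mulr0.
have Oall := liouville_prod bP Oa Ob.
set y := _ * \prod_i _ in Oall.
have nzy : y != 0.
  apply: mulf_neq0; last by apply/prodf_neq0 => i _; apply: nzr.
  by apply: mulf_neq0; apply: expf_neq0; rewrite intr_eq0 gt_eqF.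
(* Up to sign, the product of the conjugates is the constant coefficient of a characteristic
   polynomial. *)
have [q Dq] : exists q : rat, y = ratr q.
  exists (a%:~R ^+ n * b%:~R ^+ m * ((-1) ^+ D * G.[0])).
  rewrite !rmorphM !rmorphXn /= !ratr_int rmorphN1 -[ratr G.[0]]horner_map /= rmorph0 DG.
  congr (_ * _); rewrite horner_prod.
  rewrite [X in _ * X](eq_bigr (fun i => -1 * ev2 (u i) (v i) P)); last by move=> i _; rewrite hornerXsubC rE sub0r mulN1r.
  by rewrite big_split /= prodr_const card_ord mulrA -exprMn mulrNN mul1r expr1n mul1r.
have y_ge1 : 1 <= normc y.
  have : q \is a Num.int by apply: (@integral_rat C); rewrite -Dq.
  case/intrP=> x Dx; rewrite Dq Dx ratr_int normc_int ler1z.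
  have : x != 0 by apply: contraNneq nzy => x0; rewrite Dq Dx x0 ratr_int.
  by rewrite -normr_gt0 gtz0_ge1.
apply: le_trans y_ge1 _.
pose Mu i := Num.max 1 (normc (u i)); pose Mv i := Num.max 1 (normc (v i)).
have Mu1 i : 1 <= Mu i by rewrite le_max lexx.
have Mv1 i : 1 <= Mv i by rewrite le_max lexx.
have expE (w : 'I_D -> C) (c : int) : 0 < c -> 
  expR (ln (c%:~R : R) + \sum_i ln (Num.max 1 (normc (w i)))) = c%:~R * \prod_i Num.max 1 (normc (w i)).
  move=> c0; rewrite expRD lnK ?posrE ?ltr0z //; congr (_ * _).
  rewrite expR_sum.
  by apply: eq_bigr => i _; rewrite lnK // posrE lt_max ltr01.
have -> : expR (D%:R * (n%:R * weil_height alpha + m%:R * weil_height beta)) =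
    (a%:~R * \prod_i Mu i) ^+ n * (b%:~R * \prod_i Mv i) ^+ m.
  rewrite -(expE u) // -(expE v) // ha hb -!expRM_natl -expRD; congr expR; ring.
rewrite /y !ComplexField.Normc.normcM normc_prod !normcX !normc_int !gtr0_norm //.
rewrite (bigD1 i0) //= -/(u i0) -/(v i0) -Da -Db.
have prodB : \prod_(i | i != i0) normc (ev2 (u i) (v i) P) <=
    B ^+ D.-1 * ((\prod_i Mu i) ^+ n * (\prod_i Mv i) ^+ m).
  apply: le_trans (_ : \prod_(i | i != i0) (B * Mu i ^+ n * Mv i ^+ m) <= _).
    by apply: ler_prod => i _; rewrite normc_ge0 PB.
  rewrite !big_split /= prodr_const cardC1 card_ord -mulrA ler_wpM2l ?exprn_ge0 //.
  have prod1 (M : 'I_D -> R) : (forall i, 1 <= M i) -> 1 <= \prod_i M i.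
    by move=> M1; elim/big_rec: _ => // i x _ x1; apply: mulr_ege1.
  have prodle (M : 'I_D -> R) k : (forall i, 1 <= M i) ->
      0 <= \prod_(i | i != i0) M i ^+ k <= (\prod_i M i) ^+ k.
    move=> M1; rewrite -prodrXl [X in _ <= _ <= X](bigD1 i0) //=.
    have p0 : 0 <= \prod_(i | i != i0) M i ^+ k.
      by apply: prodr_ge0 => i _; rewrite exprn_ge0 // (le_trans ler01).
    by rewrite p0 ler_peMl // exprn_ege1.
  have /andP[u0 ule] := prodle Mu n Mu1; have /andP[v0 vle] := prodle Mv m Mv1.
  exact: ler_pM.
set X := \prod_(i | _) _ in prodB *.
have an0 : 0 <= (a%:~R : R) ^+ n by rewrite exprn_ge0 // ler0z ltW.
have bm0 : 0 <= (b%:~R : R) ^+ m by rewrite exprn_ge0 // ler0z ltW.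
rewrite !exprMn.
have -> : forall e A B D M N : R, e * D * (A * M * (B * N)) = A * B * (e * (D * (M * N))).
  by move=> *; ring.
apply: ler_wpM2l; first exact: mulr_ge0.
by apply: ler_wpM2l; first exact: normc_ge0.
Qed.
End Liouville.

(** * The complex exponential *)

Lemma horner_expt_scale (F : numFieldType) N (t x : F) : (expt N t).[x] = (expt N 1).[t * x].
Proof.
rewrite !horner_poly; apply: eq_bigr => i _; by rewrite expr1n exprMn mulrAC mulrC mul1r mulrCA mulrA.
Qed.

(** The difference consists of the terms of degree at least [N] of the product. With absolute values
    it becomes the right-hand side, which for complex numbers is real and tends to 0 by the real
    exponential. *)
Lemma norm_expt_mul (F : numFieldType) N (x y : F) :
  `|(expt N x).[1] * (expt N y).[1] - (expt N (x + y)).[1]| <=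
  (expt N `|x|).[1] * (expt N `|y|).[1] - (expt N (`|x| + `|y|)).[1].
Proof.
have coefE (u v : F) n : (n < N)%N -> (expt N u * expt N v)`_n = (expt N (u + v))`_n.
  move=> nN; rewrite coefM coef_poly nN exprDn mulr_suml [RHS](reindex_inj rev_ord_inj) /=.
  apply: eq_bigr => j _; have jn : (j <= n)%N by rewrite -ltnS.
  rewrite !coef_poly subSS (leq_ltn_trans jn) // (leq_ltn_trans (leq_subr _ _)) //.
  rewrite subKn // bin_sub // -[_ *+ 'C(n, j)]mulr_natr -!mulrA.
  have := congr1 (fun k => k%:R : F) (bin_fact jn); rewrite !natrM.
  have fnz k : k`!%:R != 0 :> F by rewrite pnatr_eq0 -lt0n fact_gt0.
  move=> <-; have := fnz j; have := fnz (n - j)%N.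
  have : 'C(n, j)%:R != 0 :> F by rewrite pnatr_eq0 -lt0n bin_gt0.
  move: ('C(n, j)%:R : F) (j`!%:R : F) ((n - j)`!%:R : F) => a b c a0 c0 b0.
  by field; rewrite a0 b0 c0.
have QE (u v : F) : (expt N u).[1] * (expt N v).[1] - (expt N (u + v)).[1] =
    \sum_(n < N + N) if (N <= n)%N then (expt N u * expt N v)`_n else 0.
  have szp (w : F) : (size (expt N w) <= N)%N by apply: size_poly.
  rewrite -hornerM (@horner_coef_wide _ (N + N)); last first.
    rewrite (leq_trans (size_polyMleq _ _)) // (leq_trans (leq_pred _)) // leq_add //.
  rewrite (@horner_coef_wide _ (N + N) (expt _ _)); last exact: leq_trans (szp _) (leq_addr _ _).
  rewrite -sumrB; apply: eq_bigr => i _; rewrite !expr1n !mulr1.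
  case: leqP => Ni; last by rewrite coefE // subrr.
  by rewrite [X in _ - X]nth_default ?subr0 // (leq_trans (szp _)).
rewrite !QE (le_trans (ler_norm_sum _ _ _)) //; apply: ler_sum => n _.
case: ifP => _; last by rewrite normr0.
rewrite !coefM (le_trans (ler_norm_sum _ _ _)) //; apply: ler_sum => j _.
have coefle (w : F) k : `|(expt N w)`_k| = (expt N `|w|)`_k.
  rewrite !coef_poly; case: ifP => _; last by rewrite normr0.
  rewrite normrM normrX normfV normr_nat; reflexivity.
by rewrite normrM !coefle.
Qed.

Lemma norm_expt_sub1 (F : numFieldType) N (z : F) : `|z| <= 1 ->
  `|(expt N.+2 1).[z] - 1 - z| <= `|z| ^+ 2.
Proof.
move=> z1; rewrite horner_poly !big_ord_recl /= !expr1n !fact0 !divr1 !mul1r.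
rewrite expr0 [bump 0 0]/= expr1.
have -> (s : F) : 1 + (z + s) - 1 - z = s by ring.
rewrite (le_trans (ler_norm_sum _ _ _)) //.
apply: le_trans (_ : \sum_(i < N) `|z| ^+ 2 * ((i.+2)`!%:R)^-1 <= _).
  apply: ler_sum => i _.
  rewrite expr1n mul1r normrM normfV normr_nat mulrC ler_wpM2r ?invr_ge0 // normrX.
  by rewrite /bump /= !add1n -[X in _ <= X]mulr1 -addn2 addnC exprD ler_wpM2l ?exprn_ge0 // exprn_ile1.
rewrite -mulr_sumr ler_piMr ?exprn_ge0 //.
(* Telescoping: 1 / (k + 2)! is at most 1 / ((k + 1)(k + 2)). *)
suff H k : \sum_(i < k) ((i.+2)`!%:R)^-1 <= 1 - k.+1%:R^-1 :> F.
  by apply: le_trans (H N) _; rewrite gerBl invr_ge0.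
elim: k => [|k IH]; first by rewrite big_ord0 invr1 subrr.
rewrite big_ord_recr /= (le_trans (lerD IH (lexx _))) //.
apply: le_trans (_ : 1 - k.+1%:R^-1 + (k.+2%:R * k.+1%:R)^-1 <= _).
  rewrite lerD2l lef_pV2 ?posrE ?mulr_gt0 ?ltr0n ?fact_gt0 //.
  by rewrite -natrM ler_nat !factS mulnA leq_pmulr ?fact_gt0.
have -> : k.+2%:R = k.+1%:R + 1 :> F by rewrite -natr1.
have k0 : k.+1%:R != 0 :> F by rewrite pnatr_eq0.
have k1 : k.+1%:R + 1 != 0 :> F by rewrite natr1 pnatr_eq0.
move: (k.+1%:R : F) k0 k1 => x x0 x1.
rewrite le_eqVlt; apply/orP; left; apply/eqP; field; exact/andP.
Qed.

Section Cexp.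
Local Open Scope classical_set_scope.
Variable R : realType.
Local Notation C := R[i].
Implicit Types (x y : R) (z w : C).

Lemma cexpD z w : cexp (z + w) = cexp z * cexp w.
Proof.
case: z w => [a b] [c d] /=; rewrite expRD cosD sinD; apply/eqP.
by rewrite eq_complex /=; apply/andP; split; apply/eqP; ring.
Qed.

Lemma cexp0 : cexp (0 : C) = 1.
Proof. by rewrite /cexp /= expR0 cos0 sin0 mul1r mulr0. Qed.

Lemma cexpMn z n : cexp (z *+ n) = cexp z ^+ n.
Proof. by elim: n => [|n IH]; rewrite ?cexp0 // mulrS exprS cexpD IH. Qed.

Lemma normc_cexp z : normc (cexp z) = expR (complex.Re z).
Proof.
case: z => a b /=.
have -> : (expR a * cos b) ^+ 2 + (expR a * sin b) ^+ 2 = expR a ^+ 2 * (cos b ^+ 2 + sin b ^+ 2) by ring.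
by rewrite cos2Dsin2 mulr1 sqrtr_sqr ger0_norm ?expR_ge0.
Qed.

Lemma normc_Re_le z : `|complex.Re z| <= normc z.
Proof. by case: z => a b /=; rewrite -sqrtr_sqr ler_wsqrtr // lerDl sqr_ge0. Qed.

Lemma normc_le z : normc z <= `|complex.Re z| + `|complex.Im z|.
Proof.
case: z => a b /=; rewrite -[leRHS]ger0_norm ?addr_ge0 // -[leRHS]sqrtr_sqr ler_wsqrtr //.
by rewrite sqrrD !real_normK ?num_real // [leRHS]addrAC lerDl mulrn_wge0 // mulr_ge0.
Qed.

Lemma normc_real x : normc (x%:C)%C = `|x|.
Proof. by rewrite /= expr0n addr0 sqrtr_sqr. Qed.

Lemma series_expE x N : (expt N x).[1] = series (exp_coeff x) N.
Proof.
rewrite horner_poly /series /= big_mkord; apply: eq_bigr => i _.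
by rewrite expr1n mulr1.
Qed.

Lemma cvg_expt x : (fun N => (expt N x).[1] : R) @ \oo --> expR x.
Proof.
have -> : (fun N => (expt N x).[1]) = series (exp_coeff x).
  by apply/funext => N; rewrite series_expE.
exact: is_cvg_series_exp_coeff.
Qed.

Lemma expt_le_expR x N : 0 <= x -> (expt N x).[1] <= expR x.
Proof.
move=> x0; rewrite series_expE; apply: nondecreasing_cvgn_le; last exact: is_cvg_series_exp_coeff.
apply/nondecreasing_seqP => n; rewrite /series /= big_nat_recr //= lerDl.
exact: exp_coeff_ge0.
Qed.

Lemma expt_imag y N : (expt N (0 +i* y)%C).[1] =
  ((series (cos_coeff y) N) +i* (series (sin_coeff y) N))%C.
Proof.
rewrite horner_poly /series /=.
have powE n : (0 +i* y)%C ^+ n = ((cos_coeff y n * n`!%:R) +i* (sin_coeff y n * n`!%:R))%C :> C.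
  have fnz : n`!%:R != 0 :> R by rewrite pnatr_eq0 -lt0n fact_gt0.
  rewrite /cos_coeff /sin_coeff /= !divfK // -!exprnP.
  have sq : (0 +i* y)%C ^+ 2 = ((- y ^+ 2)%:C)%C :> C.
    by rewrite expr2; apply/eqP; rewrite eq_complex /=; apply/andP; split; apply/eqP; ring.
  have sqk k : (0 +i* y)%C ^+ k.*2 = (((-1) ^+ k * y ^+ k.*2)%:C)%C :> C.
    by rewrite -mul2n exprM sq -rmorphXn /= [(- y ^+ 2) ^+ k]exprNn -exprM.
  rewrite -[n]odd_double_half; case: (odd n); rewrite /= ?add1n ?add0n.
    rewrite exprS sqk /= !odd_double /= ?uphalf_double ?doubleK.
    by apply/eqP; rewrite eq_complex /= exprS; apply/andP; split; apply/eqP; ring.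
  rewrite sqk odd_double /= doubleK.
  by apply/eqP; rewrite eq_complex /=; apply/andP; split; apply/eqP; ring.
elim: N => [|N IH]; first by rewrite big_ord0 !big_geq.
rewrite big_ord_recr IH !big_nat_recr //= expr1n mulr1 powE.
have fnz : N`!%:R != 0 :> R by rewrite pnatr_eq0 -lt0n fact_gt0.
have -> : (N`!%:R : C)^-1 = ((N`!%:R^-1 : R)%:C)%C by rewrite fmorphV rmorph_nat.
apply/eqP; rewrite eq_complex; apply/andP; by rewrite /=; split; apply/eqP; field.
Qed.

Lemma expt_real x N : (expt N (x%:C)%C).[1] = ((expt N x).[1]%:C)%C :> C.
Proof.
rewrite !horner_poly rmorph_sum; apply: eq_bigr => i _.
by rewrite !expr1n !mulr1 rmorphM rmorphXn fmorphV rmorph_nat.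
Qed.

(** The truncation at x + i y is compared with the product of those at x and i y. The latter
    converge by the real series of exp, cos and sin, and the discrepancy is at most [d N], which
    tends to 0. *)
Lemma cexp_approx z (eps : R) : 0 < eps ->
  exists N0, forall N, (N0 <= N)%N -> normc (cexp z - (expt N 1).[z]) <= eps.
Proof.
move=> eps0; case: z => x y.
pose e N := (expt N x).[1]; pose c N := series (cos_coeff y) N; pose s N := series (sin_coeff y) N.
pose d N := (expt N `|x|).[1] * (expt N `|y|).[1] - (expt N (`|x| + `|y|)).[1].
pose b N : R := `|expR x * cos y - e N * c N| + `|expR x * sin y - e N * s N| + d N.
have combine (N : nat) (cz eu ev euv euv' : C) : euv' = euv ->
    cz = ((expR x * cos y) +i* (expR x * sin y))%C -> eu = ((e N)%:C)%C ->
    ev = ((c N) +i* (s N))%C -> normc (eu * ev - euv) <= d N -> normc (cz - euv') <= b N.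
  move=> -> -> Eu Ev H; rewrite -[_ - euv](subrKA (eu * ev)).
  apply: le_trans (le_normcD _ _) _; apply: lerD H.
  apply: le_trans (normc_le _) _; rewrite Eu Ev.
  move: (e N) (c N) (s N) (expR x) (cos y) (sin y) => e' c' s' ex cy sy.
  by rewrite /= !mul0r subr0 addr0.
have bound N : normc (cexp (x +i* y)%C - (expt N 1).[(x +i* y)%C]) <= b N.
  pose u : C := (x%:C)%C; pose v : C := (0 +i* y)%C.
  have Dz : (x +i* y)%C = u + v by apply/eqP; rewrite eq_complex /= addr0 add0r !eqxx.
  have E : (expt N 1).[(x +i* y)%C] = (expt N (u + v)).[1].
    by rewrite [RHS]horner_expt_scale mulr1 Dz.
  apply: (combine N _ _ _ _ _ E erefl (expt_real x N) (expt_imag y N)).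
  have nu : `|u| = (`|x|%:C)%C by rewrite -[LHS]/((normc _)%:C)%C normc_real.
  have nv : `|v| = (`|y|%:C)%C.
    by rewrite -[LHS]/((normc _)%:C)%C /v /normc expr0n /= add0r sqrtr_sqr.
  have Eu : (expt N `|u|).[1] = ((expt N `|x|).[1]%:C)%C by rewrite nu expt_real.
  have Ev : (expt N `|v|).[1] = ((expt N `|y|).[1]%:C)%C by rewrite nv expt_real.
  have Euv : (expt N (`|u| + `|v|)).[1] = ((expt N (`|x| + `|y|)).[1]%:C)%C.
    by rewrite nu nv -rmorphD expt_real.
  have Dd : ((d N)%:C)%C = (expt N `|u|).[1] * (expt N `|v|).[1] - (expt N (`|u| + `|v|)).[1].
    rewrite /d rmorphB rmorphM; congr (_ * _ - _);
      [exact: esym Eu | exact: esym Ev | exact: esym Euv].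
  by rewrite -lecR {}Dd; exact: (norm_expt_mul N u v).
have bcvg : b @ \oo --> (0 : R).
  have cc : c @ \oo --> cos y by rewrite cos.unlock; exact: is_cvg_series_cos_coeff.
  have cs : s @ \oo --> sin y by rewrite sin.unlock; exact: is_cvg_series_sin_coeff.
  have ce : e @ \oo --> expR x by exact: cvg_expt.
  have cd : d @ \oo --> (0 : R).
    rewrite -(subrr (expR (`|x| + `|y|))) {1}expRD.
    by apply: cvgB; [apply: cvgM|]; apply: cvg_expt.
  have cn (f : nat -> R) (l : R) : f @ \oo --> l -> (fun N => `|l - f N|) @ \oo --> (0 : R).
    move=> fl; rewrite -(normr0 R) -(subrr l); apply: cvg_norm; apply: cvgB fl; exact: cvg_cst.
  rewrite /b -[X in _ --> X](addr0 0) -[X in _ --> X + _](addr0 0).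
  by apply: cvgD => //; apply: cvgD; apply: cn; apply: cvgM.
have /cvgrPdist_le /(_ eps eps0) [N0 _ HN] := bcvg.
exists N0 => N NN; apply: le_trans (bound N) _.
have := HN N NN; rewrite /= sub0r normrN; exact/le_trans/ler_norm.
Qed.

Lemma norm_cexp_sub1 z : normc z <= 1 -> normc (cexp z - 1 - z) <= normc z ^+ 2.
Proof.
move=> z1; apply/ler_addgt0Pr => eps eps0.
have [N0 HN] := cexp_approx z eps0.
have -> : cexp z - 1 - z = ((expt N0.+2 1).[z] - 1 - z) + (cexp z - (expt N0.+2 1).[z]) by ring.
apply: le_trans (le_normcD _ _) _; apply: lerD; last by apply: HN; lia.
rewrite -lecR rmorphXn; apply: (norm_expt_sub1 (F := C)).
change ((normc z)%:C%C <= (1 : R)%:C%C :> C); by rewrite lecR.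
Qed.

Lemma norm_cexp_sub1_le z : normc z <= 1 -> normc (cexp z - 1) <= 2 * normc z.
Proof.
move=> z1; have -> : cexp z - 1 = (cexp z - 1 - z) + z by rewrite subrK.
apply: le_trans (le_normcD _ _) _; rewrite mulrDl mul1r lerD2r.
apply: le_trans (norm_cexp_sub1 z1) _; rewrite expr2.
by rewrite ler_piMr // normc_ge0.
Qed.

Lemma cexp_eq1_small z : normc z < 1 -> cexp z = 1 -> z = 0.
Proof.
move=> z1 ez; have := norm_cexp_sub1 (ltW z1); rewrite ez subrr sub0r normcN expr2.
have [z0|nz] := eqVneq (normc z) 0; first by move=> _; apply: ComplexField.Normc.eq0_normc.
have z_gt0 : 0 < normc z by rewrite lt_def nz normc_ge0.
by rewrite ler_pMr // leNgt z1.
Qed.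
End Cexp.

(** * The interpolation matrix *)

Section Minor.
Variable F : numFieldType.

Definition qpolF (K sigma : nat) : {poly F} := map_poly ratr (qpol K sigma).

Lemma size_qpolF K sigma : (0 < K)%N -> size (qpolF K sigma) = sigma.+1.
Proof. by move=> K0; rewrite size_map_poly size_qpol. Qed.

(* d^tau times the sigma-th operator applied to z^tau e^(t z), at the point
   (s * b, a ^ s) of the additive times the multiplicative group. *)
Definition interp_entry (K d : nat) (a b : F) (r : nat * nat) (c : nat * nat) : F :=
  d%:R ^+ c.1 * (twop (qpolF K r.1) c.2%:R 'X^(c.1)).[r.2%:R * b] * a ^+ (c.2 * r.2).

Definition natpair m n (x : 'I_m * 'I_n) : nat * nat := (x.1 : nat, x.2 : nat).

Lemma iter_twderivZ t j (c : F) p : iter j (twderiv t) (c *: p) = c *: iter j (twderiv t) p.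
Proof.
by elim: j => //= j ->; rewrite /twderiv derivZ scalerDr !scalerA mulrC.
Qed.

Lemma iter_twderiv_sum t j (I : Type) (s : seq I) (f : I -> {poly F}) :
  iter j (twderiv t) (\sum_(i <- s) f i) = \sum_(i <- s) iter j (twderiv t) (f i).
Proof. exact: (big_morph _ (iter_twderivD _ _) (iter_twderiv0 _ _)). Qed.

Theorem nonzero_minor (L0 L1 S0 S1 K d : nat) (a b : F) :
  a != 0 -> b != 0 -> (0 < K)%N -> (0 < d)%N -> (L1 <= S0)%N ->
  (L0.-1 * L1 < (S0 - L1).+1 * S1)%N ->
  exists rw : 'I_#|{: 'I_L0 * 'I_L1}| -> 'I_S0 * 'I_S1,
    \det (\matrix_(m, c) interp_entry K d a b (natpair (rw m)) (natpair (enum_val c))) != 0.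
Proof.
move=> nza nzb K0 d0 L1S0 ineq.
pose A : 'M[F]_(#|{: 'I_S0 * 'I_S1}|, #|{: 'I_L0 * 'I_L1}|) :=
  \matrix_(m, c) interp_entry K d a b (natpair (enum_val m)) (natpair (enum_val c)).
have fA : row_full A.
  rewrite /row_full -mxrank_tr -/(row_free _) -kermx_eq0; apply/rowV0P => v.
  rewrite sub_kermx => /eqP vA.
  pose w (tau : 'I_L0) (t : 'I_L1) := v 0 (enum_rank (tau, t)).
  pose P (t : 'I_L1) := \sum_(tau < L0) (d%:R ^+ tau * w tau t) *: 'X^tau.
  have lam0 (s : 'I_S1) j : (j < S0)%N ->
      \sum_(t < L1) (a ^+ s) ^+ t * (iter j (twderiv t%:R) (P t)).[s%:R * b] = 0.
    (* The row of index [(j, s)] only says that a combination of [lam 0], ..., [lam j] is zero. As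
       [qpolF K j] has degree exactly [j], [lam j] has a nonzero coefficient, and the relations are
       solved by induction on [j]. *)
    pose lam j := \sum_(t < L1) (a ^+ s) ^+ t * (iter j (twderiv t%:R) (P t)).[s%:R * b].
    rewrite -/(lam j); have [n] := ubnP j; elim: n j => // n IH j jn jS.
    have : \sum_(i < j.+1) (qpolF K j)`_i * lam i = 0.
      have := congr1 (fun B : 'rV_ _ => B 0 (enum_rank (Ordinal jS, s))) vA.
      rewrite !mxE => v0; apply: etrans v0.
      rewrite (reindex (@enum_rank _ : 'I_L0 * 'I_L1 -> _)) /=; last first.
        by exists enum_val => x _; rewrite ?enum_rankK ?enum_valK.
      transitivity (\sum_(tau < L0) \sum_(t < L1) v 0 (enum_rank (tau, t)) *
          A^T (enum_rank (tau, t)) (enum_rank (Ordinal jS, s))); last first.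
        by rewrite pair_bigA; apply: eq_bigr => -[tau t] _.
      rewrite [RHS]exchange_big /=.
      under eq_bigr do rewrite mulr_sumr.
      rewrite exchange_big /=; apply: eq_bigr => t _.
      rewrite (eq_bigr (fun i : 'I_j.+1 => \sum_(tau < L0) (qpolF K j)`_i *
        ((a ^+ s) ^+ t * (d%:R ^+ tau * w tau t * (iter i (twderiv t%:R) 'X^tau).[s%:R * b])))); last first.
        move=> i _; rewrite -!mulr_sumr; congr (_ * (_ * _)).
        rewrite /P iter_twderiv_sum horner_sum; apply: eq_bigr => tau _.
        by rewrite iter_twderivZ hornerZ.
      rewrite exchange_big /=; apply: eq_bigr => tau _.
      rewrite !mxE !enum_rankK /interp_entry /natpair /= /twop size_qpolF // horner_sum.
      rewrite mulr_sumr mulr_suml mulr_sumr; apply: eq_bigr => i _.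
      by rewrite hornerZ mulnC exprM -/(w tau t); ring.
    rewrite big_ord_recr /= big1 ?add0r => [/eqP|i _]; last first.
      by rewrite (IH i) ?mulr0 //; [apply: leq_trans (ltn_ord i) _ | apply: ltn_trans (ltn_ord i) _].
    rewrite mulf_eq0 => /orP[|/eqP //].
    have -> : (qpolF K j)`_j = lead_coef (qpolF K j) by rewrite /lead_coef size_qpolF.
    by rewrite lead_coef_eq0 -size_poly_eq0 size_qpolF.
  have P0 : forall t, P t = 0.
    apply: (@exp_poly_zero_estimate F L0 L1 S0 S1 P (fun s => s%:R * b) (fun s => a ^+ s)) => //.
    - by move=> s s' /(mulIf nzb) /eqP; rewrite eqr_nat => /eqP/val_inj.
    - by move=> s; apply: expf_neq0.
    - move=> t; rewrite (leq_trans (size_sum _ _ _)) //; apply/bigmax_leqP => tau _.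
      by rewrite (leq_trans (size_scale_leq _ _)) // size_polyXn.
  apply/rowP => c; rewrite mxE; case: (enum_val c) (enum_valK c) => tau t <-.
  have := congr1 (fun p : {poly F} => p`_tau) (P0 t).
  rewrite coef0 coef_sum (bigD1 tau) //= big1 => [|i ne].
    rewrite addr0 coefZ coefXn eqxx mulr1 => /eqP.
    by rewrite mulf_eq0 expf_eq0 pnatr_eq0 (gtn_eqF d0) andbF => /eqP.
  rewrite coefZ coefXn eq_sym; case: eqP => [/val_inj e|]; last by rewrite mulr0.
  by rewrite e eqxx in ne.
exists (fun m => enum_val (fullrankfun fA m)).
have := fullrowsub_unit fA; rewrite unitmxE unitfE.
suff -> : rowsub (fullrankfun fA) A = \matrix_(m, c) interp_entry K d a b
   (natpair (enum_val (fullrankfun fA m))) (natpair (enum_val c)) by [].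
by apply/matrixP => m c; rewrite !mxE.
Qed.
End Minor.

Lemma bideg_le0 n m : bideg_le n m 0.
Proof. by split=> [|j]; rewrite ?coef0 size_poly0. Qed.

Lemma bideg_leD n m P Q : bideg_le n m P -> bideg_le n m Q -> bideg_le n m (P + Q).
Proof.
move=> [mP nP] [mQ nQ]; split=> [|j].
  by rewrite (leq_trans (size_polyD _ _)) // geq_max mP.
by rewrite coefD (leq_trans (size_polyD _ _)) // geq_max nP /=.
Qed.

Lemma bideg_le_sum n m (I : Type) (s : seq I) (P : pred I) f :
  (forall i, P i -> bideg_le n m (f i)) -> bideg_le n m (\sum_(i <- s | P i) f i).
Proof.
by move=> H; elim/big_rec: _ => [|i x Pi]; [exact: bideg_le0 | apply/bideg_leD/H].
Qed.

Lemma bideg_leM n m n' m' P Q :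
  bideg_le n m P -> bideg_le n' m' Q -> bideg_le (n + n') (m + m') (P * Q).
Proof.
move=> [mP nP] [mQ nQ]; split=> [|j].
  rewrite (leq_trans (size_polyMleq _ _)) //.
  by move: (leq_add mP mQ); rewrite addSn addnS; case: (_ + _)%N.
rewrite coefM (leq_trans (size_sum _ _ _)) //; apply/bigmax_leqP => i _.
rewrite (leq_trans (size_polyMleq _ _)) //.
by move: (leq_add (nP i) (nQ (j - i)%N)); rewrite addSn addnS; case: (_ + _)%N.
Qed.

Lemma bideg_le_det k n m (M : 'M_k) :
  (forall i j, bideg_le n m (M i j)) -> bideg_le (k * n) (k * m) (\det M).
Proof.
move=> bM; apply: bideg_le_sum => s _.
have bsgn (b : nat) : bideg_le 0 0 ((-1) ^+ b).
  rewrite -signr_odd; case: (odd b); rewrite ?expr0 ?expr1; last first.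
    by split=> [|[|j]]; rewrite ?size_poly1 // coefC /= ?size_poly1 ?size_poly0.
  by split=> [|[|j]]; rewrite ?size_polyN ?size_poly1 // coefN coefC /= ?size_polyN ?size_poly1 ?oppr0 ?size_poly0.
rewrite -[(k * n)%N]add0n -[(k * m)%N]add0n; apply: bideg_leM => //.
suff H r : bideg_le (size r * n) (size r * m) (\prod_(i <- r) M i (s i)).
  by have := H (index_enum 'I_k); rewrite /index_enum -enumT size_enum_ord.
elim: r => [|i r IH]; first by rewrite big_nil; apply: (bsgn 0%N).
by rewrite big_cons /= !mulSn; apply: bideg_leM.
Qed.

(* The argument of numq is an integer when d is a common multiple of 1, ..., K. *)
Definition qcoef (K d sigma k t : nat) : int :=
  numq (d%:R ^+ k * (qpol K sigma)^`(k).[t%:R]).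

(** The expansion of [horner_twopXn] as an integer polynomial. The factor [d ^+ tau] is split:
    [d ^+ k] makes [qcoef] integral and the rest stays visible. *)
Definition interp_poly (K d : nat) (r c : nat * nat) : {poly {poly int}} :=
  \sum_(k < c.1.+1)
    ((qcoef K d r.1 k c.2 * (d ^ (c.1 - k) * 'C(c.1, k) * r.2 ^ (c.1 - k))%:Z)%:P * 'X^(c.2 * r.2))%:P
      * 'X^(c.1 - k).

Lemma bideg_le_interp_poly K d r c n m :
  (c.2 * r.2 <= n)%N -> (c.1 <= m)%N -> bideg_le n m (interp_poly K d r c).
Proof.
move=> hn hm; apply: bideg_le_sum => k _; split=> [|j].
  rewrite (leq_trans (size_polyMleq _ _)) // size_polyXn addnS /=.
  apply: leq_trans (leq_add (size_polyC_leq1 _) (leqnn _)) _.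
  by rewrite add1n ltnS (leq_trans (leq_subr _ _)).
rewrite coefCM coefXn; case: eqP => _; rewrite ?mulr1 ?mulr0 ?size_poly0 //.
rewrite (leq_trans (size_polyMleq _ _)) // size_polyXn addnS /=.
by apply: leq_trans (leq_add (size_polyC_leq1 _) (leqnn _)) _; rewrite add1n ltnS.
Qed.

Lemma ev2_interp_poly (F : numFieldType) K d (u v : F) r c :
  (0 < d)%N -> (0 < K)%N -> (forall i, (0 < i <= K)%N -> (i %| d)%N) ->
  ev2 u v (interp_poly K d r c) = interp_entry K d u v r c.
Proof.
move=> d0 K0 dK; case: r c => [sg s] [tau t].
rewrite /interp_entry /interp_poly /= horner_twopXn mulr_sumr mulr_suml rmorph_sum.
apply: eq_bigr => k _.
have evX : ev2 u v 'X = v by rewrite /ev2 /= map_polyX /horner_eval hornerX.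
have evC (p : {poly int}) : ev2 u v p%:P = (map_poly intr p).[u].
  by rewrite /ev2 /= map_polyC /= /horner_eval hornerC.
rewrite rmorphM rmorphXn /= evX evC rmorphM /= map_polyC /= map_polyXn hornerM hornerC hornerXn.
have Dq : (qcoef K d sg k t)%:~R = d%:R ^+ k * (qpolF F K sg)^`(k).[t%:R] :> F.
  have -> : (qpolF F K sg)^`(k).[t%:R] = ratr ((qpol K sg)^`(k).[t%:R]).
    by rewrite /qpolF derivn_map -(rmorph_nat (ratr : {rmorphism rat -> F})) horner_map.
  rewrite -(rmorph_nat (ratr : {rmorphism rat -> F}) d) -rmorphXn -rmorphM -[LHS]ratr_int.
  congr ratr; apply: numqK; exact: (@int_derivs_qpol d K sg d0 K0 dK k t).
have kt : (k <= tau)%N by rewrite -ltnS.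
rewrite intrM Dq -pmulrn !natrM !natrX exprMn.
have -> : d%:R ^+ tau = d%:R ^+ (tau - k) * d%:R ^+ k :> F by rewrite -exprD subnK.
by ring.
Qed.

Section DetBounds.
Variable R : realType.
Local Notation C := R[i].
Implicit Types (alpha beta u v : C).

Lemma normc_leC (z : C) (x : R) : (`|z| <= (x%:C)%C) = (normc z <= x).
Proof. exact: lecR. Qed.

Lemma normc_nat n : normc (n%:R : C) = n%:R.
Proof. by rewrite -(rmorph_nat (real_complex R)) normc_real normr_nat. Qed.

Lemma normc_det n (M : 'M[C]_n) (W : R) :
  (forall i j, normc (M i j) <= W) -> normc (\det M) <= n`!%:R * W ^+ n.
Proof.
move=> MW; rewrite -normc_leC rmorphM rmorphXn rmorph_nat.
by apply: ler_norm_det => i j; rewrite normc_leC.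
Qed.

Lemma eventually_all (P : nat -> nat -> Prop) :
  (forall k, exists N0, forall N, (N0 <= N)%N -> P k N) ->
  forall m, exists N0, forall N, (N0 <= N)%N -> forall k, (k < m)%N -> P k N.
Proof.
move=> HP; elim=> [|m [N1 H1]]; first by exists 0%N.
have [N2 H2] := HP m; exists (maxn N1 N2) => N; rewrite geq_max => /andP[N1N N2N] k.
by rewrite ltnS leq_eqVlt => /orP[/eqP->|km]; [apply: H2 | apply: H1].
Qed.

Variables (K d L0 L1 S0 S1 : nat) (Q : R).
Hypothesis Q_ge : forall sg t, (sg < S0)%N -> (t < L1)%N ->
  l1n 1 (qpolF C K sg \Po ('X + t%:R%:P)) <= (Q%:C)%C.
Hypothesis d_gt0 : (0 < d)%N.

Lemma Q_ge0 sg t : (sg < S0)%N -> (t < L1)%N -> 0 <= Q.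
Proof. by move=> hs ht; rewrite -lecR (le_trans _ (Q_ge hs ht)) // l1n_ge0. Qed.

Lemma normc_twop sg t tau (z : C) (Y : R) : (sg < S0)%N -> (t < L1)%N -> (tau < L0)%N ->
  1 <= Y -> normc z <= Y -> tau%:R <= Y ->
  l1n (`|z|) (twop (qpolF C K sg) t%:R 'X^tau) <= ((Q * Y ^+ L0)%:C)%C.
Proof.
move=> hs ht htau Y1 zY tY.
have H : l1n `|z| (twop (qpolF C K sg) t%:R 'X^tau) <= (Q%:C)%C * (Y%:C)%C ^+ tau.
  apply: le_trans (l1n_twop (Y := (Y%:C)%C) _ _ _ _ _) _ => //.
  - by rewrite normc_leC.
  - by rewrite -(rmorph_nat (real_complex R)) lecR.
  by apply: ler_wpM2r; [rewrite exprn_ge0 // -(rmorph0 (real_complex R)) lecR (le_trans ler01) | exact: Q_ge].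
apply: le_trans H _; rewrite -rmorphXn -rmorphM lecR ler_wpM2l ?(Q_ge0 hs ht) //.
by rewrite ler_weXn2l // ltnW.
Qed.

Lemma dpow_le tau : (tau < L0)%N -> d%:R ^+ tau <= d%:R ^+ L0 :> R.
Proof. by move=> h; rewrite ler_weXn2l ?ler1n // ltnW. Qed.

Lemma interp_entry_normc (u v : C) r c (Y : R) :
  (r.1 < S0)%N -> (c.2 < L1)%N -> (c.1 < L0)%N ->
  1 <= Y -> r.2%:R * normc v <= Y -> c.1%:R <= Y ->
  normc (interp_entry K d u v r c) <= d%:R ^+ L0 * Q * Y ^+ L0 * normc u ^+ (c.2 * r.2).
Proof.
move=> hr hc2 hc1 Y1 rY cY; rewrite /interp_entry !ComplexField.Normc.normcM !normcX normc_nat.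
rewrite ler_wpM2r ?exprn_ge0 ?normc_ge0 // -mulrA.
apply: ler_pM; rewrite ?exprn_ge0 ?normc_ge0 ?dpow_le //.
rewrite -normc_leC; apply: le_trans (ler_norm_horner _ _) _.
by apply: normc_twop => //; rewrite ComplexField.Normc.normcM normc_nat.
Qed.

Lemma interp_det_normc n (rw cl : 'I_n -> nat * nat) (u v : C) :
  (forall m, (rw m).1 < S0)%N -> (forall m, (rw m).2 < S1)%N ->
  (forall l, (cl l).1 < L0)%N -> (forall l, (cl l).2 < L1)%N -> (S1 <= L0)%N ->
  normc (\det (\matrix_(m, l) interp_entry K d u v (rw m) (cl l))) <=
    n`!%:R * (d%:R ^+ L0 * Q * L0%:R ^+ L0) ^+ n *
    Num.max 1 (normc u) ^+ (n * (L1 * S1)) * Num.max 1 (normc v) ^+ (n * L0).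
Proof.
move=> r1 r2 c1 c2 SL.
set U := Num.max 1 (normc u); set V := Num.max 1 (normc v).
have U1 : 1 <= U by rewrite le_max lexx.
have V1 : 1 <= V by rewrite le_max lexx.
have V0 : 0 <= V := le_trans ler01 V1.
have -> : U ^+ (n * (L1 * S1)) = (U ^+ (L1 * S1)) ^+ n by rewrite mulnC exprM.
have -> : V ^+ (n * L0) = (V ^+ L0) ^+ n by rewrite mulnC exprM.
rewrite -!mulrA -!exprMn !mulrA.
apply: normc_det => m l; rewrite mxE.
have L0_1 : 1 <= L0%:R :> R by rewrite ler1n (leq_ltn_trans _ (c1 l)).
(* This value dominates the degree and also, because [S1 <= L0], the modulus of the point. *)
apply: le_trans (interp_entry_normc (Y := L0%:R * V) _ _ _ _ _ _ _) _ => //.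
- exact: mulr_ege1.
- apply: ler_pM; rewrite ?normc_ge0 // ?le_max ?lexx ?orbT //.
  by rewrite ler_nat (leq_trans _ SL) // ltnW.
- by apply: le_trans (_ : L0%:R * 1 <= _); rewrite ?ler_wpM2l // mulr1 ler_nat ltnW.
have Q0 : 0 <= Q := Q_ge0 (r1 m) (c2 l).
have -> : d%:R ^+ L0 * Q * L0%:R ^+ L0 * U ^+ (L1 * S1) * V ^+ L0 =
  d%:R ^+ L0 * Q * (L0%:R * V) ^+ L0 * U ^+ (L1 * S1) by rewrite exprMn; ring.
apply: ler_wpM2l; first by rewrite !mulr_ge0 ?exprn_ge0 ?mulr_ge0.
apply: le_trans (_ : U ^+ ((cl l).2 * (rw m).2) <= _).
  by rewrite lerXn2r ?nnegrE ?normc_ge0 ?(le_trans ler01) // le_max lexx orbT.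
by rewrite ler_weXn2l // leq_mul // ltnW.
Qed.

(** The factor 3 counts three contributions to an entry, each at most [H]: the exponential at radius
    [E], the distance from [alpha ^+ k] to the true value, and the truncation error. *)
Theorem interp_det_analytic n (rw cl : 'I_n -> nat * nat) alpha beta (E Y H : R) :
  (0 < K)%N ->
  (forall m, (rw m).1 < S0)%N -> (forall m, (rw m).2 < S1)%N ->
  (forall l, (cl l).1 < L0)%N -> (forall l, (cl l).2 < L1)%N ->
  1 <= E -> 1 <= Y -> L0%:R <= Y -> E * (S1%:R * normc beta) <= Y ->
  expR (E * normc beta * (L1 * S1)%:R) <= H ->
  (forall k, (k < L1 * S1)%N -> E ^+ n * normc (alpha ^+ k - cexp (beta *+ k)) <= H) ->
  normc (\det (\matrix_(m, l) interp_entry K d alpha beta (rw m) (cl l)))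
     * E ^+ (\sum_(j < n) j - n * S0) <=
  n`!%:R * (d%:R ^+ L0 * Q * Y ^+ L0 * (3 * H)) ^+ n.
Proof.
move=> K0 r1 r2 c1 c2 E1 Y1 LY EY expH close.
have E0 : 0 < E by apply: lt_le_trans E1.
(* The precision is 1 / E^n, so that the truncation error stays at most 1 after multiplication by
   E^n. *)
have [N0 HN0] := eventually_all (fun k => cexp_approx (beta *+ k) (divr_gt0 ltr01 (exprn_gt0 n E0))) (L1 * S1).
pose N := maxn n N0.
have HN k : (k < L1 * S1)%N -> E ^+ n * normc (cexp (beta *+ k) - (expt N 1).[beta *+ k]) <= 1.
  move=> kL; rewrite mulrC -ler_pdivlMr ?exprn_gt0 //; apply: HN0 => //; exact: leq_maxr.
have H1 : 1 <= H.
  by apply: le_trans expH; rewrite -[leLHS]expR0 ler_expR mulr_ge0 // mulr_ge0 ?normc_ge0 // ltW.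
set M := \matrix_(m, l) _; set W := d%:R ^+ L0 * Q * Y ^+ L0 * (3 * H).
set sg := fun m => (rw m).1.
suff : `|\det M| * ((E%:C)%C : C) ^+ (\sum_(j < n) j - \sum_(m < n) sg m) <= n`!%:R * ((W%:C)%C : C) ^+ n.
  rewrite -[`|\det M|]/((normc (\det M))%:C)%C -!rmorphXn -(rmorph_nat (real_complex R)) -!rmorphM lecR.
  apply: le_trans; rewrite ler_wpM2l ?normc_ge0 // ler_weXn2l // leq_sub2l //.
  by rewrite -[X in (_ <= X * _)%N]card_ord -sum_nat_const leq_sum // => m _; apply/ltnW/r1.
apply: (interpolation_det_bound (c := fun l => d%:R ^+ (cl l).1) (tau_t := fun l => (cl l).2%:R)
  (q := fun m => qpolF C K (rw m).1) (x := fun m => (rw m).2%:R * beta) (tau := fun l => (cl l).1) (N := N)).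
- by rewrite -(rmorph1 (real_complex R)) lecR.
- exact: leq_maxl.
- by move=> m; rewrite size_qpolF.
move=> m l; cbv zeta; set p := _ *: _; rewrite mxE.
set k := ((cl l).2 * (rw m).2)%N.
have Q0 : 0 <= Q := Q_ge0 (r1 m) (c2 l).
have Y0 : 0 <= Y := le_trans ler01 Y1.
have kL : (k < L1 * S1)%N.
  by apply: leq_ltn_trans (_ : k <= (cl l).2 * S1)%N _; rewrite ?leq_mul ?(ltnW (r2 m)) // ltn_pmul2r // (leq_ltn_trans _ (r2 m)).
have tY : (cl l).1%:R <= Y by apply: le_trans LY; rewrite ler_nat ltnW.
have nx : normc ((rw m).2%:R * beta) <= S1%:R * normc beta.
  by rewrite ComplexField.Normc.normcM normc_nat ler_wpM2r ?normc_ge0 // ler_nat ltnW.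
set B := d%:R ^+ L0 * Q * Y ^+ L0.
have B0 : 0 <= B by rewrite !mulr_ge0 ?exprn_ge0.
have nd tau : `|d%:R ^+ tau : C| = ((d%:R ^+ tau)%:C)%C by rewrite normrX normr_nat rmorphXn rmorph_nat.
have Dp : p.[(rw m).2%:R * beta] = d%:R ^+ (cl l).1 *
    (twop (qpolF C K (rw m).1) (cl l).2%:R 'X^((cl l).1)).[(rw m).2%:R * beta] *
    (expt N 1).[beta *+ k].
  rewrite /p hornerZ hornerM mulrA; congr (_ * _).
  by rewrite [LHS]horner_expt_scale mulrA -natrM mulr_natl.
have H1le : l1n ((E%:C)%C * `|(rw m).2%:R * beta|) p <= ((B * H)%:C)%C.
  have r0 : (0 : C) <= (E%:C)%C * `|(rw m).2%:R * beta|.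
    by rewrite mulr_ge0 // -(rmorph0 (real_complex R)) lecR ltW.
  have Er : (E%:C)%C * `|(rw m).2%:R * beta| = `|(E%:C)%C * ((rw m).2%:R * beta)|.
    by rewrite [RHS]normrM ger0_norm // -(rmorph0 (real_complex R)) lecR ltW.
  have nEr : normc ((E%:C)%C * ((rw m).2%:R * beta)) <= E * (S1%:R * normc beta).
    by rewrite ComplexField.Normc.normcM normc_real gtr0_norm // ler_wpM2l // ltW.
  rewrite /p l1nZ nd.
  apply: le_trans (_ : ((d%:R ^+ L0)%:C)%C * (((Q * Y ^+ L0)%:C)%C * (H%:C)%C) <= _); last first.
    by rewrite -!rmorphM lecR /B !mulrA.
  apply: ler_pM; rewrite ?l1n_ge0 //.
  - by rewrite -(rmorph0 (real_complex R)) lecR exprn_ge0.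
  - by rewrite lecR dpow_le.
  apply: le_trans (l1nM _ _ r0) _; apply: ler_pM; rewrite ?l1n_ge0 //.
    rewrite Er; apply: normc_twop => //; exact: le_trans nEr EY.
  rewrite l1n_expt normr_nat Er.
  set rr := normc ((E%:C)%C * ((rw m).2%:R * beta)) in nEr.
  have -> : (expt N (cl l).2%:R).[`|(E%:C)%C * ((rw m).2%:R * beta)|] =
      (((expt N ((cl l).2%:R * rr)).[1])%:C)%C.
    rewrite -expt_real rmorphM rmorph_nat [LHS]horner_expt_scale [RHS]horner_expt_scale mulr1.
    by [].
  rewrite lecR; apply: le_trans (expt_le_expR _ _) _; first by rewrite mulr_ge0 ?normc_ge0.
  apply: le_trans expH; rewrite ler_expR natrM.
  apply: le_trans (_ : L1%:R * (E * (S1%:R * normc beta)) <= _); last by rewrite le_eqVlt; apply/orP; left; apply/eqP; ring.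
  by apply: ler_pM; rewrite ?normc_ge0 // ler_nat ltnW.
have H2le : normc (interp_entry K d alpha beta (rw m) (cl l) - p.[(rw m).2%:R * beta]) * E ^+ n <= B * (H + 1).
  rewrite Dp /interp_entry /= -/k -mulrBr ComplexField.Normc.normcM -mulrA.
  apply: ler_pM; rewrite ?mulr_ge0 ?normc_ge0 ?exprn_ge0 ?(ltW E0) //.
    rewrite ComplexField.Normc.normcM normcX normc_nat /B -mulrA.
    apply: ler_pM; rewrite ?exprn_ge0 ?normc_ge0 ?dpow_le //.
    rewrite -normc_leC; apply: le_trans (ler_norm_horner _ _) _.
    apply: normc_twop => //; apply: le_trans nx (le_trans _ EY).
    by rewrite ler_peMl // mulr_ge0 ?normc_ge0.
  rewrite -[alpha ^+ k - _](subrKA (cexp (beta *+ k))) mulrC.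
  apply: le_trans (ler_wpM2l _ (le_normcD _ _)) _; first by rewrite exprn_ge0 // ltW.
  by rewrite mulrDr; apply: lerD; [apply: close | apply: HN].
apply: le_trans (lerD H1le (lexx _)) _.
rewrite -rmorphXn -[`|_ - _|]/((normc _)%:C)%C -rmorphM -rmorphD lecR mulrC.
apply: le_trans (lerD (lexx _) _) _; first by rewrite mulrC; exact: H2le.
rewrite /W -/B; nra.
Qed.
End DetBounds.

(** * Choice of the parameters *)

Section Numeric.
Variable R : realType.
Implicit Types (x y : R).

Lemma ceil_nat x : 0 <= x -> exists n : nat, x <= n%:R <= x + 1.
Proof.
move=> x0; exists (Num.truncn x).+1; have /andP[h1 h2] := truncn_itv x0.
by rewrite ltW //= -natr1 lerD2r.
Qed.

Lemma expR1_ge : 26 / 10 <= expR 1 :> R.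
Proof.
apply: le_trans (expt_le_expR 4 ler01).
rewrite horner_poly !big_ord_recl big_ord0 /= /bump /= !expr1n !mulr1 !factS fact0.
rewrite !mul1r invr1 -[((1 + 0).+1 * (1 * 1))%N]/2%N -[((1 + (1 + 0)).+1 * 2)%N]/6%N.
lra.
Qed.

Lemma expR_nat_ge (c : R) n : c <= (26 / 10) ^+ n -> c <= expR n%:R.
Proof.
move=> h; apply: le_trans h _; rewrite -[n%:R]mulr1 expRM_natl lerXn2r ?nnegrE ?expR_ge0 //.
  by lra.
exact: expR1_ge.
Qed.

Lemma ln_le_nat (c : R) n : 0 < c -> c <= (26 / 10) ^+ n -> ln c <= n%:R.
Proof. by move=> c0 /expR_nat_ge h; rewrite -ler_expR lnK. Qed.

Lemma ln16 : ln 16 <= 3 :> R.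
Proof. by apply: (ln_le_nat (n := 3)) => //; lra. Qed.

Lemma ln4 : ln 4 <= 3 / 2 :> R.
Proof.
have := ln16; have -> : 16 = 4 ^+ 2 :> R by ring.
by rewrite lnXn //; lra.
Qed.

(** The tangent of [ln] at 16, with [ln 16 <= 3]. *)
Lemma ln_le_tangent x : 0 < x -> ln x <= x / 16 + 2.
Proof.
move=> x0; have -> : x = (1 + (x / 16 - 1)) * 16 by field.
rewrite lnM ?posrE //; last by rewrite addrC subrK divr_gt0.
have := le_ln1Dx (x := x / 16 - 1) _; have := ln16.
have -> : (1 + (x / 16 - 1)) * 16 / 16 = x / 16 by field.
have : 0 < x / 16 by rewrite divr_gt0.
lra.
Qed.

Lemma ln_ge_1subV x : 0 < x -> x - 1 <= x * ln x.
Proof.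
move=> x0; have h : ln x^-1 <= x^-1 - 1.
  have {1}-> : x^-1 = 1 + (x^-1 - 1) by rewrite addrC subrK.
  apply: le_ln1Dx.
  by have : 0 < x^-1 by [rewrite invr_gt0]; lra.
rewrite lnV ?posrE // in h.
have -> : x - 1 = x * (1 - x^-1) by rewrite mulrBr mulr1 divff // gt_eqF.
by apply: ler_wpM2l; [exact: ltW | lra].
Qed.

(** With Z = D K M S w the right-hand side is 8 Z. The factors 4, 20 and 48 are such that the five
    main terms [t1] to [t5] take at most 0.35, 1.5, 1.77, 2 and 1.6 times Z, in all 7.22 Z; the rest
    is little more than Z / 16. *)
Lemma parameter_inequality (D K M S w a b g lD lN L1 L0 S0 : R) :
  1 <= D -> 1 <= w -> w <= a -> w <= b -> 0 <= lD -> D - 1 <= D * lD -> g = D * lD + w ->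
  4 * b <= K * w -> 20 * a <= M * w -> 48 * g <= S * w ->
  lN <= 5 + lD + (K * M * S) / 16 ->
  L1 = 16 * D * K -> L0 = S * M -> S0 = (M + 1) * L1 ->
  D * lN + D * L0 * (3 / 2 * K) + D * ((S0 + K) * (4 + lD)) + 8 * (D * L0 * b) + 2
    + 2 * (a * (L1 * S)) + w / 2 + w * S0 < w * (L0 * L1) / 2.
Proof.
move=> D1 w1 wa wb lD0 DlD Dg Kb Ma Sg lNle DL1 DL0 DS0.
have w0 : 0 < w by clear -w1; lra.
have quot (c x y : R) : w <= x -> 0 < c -> c * x <= y * w -> c <= y.
  move=> wx c0 h; rewrite -(ler_pM2r w0); apply: le_trans h.
  by rewrite ler_pM2l.
have gw : w <= g by rewrite Dg lerDr mulr_ge0 //; clear -D1; lra.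
have K4 : 4 <= K by apply: quot Kb.
have M20 : 20 <= M by apply: quot Ma.
have S48 : 48 <= S by apply: quot Sg.
have D0 : 0 <= D by clear -D1; lra.
have K0 : 0 <= K by clear -K4; lra.
have M0 : 0 <= M by clear -M20; lra.
have S00 : 0 <= S by clear -S48; lra.
have w00 := ltW w0.
pose Z := D * K * M * S * w.
have KMS : 4 * 20 * 48 <= K * M * S.
  by apply: ler_pM => //; [exact: mulr_ge0 | apply: ler_pM].
have DKMS : 1000 * D <= D * K * M * S.
  have -> : D * K * M * S = (K * M * S) * D by ring.
  by rewrite ler_wpM2r //; clear -KMS; lra.
have DKMS1 : 1000 <= D * K * M * S by clear -DKMS D1; lra.
have ZD : D * K * M * S <= Z by rewrite /Z ler_peMr // !mulr_ge0.
have Zw : 1000 * w <= Z by rewrite /Z ler_pM2r.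
have t1 : w * S0 <= 35 / 100 * Z.
  have -> : w * S0 = 16 * (D * K * w) * (M + 1) by rewrite DS0 DL1; ring.
  have -> : 35 / 100 * Z = 16 * (D * K * w) * (M * (21 / 20) * (S / 48)) by rewrite /Z; field.
  apply: ler_wpM2l; first by rewrite !mulr_ge0.
  apply: le_trans (_ : M * (21 / 20) * 1 <= _); first by clear -M20; lra.
  by apply: ler_wpM2l; [rewrite mulr_ge0 // | ]; clear -S48; lra.
have t2 : D * L0 * (3 / 2 * K) <= 3 / 2 * Z.
  have -> : D * L0 * (3 / 2 * K) = 3 / 2 * (D * K * M * S) by rewrite DL0; ring.
  by clear -ZD; lra.
have t3 : D * ((S0 + K) * (4 + lD)) <= 177 / 100 * Z.
  have -> : D * ((S0 + K) * (4 + lD)) = (S0 + K) * (D * (4 + lD)) by ring.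
  have h1 : D * (4 + lD) <= 5 * (S * w / 48) by clear -DlD Dg Sg w1; lra.
  have SKE : S0 + K = 16 * (D * K) * (M + 1) + K by rewrite DS0 DL1; ring.
  have h2 : S0 + K <= 16 * (D * K) * (M * (106 / 100)).
    have h : 0 <= D * K * (M * (106 / 100) - M - 1 - 1 / 16).
      by rewrite !mulr_ge0 //; clear -M20; lra.
    have KDK : K <= D * K by rewrite ler_peMl.
    by clear -SKE h KDK; lra.
  have h3 : 0 <= D * (4 + lD) by rewrite mulr_ge0 // addr_ge0.
  have h4 : 0 <= S0 + K by rewrite SKE addr_ge0 // !mulr_ge0 // addr_ge0.
  apply: le_trans (ler_pM h4 h3 h2 h1) _.
  have -> : 16 * (D * K) * (M * (106 / 100)) * (5 * (S * w / 48)) = 16 * (106 / 100) * 5 / 48 * Z.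
    by rewrite /Z; field.
  by clear -Zw w0; lra.
have t4 : 8 * (D * L0 * b) <= 2 * Z.
  have -> : 8 * (D * L0 * b) = 2 * (D * S * M) * (4 * b) by rewrite DL0; ring.
  have -> : 2 * Z = 2 * (D * S * M) * (K * w) by rewrite /Z; ring.
  by apply: ler_wpM2l => //; rewrite !mulr_ge0.
have t5 : 2 * (a * (L1 * S)) <= 16 / 10 * Z.
  have -> : 2 * (a * (L1 * S)) = 16 / 10 * (D * K * S) * (20 * a) by rewrite DL1; field.
  have -> : 16 / 10 * Z = 16 / 10 * (D * K * S) * (M * w) by rewrite /Z; ring.
  by apply: ler_wpM2l => //; rewrite !mulr_ge0 ?invr_ge0.
have t6 : D * lN <= 5 * D + D * lD + Z / 16.
  apply: le_trans (ler_wpM2l D0 lNle) _.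
  have -> : D * (5 + lD + K * M * S / 16) = 5 * D + D * lD + (D * K * M * S) / 16 by field.
  by clear -ZD; lra.
have t7 : D * lD <= Z / 1000.
  have h1 : 48 * (D * lD) <= S * w by clear -Dg Sg w0; lra.
  have h2 : S * w * 80 <= Z.
    rewrite /Z (_ : D * K * M * S * w = S * w * (D * K * M)); last by ring.
    apply: ler_wpM2l; first exact: mulr_ge0.
    have h : 1 * 4 * 20 <= D * K * M by apply: ler_pM => //; [exact: mulr_ge0 | apply: ler_pM].
    by clear -h; lra.
  by clear -h1 h2 Zw w0; lra.
have -> : w * (L0 * L1) / 2 = 8 * Z by rewrite DL0 DL1 /Z; field.
by clear -t1 t2 t3 t4 t5 t6 t7 DKMS Zw w1 ZD D1; lra.
Qed.
End Numeric.

(** * Comparison of the two estimates of the minor *)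

Section Core.
Variable R : realType.
Local Notation C := R[i].
Implicit Types (alpha beta : C).

Lemma adjoin_degree_gt0 alpha beta D : is_adjoin_degree alpha beta D -> (0 < D)%N.
Proof. by case/adjoin_degree_conjugates => f [pa [pb [z [i0 _]]]]; apply: leq_ltn_trans (ltn_ord i0). Qed.

Lemma weil_height_ge0 alpha beta D : algebraic_number beta ->
  is_adjoin_degree alpha beta D -> 0 <= weil_height beta.
Proof.
move=> algb degD; have D0 := adjoin_degree_gt0 degD.
have [f [pa [pb [z [i0 [irrf Df injz [_ Db]]]]]]] := adjoin_degree_conjugates degD.
have [b [b0 _ hb]] := height_conjugates algb irrf Df injz Db.
rewrite -(pmulr_rge0 _ (_ : 0 < D%:R)) ?ltr0n // -hb addr_ge0 //.
  by apply: ln_ge0; rewrite ler1z -gtz0_ge1.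
by apply: sumr_ge0 => i _; apply: ln_ge0; rewrite le_max lexx.
Qed.

Lemma normc_subX (x y : C) (m eps : R) k : 1 <= m -> normc y <= m -> normc (x - y) <= eps ->
  normc (x ^+ k - y ^+ k) <= k%:R * eps * (m + eps) ^+ k.
Proof.
move=> m1 ym xy; have e0 : 0 <= eps := le_trans (normc_ge0 _) xy.
have xm : normc x <= m + eps.
  by rewrite -[x](subrK y) addrC; apply: le_trans (le_normcD _ _) _; apply: lerD.
rewrite subrXX ComplexField.Normc.normcM mulrC [k%:R * _]mulrC -mulrA [leRHS]mulrC.
apply: ler_pM; rewrite ?normc_ge0 //.
rewrite -[normc _]/(normc _) -lecR -[X in X <= _]/(`|\sum_(i < k) x ^+ (k.-1 - i) * y ^+ i|).
apply: le_trans (ler_norm_sum _ _ _) _.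
have -> : ((k%:R * (m + eps) ^+ k)%:C)%C = \sum_(i < k) (((m + eps) ^+ k)%:C)%C :> C.
  by rewrite sumr_const card_ord rmorphM rmorph_nat mulr_natl.
apply: ler_sum => i _; rewrite normc_leC ComplexField.Normc.normcM !normcX.
have ik : (k.-1 - i + i <= k)%N by have := ltn_ord i; lia.
apply: le_trans (_ : (m + eps) ^+ (k.-1 - i + i) <= _).
  rewrite exprD; apply: ler_pM; rewrite ?exprn_ge0 ?normc_ge0 //.
    by rewrite lerXn2r ?nnegrE ?normc_ge0 ?addr_ge0 // (le_trans ler01).
  by rewrite lerXn2r ?nnegrE ?normc_ge0 ?addr_ge0 ?(le_trans ler01 m1) // (le_trans ym) // lerDl.
by rewrite ler_weXn2l // (le_trans m1) // lerDl.
Qed.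

Lemma ln3 : ln 3 <= 2 :> R.
Proof. by apply: (ln_le_nat (n := 2)) => //; lra. Qed.

Lemma fact_le_exp n : (n`! <= n ^ n)%N.
Proof.
rewrite fact_prod big_add1 /= big_mkord -[X in (_ <= _ ^ X)%N]card_ord -prod_nat_const.
by apply: leq_prod => i _.
Qed.

Lemma sum_ord_real n : (\sum_(j < n) (j : nat))%N%:R = n%:R * (n%:R - 1) / 2 :> R.
Proof.
elim: n => [|n IH]; first by rewrite big_ord0 !mul0r.
by rewrite big_ord_recr /= natrD IH -natr1; field.
Qed.

(** Since K^j / j! is at most e^K, each binomial factor costs at most (16 e D)^K, in which [K]
    survives only in the exponent. The incomplete last factor accounts for the extra [K] in
    [S0 + K]. *)
Lemma qpol_norm_bound (K D s t : nat) : (0 < K)%N -> (0 < D)%N -> (t < 16 * D * K)%N ->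
  forall S0, (s < S0)%N ->
  l1n 1 (qpolF C K s \Po ('X + t%:R%:P)) <= (((16 * expR 1 * D%:R) ^+ (S0 + K) : R)%:C)%C.
Proof.
move=> K0 D0 tL S0 sS.
set c : R := 16 * expR 1 * D%:R.
have e1 : 1 <= expR 1 :> R by rewrite -[leLHS]expR0 ler_expR.
have D1 : 1 <= D%:R :> R by rewrite ler1n.
have c1 : 1 <= c by rewrite /c !mulr_ege1 // ler1n.
have step j : (j <= K)%N -> (16 * D * K)%:R ^+ j / j`!%:R <= c ^+ K :> R.
  move=> jK; have -> : (16 * D * K)%:R ^+ j / j`!%:R = (16 * D%:R) ^+ j * (K%:R ^+ j / j`!%:R) :> R.
    by rewrite !natrM exprMn mulrA.
  have -> : c = (16 * D%:R) * expR 1 by rewrite /c; ring.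
  rewrite [leRHS]exprMn; apply: ler_pM; rewrite ?divr_ge0 ?exprn_ge0 ?mulr_ge0 //.
    by rewrite ler_weXn2l // mulr_ege1 // ler1n.
  rewrite -expRM_natl mulr1; case: j {jK} => [|j].
    by rewrite expr0 fact0 divr1 -[leLHS]expR0 ler_expR.
  by apply: le_trans (expR_ge1Dxn j _) => //; rewrite lerDr.
have KL : (K <= 16 * D * K)%N by rewrite leq_pmull // muln_gt0.
apply: le_trans (l1n_qpol_shift C s K0 tL KL) _.
have toR j : (16 * D * K)%:R ^+ j / j`!%:R = ((((16 * D * K)%:R ^+ j / j`!%:R : R))%:C)%C :> C.
  by rewrite [RHS](rmorphM (real_complex R)) (rmorphXn (real_complex R)) (fmorphV (real_complex R)) !(rmorph_nat (real_complex R)).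
rewrite !toR -rmorphXn -rmorphM lecR.
apply: le_trans (_ : (c ^+ K) ^+ (s %/ K) * c ^+ K <= _).
  have nn j : 0 <= (16 * D * K)%:R ^+ j / j`!%:R :> R by rewrite divr_ge0 ?exprn_ge0.
  apply: ler_pM; [exact/exprn_ge0/nn | exact: nn | | by apply/step/ltnW; rewrite ltn_pmod].
  by rewrite lerXn2r ?nnegrE ?nn ?exprn_ge0 ?(le_trans ler01 c1) // step.
rewrite -exprM -exprD ler_weXn2l // leq_add2r mulnC (leq_trans (leq_trunc_div _ _)) //; exact: ltnW.
Qed.
End Core.

Section Core.
Variable R : realType.
Local Notation C := R[i].

(** The upper and lower bounds of the minor are combined, logarithms are taken, and the result is
    divided by [n]. On the right, [3 / 2] bounds ln 4 (from [d <= 4 ^ K]), 4 bounds ln 16 + 1, and 2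
    bounds ln 3. One of the terms [a * (L1 * S)] is ln H, the other comes from the height of
    alpha. *)
Lemma liouville_interpolation_inequality (alpha beta : C) (D K M S : nat) (a h E H : R) :
  algebraic_number alpha -> algebraic_number beta -> is_adjoin_degree alpha beta D ->
  alpha != 0 -> beta != 0 -> (0 < K)%N -> (0 < M)%N -> (0 < S)%N -> expR 1 <= E ->
  D%:R * weil_height alpha <= a -> weil_height beta = h -> 
  let L1 := (16 * D * K)%N in let L0 := (S * M)%N in let S0 := (M.+1 * L1)%N in let n := (L0 * L1)%N in
  E * (S%:R * normc beta) <= L0%:R * ln E ->
  H = expR (a * (L1 * S)%:R) -> E * normc beta <= a ->
  (forall k, (k < L1 * S)%N -> E ^+ n * normc (alpha ^+ k - cexp (beta *+ k)) <= H) ->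
  ln E * ((n%:R - 1) / 2 - S0%:R) <=
    D%:R * ln n%:R + D%:R * L0%:R * (3 / 2 * K%:R) + D%:R * ((S0 + K)%:R * (4 + ln D%:R))
    + D%:R * L0%:R * ln L0%:R + L0%:R * ln (ln E) + 2 + a * (L1 * S)%:R + a * (L1 * S)%:R
    + D%:R * (L0%:R * h).
Proof.
move=> alga algb degD nza nzb K0 M0 Sp Ee Da Dh L1 L0 S0 n EY DH Eb close.
have D0 : (0 < D)%N := adjoin_degree_gt0 degD.
have L1p : (0 < L1)%N by rewrite /L1 !muln_gt0 D0 K0.
have L0p : (0 < L0)%N by rewrite /L0 muln_gt0 Sp.
have np : (0 < n)%N by rewrite /n muln_gt0 L0p.
have e2 : 1 <= expR 1 :> R by rewrite -[leLHS]expR0 ler_expR.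
have E1 : 1 <= E := le_trans e2 Ee.
have E0 : 0 < E by apply: lt_le_trans E1.
have w1 : 1 <= ln E by rewrite -[leLHS]expRK ler_ln ?posrE ?expR_gt0.
have w0 : 0 < ln E by apply: lt_le_trans w1.
have [d /andP[d0 d4] dK] := common_multiple_exp4 K.
have L1S0 : (L1 <= S0)%N by rewrite /S0 leq_pmull.
have cond : (L0.-1 * L1 < (S0 - L1).+1 * S)%N.
  have -> : (S0 - L1)%N = (M * L1)%N by rewrite /S0 mulSn addKn.
  apply: leq_ltn_trans (_ : L0 * L1 < _)%N; first by rewrite leq_mul ?leq_pred.
  have -> : (L0 * L1 = M * L1 * S)%N by rewrite /L0 -mulnA mulnC.
  by rewrite mulSn -[X in (X < _)%N]add0n ltn_add2r.
have [rw nzdet] := nonzero_minor nza nzb K0 d0 L1S0 cond.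
set N := #|{: 'I_L0 * 'I_L1}| in rw nzdet.
have NE : N = n by rewrite /N card_prod !card_ord.
pose rr m := natpair (rw m); pose cc (l : 'I_N) := natpair (enum_val l).
have r1 m : ((rr m).1 < S0)%N by apply: ltn_ord.
have r2 m : ((rr m).2 < S)%N by apply: ltn_ord.
have c1 l : ((cc l).1 < L0)%N by apply: ltn_ord.
have c2 l : ((cc l).2 < L1)%N by apply: ltn_ord.
set Q : R := (16 * expR 1 * D%:R) ^+ (S0 + K).
have HQ sg t : (sg < S0)%N -> (t < L1)%N -> l1n 1 (qpolF C K sg \Po ('X + t%:R%:P)) <= (Q%:C)%C.
  by move=> hs ht; apply: qpol_norm_bound.
have D1 : 1 <= D%:R :> R by rewrite ler1n.
have Q1 : 1 <= Q by rewrite /Q exprn_ege1 // !mulr_ege1 // ler1n.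
pose P : {poly {poly int}} := \det (\matrix_(m, l) interp_poly K d (rr m) (cc l)).
have evP u v : ev2 u v P = \det (\matrix_(m, l) interp_entry K d u v (rr m) (cc l)) :> C.
  rewrite /P -det_map_mx; congr (\det _); apply/matrixP => m l.
  by rewrite !mxE; apply: ev2_interp_poly.
set x := ev2 alpha beta P.
have nzx : x != 0 by rewrite /x evP.
have bP : bideg_le (N * (L1 * S)) (N * L0) P.
  apply: bideg_le_det => m l; rewrite mxE; apply: bideg_le_interp_poly; last exact: ltnW.
  by apply: leq_mul; apply: ltnW.
set W0 : R := d%:R ^+ L0 * Q * L0%:R ^+ L0.
have d1 : 1 <= d%:R :> R by rewrite ler1n.
have W01 : 1 <= W0 by rewrite /W0 !mulr_ege1 // exprn_ege1 // ler1n.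
have SL0 : (S <= L0)%N by rewrite leq_pmulr.
set B : R := N`!%:R * W0 ^+ N.
have B1 : 1 <= B by rewrite /B mulr_ege1 ?exprn_ege1 // ler1n fact_gt0.
have PB u v : normc (ev2 u v P) <= B * Num.max 1 (normc u) ^+ (N * (L1 * S)) * Num.max 1 (normc v) ^+ (N * L0).
  by rewrite evP; apply: (interp_det_normc HQ d0 u v r1 r2 c1 c2 SL0).
have lio := liouville_two alga algb degD bP (le_trans ler01 B1) PB nzx.
set Y := L0%:R * ln E.
have Y1 : 1 <= Y by rewrite /Y mulr_ege1 // ler1n.
have LY : L0%:R <= Y by rewrite /Y ler_peMr.
have expH : expR (E * normc beta * (L1 * S)%:R) <= H by rewrite DH ler_expR ler_wpM2r.
have H0 : 0 < H by rewrite DH expR_gt0.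
have ana := interp_det_analytic HQ d0 K0 r1 r2 c1 c2 E1 Y1 LY EY expH.
rewrite -NE in close *; move: (ana alpha close) => {}ana; rewrite -evP -/x in ana.
set T := (\sum_(j < N) j - N * S0)%N in ana.
set hh := D%:R * _ in lio.
have x0 : 0 < normc x.
  rewrite lt_def normc_ge0 andbT; apply: contra nzx => /eqP /ComplexField.Normc.eq0_normc ->.
  exact: eqxx.
(* The analytic bound contains the same factor [B] as the trivial bound of the other conjugates,
   hence [B ^+ D]. What remains of [Y] is only a power of ln E. *)
have key : E ^+ T <= B ^+ D * (Y ^+ L0 / L0%:R ^+ L0 * (3 * H)) ^+ N * expR hh.
  have h1 : E ^+ T <= normc x * E ^+ T * (B ^+ D.-1 * expR hh).
    rewrite mulrAC -[leLHS]mul1r ler_wpM2r ?exprn_ge0 ?(ltW E0) //.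
    by rewrite mulrA.
  apply: le_trans h1 _; apply: le_trans (ler_wpM2r _ ana) _.
    by rewrite mulr_ge0 ?expR_ge0 // exprn_ge0 // (le_trans ler01).
  have -> : d%:R ^+ L0 * Q * Y ^+ L0 * (3 * H) = W0 * (Y ^+ L0 / L0%:R ^+ L0 * (3 * H)).
    have lnz : L0%:R ^+ L0 != 0 :> R by rewrite expf_neq0 // pnatr_eq0 -lt0n.
    by rewrite /W0; field.
  have -> : B ^+ D = B * B ^+ D.-1 by rewrite -exprS prednK.
  rewrite /B exprMn le_eqVlt; apply/orP; left; apply/eqP; ring.
have Lp : 0 < L0%:R :> R by rewrite ltr0n.
have YL : Y ^+ L0 / L0%:R ^+ L0 = ln E ^+ L0.
  by rewrite /Y exprMn mulrAC divff ?mul1r // expf_neq0 // gt_eqF.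
have lnkey : ln E *+ T <= ln B *+ D + (L0%:R * ln (ln E) + ln 3 + a * (L1 * S)%:R) *+ N + hh.
  have B0 : 0 < B := lt_le_trans ltr01 B1.
  have V0 : 0 < ln E ^+ L0 * (3 * H) by rewrite !mulr_gt0 ?exprn_gt0.
  rewrite -lnXn // -(lnXn D B0) -[hh]expRK.
  have -> : L0%:R * ln (ln E) + ln 3 + a * (L1 * S)%:R = ln (ln E ^+ L0 * (3 * H)).
    by rewrite lnM ?posrE ?exprn_gt0 ?mulr_gt0 // lnM ?posrE // lnXn // DH expRK mulr_natl addrA.
  rewrite -lnXn // -!lnM ?posrE ?mulr_gt0 ?exprn_gt0 ?expR_gt0 //.
  by rewrite ler_ln ?posrE ?mulr_gt0 ?exprn_gt0 ?expR_gt0 // -YL.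
have lnB : ln B <= N%:R * ln N%:R + N%:R * (L0%:R * (3 / 2 * K%:R) + (S0 + K)%:R * (4 + ln D%:R) + L0%:R * ln L0%:R).
  have W00 : 0 < W0 := lt_le_trans ltr01 W01.
  rewrite /B lnM ?posrE ?exprn_gt0 ?ltr0n ?fact_gt0 // lnXn //.
  have Np : 0 < N%:R :> R by rewrite ltr0n NE.
  apply: lerD.
    rewrite mulr_natl -lnXn // ler_ln ?posrE ?exprn_gt0 //; last by rewrite ltr0n fact_gt0.
    by rewrite -natrX ler_nat fact_le_exp.
  rewrite mulr_natl lerMn2r; apply/orP; right.
  have dp : 0 < d%:R :> R := lt_le_trans ltr01 d1.
  have Qp : 0 < Q := lt_le_trans ltr01 Q1.
  have dLp : 0 < d%:R ^+ L0 :> R by apply: exprn_gt0.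
  have LLp : 0 < L0%:R ^+ L0 :> R by apply: exprn_gt0.
  have -> : ln W0 = ln d%:R *+ L0 + ln Q + L0%:R * ln L0%:R.
    by rewrite /W0 lnM ?posrE ?mulr_gt0 // lnM ?posrE // (lnXn _ dp) (lnXn _ Lp) [L0%:R * _]mulr_natl.
  rewrite lerD2r.
  apply: lerD.
    rewrite [leRHS]mulr_natl lerMn2r; apply/orP; right.
    apply: le_trans (_ : ln (4 ^+ K) <= _).
      by rewrite ler_ln ?posrE ?exprn_gt0 // -natrX ler_nat.
    by rewrite lnXn // [leRHS]mulr_natr lerMn2r ln4 orbT.
  have Dp : 0 < D%:R :> R by rewrite ltr0n.
  rewrite /Q lnXn ?mulr_gt0 ?expR_gt0 // [leRHS]mulr_natl lerMn2r; apply/orP; right.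
  rewrite lnM ?posrE ?mulr_gt0 ?expR_gt0 // lnM ?posrE ?expR_gt0 // expRK lerD2r.
  by apply: le_trans (lerD (ln16 R) (lexx 1)) _; rewrite natr1.
have Np : 0 < N%:R :> R by rewrite ltr0n NE.
have Tge : N%:R * ((N%:R - 1) / 2 - S0%:R) <= T%:R :> R.
  have -> : N%:R * ((N%:R - 1) / 2 - S0%:R) = (\sum_(j < N) (j : nat))%N%:R - (N * S0)%:R :> R.
    by rewrite sum_ord_real natrM; field.
  by rewrite lerBlDr -natrD ler_nat /T addnC -leq_subLR.
rewrite -(ler_pM2l Np) mulrCA.
apply: le_trans (ler_wpM2l (ltW w0) Tge) _; rewrite -[ln E *+ T]mulr_natr in lnkey; apply: le_trans lnkey _.
have ln3 := ln3 R.
have hhle : hh <= N%:R * (a * (L1 * S)%:R) + N%:R * (D%:R * (L0%:R * h)).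
  rewrite /hh Dh mulrDr (natrM _ N (L1 * S)) (natrM _ N L0); apply: lerD; last first.
    by rewrite le_eqVlt; apply/orP; left; apply/eqP; ring.
  have -> : D%:R * (N%:R * (L1 * S)%:R * weil_height alpha) = N%:R * (D%:R * weil_height alpha * (L1 * S)%:R) by ring.
  by apply: ler_wpM2l; [exact: ltW | rewrite ler_wpM2r].
have lB : ln B *+ D <= D%:R * (N%:R * ln N%:R + N%:R * (L0%:R * (3 / 2 * K%:R) + (S0 + K)%:R * (4 + ln D%:R) + L0%:R * ln L0%:R)).
  by rewrite [leRHS]mulr_natl lerMn2r lnB orbT.
have lV : (L0%:R * ln (ln E) + ln 3 + a * (L1 * S)%:R) *+ N <=
    N%:R * (L0%:R * ln (ln E) + 2 + a * (L1 * S)%:R).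
  by rewrite [leRHS]mulr_natl lerMn2r; apply/orP; right; rewrite lerD2r lerD2l.
apply: le_trans (lerD (lerD lB lV) hhle) _.
by rewrite le_eqVlt; apply/orP; left; apply/eqP; ring.
Qed.
End Core.

Section Core.
Variable R : realType.
Local Notation C := R[i].

(** From ln d <= d - 1 follows g <= w d^2, so S <= 49 d^2 and M <= 21 a, with 49 * 21 = 1029. For
    this logarithm the terms [ln_plus (ln A)] and [ln D%:R] are present in [b]. *)
Lemma ln_degree_bound (d M S a g w lp lA : R) : 1 <= d -> 1 <= w -> 0 < M -> 0 < S ->
  a = d * lA -> 0 < lA -> w <= a -> g = d * ln d + w -> 
  M * w <= 21 * a -> S * w <= 49 * g -> ln lA <= lp -> 0 <= lp ->
  ln (S * M) <= 8 + 3 * ln d + lp.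
Proof.
move=> d1 w1 M0 S0 Da lA0 wa Dg Ma Sg lpl lp0.
have w0 : 0 < w by lra.
have d0 : 0 < d by lra.
have a0 : 0 < a by lra.
have ld : ln d <= d - 1.
  by have := le_ln1Dx (x := d - 1); rewrite [1 + (d - 1)]addrC subrK; apply; lra.
have ld0 : 0 <= ln d by apply: ln_ge0.
have gd : g <= w * d ^+ 2.
  have h1 : 0 <= d * (d - 1 - ln d) by apply: mulr_ge0; lra.
  have h2 : 0 <= (d - 1) * (w * (d + 1) - d) by apply: mulr_ge0; nra.
  rewrite Dg; lra.
have SM : S * M <= 1029 * (d ^+ 2 * a).
  have S1 : S <= 49 * d ^+ 2 by rewrite -(ler_pM2r w0); lra.
  have M1 : M <= 21 * a by apply: le_trans Ma; rewrite ler_peMr // ltW.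
  by apply: le_trans (ler_pM (ltW S0) (ltW M0) S1 M1) _; lra.
have SMp : 0 < S * M by apply: mulr_gt0.
have h : 0 < d ^+ 2 * a by rewrite mulr_gt0 ?exprn_gt0.
apply: le_trans (_ : ln (1029 * (d ^+ 2 * a)) <= _).
  by rewrite ler_ln ?posrE ?mulr_gt0.
rewrite lnM ?posrE // lnM ?posrE ?exprn_gt0 // lnXn // Da lnM ?posrE //.
have : ln 1029 <= 8 :> R by apply: (ln_le_nat (n := 8)) => //; rewrite !exprS expr0; lra.
lra.
Qed.

Theorem core_bound (alpha beta : C) (D : nat) (A E : R) :
  algebraic_number alpha -> algebraic_number beta -> is_adjoin_degree alpha beta D ->
  alpha != 0 -> beta != 0 -> expR 1 <= E ->
  let w := ln E in let a := D%:R * ln A in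
  let b := weil_height beta + ln_plus (ln A) + ln D%:R + w in
  let g := D%:R * ln D%:R + w in
  0 < ln A ->
  w <= a -> D%:R * weil_height alpha <= a -> normc beta * E <= a ->
  expR (- (10 ^+ 5 * (D%:R * a * b * g / w ^+ 2))) <= normc (cexp beta - alpha).
Proof.
move=> alga algb degD nza nzb Ee w a b g lA0 wa ha Eb.
rewrite leNgt; apply/negP => small.
have D0 : (0 < D)%N := adjoin_degree_gt0 degD.
have D1 : 1 <= D%:R :> R by rewrite ler1n.
have e1 : 1 <= expR 1 :> R by rewrite -[leLHS]expR0 ler_expR.
have E1 : 1 <= E := le_trans e1 Ee.
have E0 : 0 < E := lt_le_trans ltr01 E1.
have w1 : 1 <= w by rewrite -[leLHS]expRK ler_ln ?posrE ?expR_gt0.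
have w0 : 0 < w := lt_le_trans ltr01 w1.
have h0 := weil_height_ge0 algb degD.
have lp0 : 0 <= ln_plus (ln A) by apply: ln_ge0; rewrite le_max lexx.
have lpl : ln (ln A) <= ln_plus (ln A) by rewrite ler_ln ?posrE ?lt_max ?ltr01 // le_max lexx orbT.
have lD0 : 0 <= ln D%:R :> R by apply: ln_ge0.
have wb : w <= b by rewrite /b; lra.
have wg : w <= g by rewrite /g lerDr mulr_ge0.
have b0 : 0 < b := lt_le_trans w0 wb.
have g0 : 0 < g := lt_le_trans w0 wg.
have a0 : 0 < a := lt_le_trans w0 wa.
have param (c y : R) : w <= y -> 1 <= c -> exists n : nat, [/\ (0 < n)%N, c * y <= n%:R * w & n%:R * w <= (c + 1) * y].
  move=> wy c1; have cy : 0 < c * y / w by rewrite !mulr_gt0 ?invr_gt0; lra.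
  have [n /andP[h1 h2]] := ceil_nat (ltW cy).
  have m1 : c * y <= n%:R * w by rewrite -ler_pdivrMr.
  exists n; split => //.
    by rewrite -(ltr0n R); apply: lt_le_trans cy h1.
  have := ler_wpM2r (ltW w0) h2; rewrite mulrDl divfK ?gt_eqF // mul1r; lra.
have [K [K0 K1 K2]] := param 4 b wb (ler1n _ 4).
have [M [M0 M1 M2]] := param 20 a wa (ler1n _ 20).
have [S [Sp S1 S2]] := param 48 g wg (ler1n _ 48).
pose L1 := (16 * D * K)%N; pose L0 := (S * M)%N; pose S0 := (M.+1 * L1)%N; pose n := (L0 * L1)%N.
have nE : n%:R = 16 * (D%:R * (K%:R * M%:R * S%:R)) :> R by rewrite /n /L0 /L1 !natrM; ring.
set U := 10 ^+ 5 * _ in small.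
(* Rounding up leaves at most 5 b, 21 a and 49 g, and 16 * 5 * 21 * 49 * 6 / 5 = 98784 is below
   10^5. The margin 6/5 absorbs ln n + 1 in the proof of [close]. *)
have UN : 6 / 5 * (n%:R * w) <= U.
  have h1 : (K%:R * w) * ((M%:R * w) * (S%:R * w)) <= ((4 + 1) * b) * (((20 + 1) * a) * ((48 + 1) * g)).
    have nn (x : nat) : 0 <= x%:R * w by rewrite mulr_ge0 // ltW.
    by apply: ler_pM => //; [exact: mulr_ge0 | apply: ler_pM].
  rewrite /U mulrA ler_pdivlMr ?exprn_gt0 // nE.
  have -> : 6 / 5 * (16 * (D%:R * (K%:R * M%:R * S%:R)) * w) * w ^+ 2 =
     6 / 5 * 16 * (D%:R * ((K%:R * w) * ((M%:R * w) * (S%:R * w)))) by field.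
  have h2 : 0 <= D%:R * a * b * g by rewrite !mulr_ge0 // ltW.
  have h3 := ler_wpM2l (ler0n R D) h1.
  clear -h2 h3; move: h2 h3; set y := D%:R * (_ * _); move: y => y h2 h3; lra.
have n22 : 1000 <= n%:R :> R.
  have K4 : 4 <= K%:R :> R by rewrite -(ler_pM2r w0); apply: le_trans K1; rewrite ler_pM2l.
  have M20 : 20 <= M%:R :> R by rewrite -(ler_pM2r w0); apply: le_trans M1; rewrite ler_pM2l.
  have S48 : 48 <= S%:R :> R by rewrite -(ler_pM2r w0); apply: le_trans S1; rewrite ler_pM2l.
  have h1 : 4 * 20 * 48 <= K%:R * M%:R * S%:R :> R.
    by apply: ler_pM => //; [exact: mulr_ge0 | apply: ler_pM].
  have h2 : 1 * (4 * 20 * 48) <= D%:R * (K%:R * M%:R * S%:R) :> R.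
    by apply: ler_pM => //; rewrite !mulr_ge0.
  rewrite nE; clear -h2; lra.
have betaa : normc beta <= a by apply: le_trans Eb; rewrite ler_peMr ?normc_ge0.
set H := expR (a * (L1 * S)%:R).
have L1Sn : (L1 * S <= n)%N by rewrite /n /L0 mulnC [(S * M)%N]mulnC -mulnA leq_pmull.
(* Passing to [k]-th powers multiplies the assumed distance by at most [k] times a power of e^|beta|
   + eps. The power is absorbed by [H], and [E ^+ n] by the distance itself. *)
have close k : (k < L1 * S)%N -> E ^+ n * normc (alpha ^+ k - cexp (beta *+ k)) <= H.
  move=> kL; have kn : k%:R <= n%:R :> R by rewrite ler_nat; apply: leq_trans (ltnW kL) L1Sn.
  set eps := expR (- U) in small.
  have eps0 : 0 < eps by apply: expR_gt0.
  set m := expR (normc beta).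
  have m1 : 1 <= m by rewrite -[leLHS]expR0 ler_expR normc_ge0.
  have cm : normc (cexp beta) <= m.
    by rewrite normc_cexp ler_expR; apply: le_trans (ler_norm _) (normc_Re_le _).
  have ac : normc (alpha - cexp beta) <= eps by rewrite -normcN opprB ltW.
  have n0 : 0 < n%:R :> R by apply: lt_le_trans n22.
  have Un : n%:R <= U.
    by apply: le_trans UN; clear -w1 n0; nra.
  have keps : k%:R * eps <= 1.
    apply: le_trans (ler_wpM2r (ltW eps0) kn) _.
    rewrite /eps expRN ler_pdivrMr ?expR_gt0 // mul1r; apply: le_trans (_ : expR n%:R <= _).
      by apply: le_trans (expR_ge1Dx _); rewrite lerDr.
    by rewrite ler_expR.
  rewrite cexpMn; apply: le_trans (ler_wpM2l _ (normc_subX k m1 cm ac)) _.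
    by rewrite exprn_ge0 // ltW.
  have mk : (m + eps) ^+ k <= expR (normc beta * k%:R + 1).
    apply: le_trans (_ : (m * expR eps) ^+ k <= _).
      rewrite lerXn2r ?nnegrE ?addr_ge0 ?mulr_ge0 ?expR_ge0 ?(ltW eps0) //.
      apply: le_trans (_ : m * (1 + eps) <= _); last by rewrite ler_wpM2l ?expR_ge0 ?expR_ge1Dx.
      by rewrite mulrDr mulr1 lerD2l ler_peMl // ltW.
    rewrite exprMn /m -!expRM_natr -expRD ler_expR lerD2l mulrC.
    exact: keps.
  have Ew : E ^+ n = expR (n%:R * w) by rewrite expRM_natl /w lnK.
  have kexp : k%:R * eps <= expR (ln n%:R - U).
    rewrite /eps expRD lnK ?posrE // ler_wpM2r ?expR_ge0 //.
  apply: le_trans (_ : expR (n%:R * w) * (expR (ln n%:R - U) * expR (normc beta * k%:R + 1)) <= _).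
    rewrite Ew ler_wpM2l ?expR_ge0 //; apply: ler_pM => //.
      by rewrite mulr_ge0 // ltW.
    by rewrite exprn_ge0 // addr_ge0 ?ltW // (lt_le_trans ltr01).
  rewrite -!expRD ler_expR.
  have lnn := ln_le_tangent n0.
  have bk : normc beta * k%:R <= a * (L1 * S)%:R.
    by apply: ler_pM; rewrite ?normc_ge0 // ler_nat ltnW.
  have nw : n%:R <= n%:R * w by rewrite ler_peMr // ltW.
  clear -lnn bk nw UN n22; lra.
have EY : E * (S%:R * normc beta) <= L0%:R * ln E.
  rewrite /L0 natrM -/w -mulrA mulrCA ler_wpM2l // [E * _]mulrC; apply: le_trans Eb _; lra.
have EbE : E * normc beta <= a by rewrite mulrC.
have P := liouville_interpolation_inequality alga algb degD nza nzb K0 M0 Sp Ee ha erefl EY erefl EbE close.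
have lL0 : ln L0%:R <= 8 + 3 * ln D%:R + ln_plus (ln A) :> R.
  rewrite /L0 natrM; apply: (ln_degree_bound D1 w1 _ _ (erefl a) lA0 wa (erefl g)) => //; rewrite ?ltr0n //.
    by apply: le_trans M2 _; rewrite natr1.
  by apply: le_trans S2 _; rewrite natr1.
have lnn : ln n%:R <= 5 + ln D%:R + (K%:R * M%:R * S%:R) / 16 :> R.
  have q0 : 0 < K%:R * M%:R * S%:R :> R by rewrite !mulr_gt0 ?ltr0n.
  have Dp : 0 < D%:R :> R by rewrite ltr0n.
  have Dq := mulr_gt0 Dp q0.
  rewrite nE (lnM (_ : 16 \is Num.pos)) ?posrE ?ltr0n // (lnM (_ : D%:R \is Num.pos)) ?posrE //.
  have := ln_le_tangent q0; have := ln16 R; clear; lra.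
have E1' : L1%:R = 16 * D%:R * K%:R :> R by rewrite /L1 !natrM.
have E2' : L0%:R = S%:R * M%:R :> R by rewrite /L0 !natrM.
have E3' : S0%:R = (M%:R + 1) * L1%:R :> R by rewrite /S0 natrM -natr1.
have Dl : D%:R - 1 <= D%:R * ln D%:R :> R by apply: ln_ge_1subV; rewrite ltr0n.
have PI := parameter_inequality D1 w1 wa wb lD0 Dl (erefl g) K1 M1 S1 lnn E1' E2' E3'.
have lw : ln w <= w - 1.
  by have := le_ln1Dx (x := w - 1); rewrite [1 + (w - 1)]addrC subrK; apply; lra.
(* The constant 8 in the bound of ln L0 fits into 8 b because w >= 1. *)
have last : D%:R * L0%:R * ln L0%:R + L0%:R * ln w + D%:R * (L0%:R * weil_height beta) <=
    8 * (D%:R * L0%:R * b).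
  have -> : D%:R * L0%:R * ln L0%:R + L0%:R * ln w + D%:R * (L0%:R * weil_height beta) =
    L0%:R * (D%:R * (ln L0%:R + weil_height beta) + ln w) by ring.
  have -> : 8 * (D%:R * L0%:R * b) = L0%:R * (D%:R * (8 * b)) by ring.
  apply: ler_wpM2l => //.
  apply: le_trans (_ : D%:R * (ln L0%:R + weil_height beta) + D%:R * (w - 1) <= _).
    by rewrite lerD2l; apply: le_trans lw _; rewrite ler_peMl // subr_ge0.
  rewrite -mulrDr; apply: ler_wpM2l => //.
  rewrite /b; clear -lL0 h0 lp0 lD0 w1; lra.
move: P; apply/negP; rewrite -ltNge.
rewrite -/n; have wn : w * n%:R = w * (L0%:R * L1%:R) by rewrite /n natrM.
have -> : ((L1 * S)%N%:R : R) = L1%:R * S%:R by rewrite natrM.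
have -> : ((S0 + K)%N%:R : R) = S0%:R + K%:R by rewrite natrD.
rewrite -/w; rewrite -/L1 -/L0 -/S0; clear -PI last wn; lra.
Qed.
End Core.

(** * Degenerate cases and passage to the logarithm *)

Lemma liouville_sub1 (R : realType) (alpha beta : R[i]) (D : nat) :
  algebraic_number alpha -> algebraic_number beta -> is_adjoin_degree alpha beta D ->
  alpha != 1 ->
  1 <= normc (alpha - 1) * 2 ^+ D.-1 * expR (D%:R * weil_height alpha).
Proof.
move=> alga algb degD na1.
pose P : {poly {poly int}} := ('X - 1)%:P.
have evP (u v : R[i]) : ev2 u v P = u - 1.
  by rewrite /ev2 /= map_polyC /= /horner_eval hornerC rmorphB rmorph1 /= map_polyX hornerD hornerX hornerN hornerC.
have bP : bideg_le 1 0 P.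
  by split=> [|j]; rewrite ?size_polyC_leq1 // coefC; case: eqP => _; rewrite ?size_poly0 // size_XsubC.
have PB (u v : R[i]) : normc (ev2 u v P) <= 2 * Num.max 1 (normc u) ^+ 1 * Num.max 1 (normc v) ^+ 0.
  rewrite evP expr1 expr0 mulr1; apply: le_trans (le_normcD _ _) _.
  by rewrite normcN ComplexField.Normc.normc1 mulrDl mul1r lerD // le_max lexx ?orbT.
have := liouville_two alga algb degD bP (ler0n _ 2) PB.
rewrite evP subr_eq0 => /(_ na1).
by rewrite mul1r mul0r addr0.
Qed.

Theorem theorem5 (R : realType) (alpha beta : R[i])
  (alpha_alg : algebraic_number alpha) (beta_alg : algebraic_number beta)
  (D : nat) (degD : is_adjoin_degree alpha beta D)
  (A E : R) (A_gt0 : 0 < A) (E_gt0 : 0 < E) (E_ge_e : expR 1 <= E)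
  (logA_ge : Num.max (weil_height alpha)
               (Num.max (D%:R^-1 * ln E) (D%:R^-1 * normc beta * E)) <= ln A) :
  let bound := expR (- (1055 * 10 ^+ 2) * D%:R ^+ 2 * ln A
      * (weil_height beta + ln_plus (ln A) + ln D%:R + ln E)
      * (D%:R * ln D%:R + ln E) * ln E ^- 2) in
  (beta != 0 -> bound <= normc (cexp beta - alpha)) /\
  (alpha != 0 -> forall lambda : R[i], lambda != 0 -> cexp lambda = alpha ->
     bound <= normc (beta - lambda)).
Proof.
have D0 : (0 < D)%N := adjoin_degree_gt0 degD.
have Dp : 0 < D%:R :> R by rewrite ltr0n.
have D1 : 1 <= D%:R :> R by rewrite ler1n.
have w1 : 1 <= ln E by rewrite -[leLHS]expRK ler_ln ?posrE ?expR_gt0.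
have w0 : 0 < ln E := lt_le_trans ltr01 w1.
move: logA_ge; rewrite !ge_max => /and3P[ha wa Eb].
have lA0 : 0 < ln A by apply: lt_le_trans wa; rewrite mulr_gt0 ?invr_gt0.
set a := D%:R * ln A.
have {}ha : D%:R * weil_height alpha <= a by rewrite ler_pM2l.
have {}wa : ln E <= a by rewrite /a mulrC -ler_pdivrMr // mulrC.
have {}Eb : normc beta * E <= a by rewrite /a [D%:R * _]mulrC -ler_pdivrMr // mulrC mulrA.
set b := weil_height beta + _ + _ + _; set g := _ + ln E => bound.
have h0 := weil_height_ge0 beta_alg degD.
have lp0 : 0 <= ln_plus (ln A) by apply: ln_ge0; rewrite le_max lexx.
have lD0 : 0 <= ln D%:R :> R by apply: ln_ge0.
have wb : ln E <= b by rewrite lerDr !addr_ge0.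
have wg : ln E <= g by rewrite lerDr mulr_ge0.
have a1 : 1 <= a := le_trans w1 wa.
set X := D%:R * a * b * g / ln E ^+ 2.
have DX : bound = expR (- (1055 * 10 ^+ 2 * X)).
  by rewrite /bound /X /a; congr expR; field; rewrite gt_eqF.
have XDa : D%:R * a <= X.
  rewrite /X ler_pdivlMr ?exprn_gt0 // -[leRHS]mulrA expr2.
  apply: ler_wpM2l; first by rewrite mulr_ge0 // (le_trans ler01 a1).
  by apply: ler_pM => //; apply: ltW.
have Xa : a <= X by apply: le_trans XDa; rewrite ler_peMl // (le_trans ler01).
have XD : D%:R <= X by apply: le_trans XDa; rewrite ler_peMr.
have E1 : 1 <= E by apply: le_trans E_ge_e; rewrite -[leLHS]expR0 ler_expR.
have ba : normc beta <= a by apply: le_trans Eb; rewrite ler_peMr ?normc_ge0.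
have strong : beta != 0 -> expR (- (10 ^+ 5 * X)) <= normc (cexp beta - alpha).
  move=> nzb; have [a0|nza] := eqVneq alpha 0.
    (* The interpolation argument needs a point of the multiplicative group; for alpha = 0 it is
       enough that |e^beta| >= e^(-|beta|). *)
    rewrite a0 subr0 normc_cexp ler_expR.
    have := normc_Re_le beta; rewrite ler_norml => /andP[h _].
    apply: le_trans h; rewrite lerN2; clear -ba Xa a1; lra.
  exact: core_bound.
have two_e : 2 <= expR 1 :> R by apply: le_trans (expR_ge1Dx 1).
split=> [nzb|nza lambda nzl el].
  apply: le_trans (strong nzb); rewrite DX ler_expR lerN2.
  by clear -Xa a1; lra.
rewrite leNgt; apply/negP => small.
have bound1 : bound <= 1 by rewrite DX -[leRHS]expR0 ler_expR; clear -Xa a1; lra.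
have [b0|nzb] := eqVneq beta 0.
  move: small; rewrite b0 sub0r normcN => small.
  have l1 : normc lambda < 1 := lt_le_trans small bound1.
  (* A logarithm of 1 of modulus less than 1 is zero, so [lambda != 0] excludes alpha = 1. *)
  have na1 : alpha != 1.
    by apply: contraNneq nzl => a_1; rewrite (cexp_eq1_small l1) // el.
  have := liouville_sub1 alpha_alg beta_alg degD na1.
  apply/negP; rewrite -ltNge.
  have h1 : normc (alpha - 1) <= 2 * normc lambda by rewrite -el norm_cexp_sub1_le // ltW.
  apply: le_lt_trans (_ : 2 ^+ D * bound * expR a < 1).
    apply: ler_pM; rewrite ?mulr_ge0 ?normc_ge0 ?expR_ge0 ?exprn_ge0 ?ler_expR //.
    rewrite -(prednK D0) exprS [2 * _]mulrC -mulrA [leLHS]mulrC ler_wpM2l ?exprn_ge0 //.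
    by apply: le_trans h1 _; rewrite ler_wpM2l // ltW.
  apply: le_lt_trans (_ : expR D%:R * bound * expR a < 1).
    rewrite ler_wpM2r ?expR_ge0 // ler_wpM2r ?expR_ge0 //.
    by rewrite -[D%:R]mulr1 expRM_natl lerXn2r ?nnegrE ?expR_ge0.
  rewrite DX -!expRD -[ltRHS]expR0 ltr_expR; clear -XD Xa a1; lra.
have := strong nzb; apply/negP; rewrite -ltNge -el.
(* A small distance from beta to lambda makes e^beta close to alpha, at the cost of a factor 2 e^a,
   in contradiction with [strong]. *)
have -> : cexp beta - cexp lambda = - (cexp beta * (cexp (lambda - beta) - 1)).
  by rewrite mulrBr mulr1 -cexpD [beta + _]addrC subrK opprB.
rewrite normcN ComplexField.Normc.normcM normc_cexp.
have sm : normc (lambda - beta) < bound by rewrite -normcN opprB.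
apply: le_lt_trans (_ : expR a * (2 * normc (lambda - beta)) < _).
  apply: ler_pM; rewrite ?expR_ge0 ?normc_ge0 // ?ler_expR.
    exact: le_trans (ler_norm _) (le_trans (normc_Re_le _) ba).
  by apply: norm_cexp_sub1_le; apply/ltW/(lt_le_trans sm).
apply: lt_le_trans (_ : expR a * (expR 1 * bound) <= _).
  rewrite ltr_pM2l ?expR_gt0 //; apply: le_lt_trans (ler_wpM2r (normc_ge0 _) two_e) _.
  by rewrite ltr_pM2l ?expR_gt0.
by rewrite DX -!expRD ler_expR; clear -Xa a1; lra.
Qed.
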